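(* In the setting below, for each $0\le k\le g$ let $\psi_k$ be the $N_k$-th approximate root of $F$, $\psi_{-1}=x$, $\Psi=(\psi_{-1},\dots,\psi_k)$, and $F=\sum_{B\in\mathcal{B}}f'_B\Psi^B$ the $\Psi$-adic expansion. Let $w'_i:=\min\{\langle B,V\rangle : b_k=i,\ f'_B\ne0\}-v_k(F)$ and $\bar H'_k:=\sum_{(i,w'_i)\in\mathcal{N}(H_k)}\big(\sum_{B\in\mathcal{B}(i,w'_i+v_k(F))}f'_B\Lambda^{B-B_0}\big)x^{w'_i}y^i$, with $B_0=(0,\dots,0,N_k)$. Then $\bar H_k=\bar H'_k$ for $0\le k<g$, where $\bar H_k$ is the boundary polynomial of $H_k$; and $\bar H_g$ and $\bar H'_g$ have the same restriction to the lower edge of the Newton polygon of $H_g$.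
   Context: Setting. $\mathbb{K}$ perfect, $F\in\mathbb{K}[[x]][y]$ monic of degree $d$, $\mathrm{char}\,\mathbb{K}=0$ or $>d$. The $N$-th approximate root ($N\mid d$) is the unique monic $\psi$ of degree $d/N$ with $\deg(F-\psi^N)<d-d/N$. Newton polygon of $H=\sum h_iy^i$: lower convex hull of $(i,\mathrm{val}_xh_i)$; principal Newton polygon: its negative-slope edges; boundary polynomial: terms $h_{ij}x^jy^i$ with $(i,j)$ on the polygon; lower edge: edge with right endpoint $(\deg H,0)$. $H$ degenerated: polygon straight of slope $-m/q$ and boundary polynomial $c(P(y^q/x^m)x^{\varepsilon m\deg P})^N$ ($c\ne0$, $P$ monic irreducible, $\varepsilon=1$ if $m\ge0$ else $0$); edge data $(q,m,P,N)$, $\ell=\deg P$. Procedure: $\mathbb{K}_0=\mathbb{K}$, $N_0=d$, $\tau_0(x,y)=(x,y-a_{d-1}/d)$, $H_0=F\circ\tau_0$; for $k\ge0$, if $N_k=1$ or $H_k$ is not degenerated over $\mathbb{K}_k$ (w.r.t. Newton polygon if $k=0$, principal one if $k\ge1$), set $g=k$ and stop; else, with edge data $(q_{k+1},m_{k+1},P_{k+1},N_{k+1})$, $\mathbb{K}_{k+1}=\mathbb{K}_k[Z]/(P_{k+1})$, $z_{k+1}=Z\bmod P_{k+1}$, $q s-m t=1$, $0\le t<q$, $\sigma_{k+1}(x,y)=(z_{k+1}^tx^{q},x^{m}(y+z_{k+1}^s))$, write $H_k\circ\sigma_{k+1}=x^aUG$ ($U(0,0)\ne0$, $G$ Weierstrass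 of degree $N_{k+1}$), $\tau_{k+1}(x,y)=(x,y-\gamma(x)/N_{k+1})$ with $\gamma$ the coefficient of $y^{N_{k+1}-1}$ in $G$, $H_{k+1}=G\circ\tau_{k+1}$. $\pi_0=\tau_0$, $\pi_k=\pi_{k-1}\circ\sigma_k\circ\tau_k=(\mu_kx^{e_k},\alpha_kx^{r_k}y+S_k(x))$; $\phi_i$ the unique monic irreducible polynomial of $\mathbb{K}[[x]][y]$ with $\phi_i(\mu_ix^{e_i},S_i(x))=0$, $\phi_{-1}=x$. $v_k(H)=\mathrm{val}_x(H\circ\pi_k)$, $\lambda_k(H)$ = trailing $y$-coefficient of $((H\circ\pi_k)/x^{v_k(H)})|_{x=0}$. $\mathcal{B}=\{B\in\mathbb{N}^{k+2}:b_{i-1}<q_i\ell_i,\ 1\le i\le k\}$, $\Psi^B=\prod\psi_i^{b_i}$ (expansion unique with coefficients in $\mathbb{K}$); $V=(v_k(\phi_i))_{i=-1}^k$, $\Lambda=(\lambda_k(\phi_i))_{i=-1}^k$, $\Lambda^B=\prod\lambda_k(\phi_i)^{b_i}$; $\mathcal{B}(i,w)=\{B\in\mathcal{B}:b_k=i,\ \langle B,V\rangle=w\}$; $\mathcal{N}(H_k)$ is the Newton polygon of $H_k$. *)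

(* Defs.v *)
(* Formal power series / polynomials in y over K[[x]] are
   encoded as bivariate coefficient functions  h : nat -> nat -> R,
   h i j = coefficient of  x^j y^i  (so (i,j) is the Newton-polygon point). *)
From HB Require Import structures.
From mathcomp Require Import all_boot all_order all_algebra.
From Stdlib Require Import ClassicalEpsilon.
Set Implicit Arguments.
Unset Strict Implicit.
Unset Printing Implicit Defensive.
Import Order.TTheory GRing.Theory Num.Theory.
Local Open Scope ring_scope.

Definition bser (R : Type) := nat -> nat -> R.

Section Series.
Variable R : comNzRingType.

Definition bone : bser R := fun i j => ((i == 0%N) && (j == 0%N))%:R.
Definition bxser : bser R := fun i j => ((i == 0%N) && (j == 1%N))%:R.
Definition bxpow (a : nat) : bser R := fun i j => ((i == 0%N) && (j == a))%:R.
Definition bsub (h g : bser R) : bser R := fun i j => h i j - g i j.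
Definition bmul (h g : bser R) : bser R :=
  fun i j => \sum_(u < i.+1) \sum_(v < j.+1) h u v * g (i - u)%N (j - v)%N.
Definition bexp (h : bser R) (n : nat) : bser R := iter n (bmul h) bone.

Definition ydeg_le (h : bser R) (n : nat) := forall i j, (n < i)%N -> h i j = 0.
Definition ydeg_lt (h : bser R) (n : nat) := forall i j, (n <= i)%N -> h i j = 0.
Definition ymonic (h : bser R) (n : nat) :=
  ydeg_le h n /\ h n 0%N = 1 /\ forall j, (0 < j)%N -> h n j = 0.
Definition bpoly (h : bser R) := exists n, ydeg_le h n.
Definition bunit (h : bser R) := exists h', bpoly h' /\ bmul h h' = bone.
Definition birreducible (h : bser R) :=
  bpoly h /\ h <> (fun _ _ => 0) /\ ~ bunit h /\
  forall a b, bpoly a -> bpoly b -> bmul a b = h -> bunit a \/ bunit b.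
Definition weierstrass (h : bser R) (n : nat) :=
  ymonic h n /\ forall i, (i < n)%N -> h i 0%N = 0.

(* substitution maps  (x,y) |-> (c x^e, Y(x,y)) *)
Record smap := SMap { mc : R; me : nat; mY : bser R }.

(* H o (c x^e, Y), for H of y-degree <= n, and e >= 1 *)
Definition bcomp (n : nat) (h : bser R) (f : smap) : bser R :=
  fun i' j' => \sum_(i < n.+1) \sum_(j < j'.+1 | (me f * j <= j')%N)
      h i j * mc f ^+ j * bexp (mY f) i i' (j' - me f * j)%N.
Definition mcomp (f g : smap) : smap :=
  SMap (mc f * mc g ^+ me f) (me f * me g)%N (bcomp 1 (mY f) g).
Definition tshift (c : nat -> R) : smap :=
  SMap 1 1 (fun i j => if i == 1%N then (j == 0%N)%:R else if i == 0%N then c j else 0).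
(* sigma : (x,y) |-> (z^t x^q, x^m (y + z^s)) *)
Definition sigmap (z : R) (q m s t : nat) : smap :=
  SMap (z ^+ t) q (fun i j => if j == m then
                               (if i == 1%N then 1 else if i == 0%N then z ^+ s else 0)
                             else 0).

Definition supline (h : bser R) (a b c : int) :=
  0 < b /\ forall i j, h i j != 0 -> c <= a * (i%:Z) + b * (j%:Z).
(* (i,w) lies on the Newton polygon, using only supporting lines  a*i+b*j=c
   whose coefficient a satisfies A (A = True : Newton polygon;
   A = (0 < a) : principal Newton polygon, i.e. negative-slope edges) *)
Definition on_np (A : int -> Prop) (h : bser R) (i : nat) (w : int) :=
  exists a b c i1 j1 i2 j2, A a /\ supline h a b c /\
    h i1 j1 != 0 /\ h i2 j2 != 0 /\
    a * i1%:Z + b * j1%:Z = c /\ a * i2%:Z + b * j2%:Z = c /\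
    (i1 <= i <= i2)%N /\ a * i%:Z + b * w = c.
Definition npT : int -> Prop := fun _ => True.
Definition npP : int -> Prop := fun a => 0 < a.
Definition on_lower (h : bser R) (n : nat) (i : nat) (w : int) :=
  exists a b c i1 j1, supline h a b c /\ h i1 j1 != 0 /\ h n 0%N != 0 /\
    a * i1%:Z + b * j1%:Z = c /\ a * n%:Z = c /\ (i1 < n)%N /\
    (i1 <= i <= n)%N /\ a * i%:Z + b * w = c.
Definition straight (A : int -> Prop) (h : bser R) (m q : nat) :=
  A m%:Z /\ exists c, supline h m%:Z q%:Z c /\
   (exists i1 j1 i2 j2, (i1 < i2)%N /\ h i1 j1 != 0 /\ h i2 j2 != 0 /\
        m%:Z * i1%:Z + q%:Z * j1%:Z = c /\ m%:Z * i2%:Z + q%:Z * j2%:Z = c) /\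
   forall i j, h i j != 0 -> on_np A h i j%:Z -> m%:Z * i%:Z + q%:Z * j%:Z = c.
Definition bnd (A : int -> Prop) (h : bser R) : bser R :=
  fun i j => if excluded_middle_informative (on_np A h i j%:Z) then h i j else 0.
(* P(y^q/x^m) x^(m deg P) *)
Definition Pbiv (P : {poly R}) (q m : nat) : bser R :=
  fun i j => if [&& (q %| i)%N, (i %/ q <= (size P).-1)%N &
                    j == (m * ((size P).-1 - i %/ q))%N] then P`_(i %/ q) else 0.

Definition polyover (Kp : R -> Prop) (P : {poly R}) := forall u, Kp P`_u.
Definition irr_over (Kp : R -> Prop) (P : {poly R}) :=
  (1 < size P)%N /\ forall a b, polyover Kp a -> polyover Kp b -> P = a * b ->
     size a = 1%N \/ size b = 1%N.

Definition degen (A : int -> Prop) (Kp : R -> Prop) (h : bser R)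
    (q m : nat) (P : {poly R}) (N : nat) :=
  (0 < q)%N /\ coprime q m /\ straight A h m q /\
  P \is monic /\ polyover Kp P /\ irr_over Kp P /\
  exists c, c != 0 /\ forall i j, bnd A h i j = c * bexp (Pbiv P q m) N i j.

Definition vval (h : bser R) : nat :=
  epsilon (inhabits 0%N) (fun v => (exists i, h i v != 0) /\
                                  forall i j, h i j != 0 -> (v <= j)%N).
Definition lval (h : bser R) : R :=
  epsilon (inhabits 0) (fun l => exists i0, h i0 (vval h) = l /\ l != 0 /\
                                    forall i, (i < i0)%N -> h i (vval h) = 0).
Definition fsum (S : seq nat -> Prop) (f : seq nat -> R) : R :=
  epsilon (inhabits 0) (fun v => exists s, uniq s /\ (forall B, B \in s <-> S B) /\
                                     v = \sum_(B <- s) f B).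
End Series.

Arguments bone {R}.
Arguments bxser {R}.
Arguments bxpow {R}.

Definition bmap (K L : comNzRingType) (f : K -> L) (h : bser K) : bser L :=
  fun i j => f (h i j).

Definition perfect_field (K : fieldType) :=
  forall p, p \in [pchar K] -> forall a : K, exists b, b ^+ p = a.

Record run (L : fieldType) := Run {
  gg : nat;
  Kf : nat -> L -> Prop;       (* K_k as subfields of L *)
  Nn : nat -> nat;
  qq : nat -> nat; mm : nat -> nat; ss : nat -> nat; tt : nat -> nat;
  PP : nat -> {poly L};
  zz : nat -> L;
  aa : nat -> nat; UU : nat -> bser L; GG : nat -> bser L;
  HH : nat -> bser L;
  pi : nat -> smap L }.

Definition Apoly (k : nat) : int -> Prop := if k == 0%N then npT else npP.

Definition tau0 (K L : fieldType) (iota : K -> L) (d : nat) (F : bser K) : smap L :=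
  tshift (fun j => - iota (F d.-1 j) / d%:R).

Definition is_run (K L : fieldType) (iota : K -> L) (d : nat) (F : bser K)
    (r : run L) : Prop :=
  (forall c, Kf r 0 c <-> exists b, c = iota b) /\
  Nn r 0 = d /\
  HH r 0 = bcomp d (bmap iota F) (tau0 iota d F) /\
  pi r 0 = tau0 iota d F /\
  (forall k, (k < gg r)%N ->
     let sig := sigmap (zz r k.+1) (qq r k.+1) (mm r k.+1) (ss r k.+1) (tt r k.+1) in
     let tau := tshift (fun j => - GG r k.+1 (Nn r k.+1).-1 j / (Nn r k.+1)%:R) in
     Nn r k <> 1%N /\
     degen (Apoly k) (Kf r k) (HH r k) (qq r k.+1) (mm r k.+1) (PP r k.+1) (Nn r k.+1) /\
     root (PP r k.+1) (zz r k.+1) /\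
     (forall c, Kf r k.+1 c <-> exists p, polyover (Kf r k) p /\ c = p.[zz r k.+1]) /\
     (qq r k.+1 * ss r k.+1 = mm r k.+1 * tt r k.+1 + 1)%N /\
     (tt r k.+1 < qq r k.+1)%N /\
     bcomp (Nn r k) (HH r k) sig = bmul (bxpow (aa r k.+1)) (bmul (UU r k.+1) (GG r k.+1)) /\
     UU r k.+1 0%N 0%N != 0 /\
     weierstrass (GG r k.+1) (Nn r k.+1) /\
     HH r k.+1 = bcomp (Nn r k.+1) (GG r k.+1) tau /\
     pi r k.+1 = mcomp (mcomp (pi r k) sig) tau) /\
  (Nn r (gg r) = 1%N \/
   ~ exists q m P N, degen (Apoly (gg r)) (Kf r (gg r)) (HH r (gg r)) q m P N).

Section Objects.
Variables (K L : fieldType) (iota : K -> L) (d : nat) (F : bser K) (r : run L).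
Variables (psi phi : nat -> bser K) (phideg : nat -> nat) (fp : nat -> seq nat -> K).

Definition approx_root (N : nat) (p : bser K) :=
  ymonic p (d %/ N) /\ ydeg_lt (bsub F (bexp p N)) (d - d %/ N).

Definition Sser (k : nat) : bser L :=
  fun i j => if i == 0%N then mY (pi r k) 0%N j else 0.
Definition phi_spec (k : nat) :=
  ymonic (phi k) (phideg k) /\ birreducible (phi k) /\
  bcomp (phideg k) (bmap iota (phi k)) (SMap (mc (pi r k)) (me (pi r k)) (Sser k))
    = (fun _ _ => 0).

(* the multi-index set  calB  (position p of B stores b_{p-1}) *)
Definition inB (k : nat) (B : seq nat) :=
  size B = k.+2 /\ forall i, (1 <= i <= k)%N -> (nth 0%N B i < qq r i * (size (PP r i)).-1)%N.

Definition PsiB (k : nat) (B' : seq nat) : bser K :=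
  \big[@bmul K/bone]_(t < k.+1) bexp (psi t) (nth 0%N B' t).
Definition expansion (k : nat) :=
  (forall B, ~ inB k B -> fp k B = 0) /\
  exists s : seq (seq nat), uniq s /\ (forall B, fp k B != 0 -> behead B \in s) /\
    forall i j, F i j = \sum_(B' <- s)
        bmul (fun u v => if u == 0%N then fp k (v :: B') else 0) (PsiB k B') i j.

Definition vk (k : nat) (h : bser K) (n : nat) : nat := vval (bcomp n (bmap iota h) (pi r k)).
Definition lk (k : nat) (h : bser K) (n : nat) : L := lval (bcomp n (bmap iota h) (pi r k)).
Definition phiP (p : nat) : bser K := if p == 0%N then bxser else phi p.-1.
Definition degP (p : nat) : nat := if p == 0%N then 0%N else phideg p.-1.
Definition VV (k p : nat) : nat := vk k (phiP p) (degP p).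
Definition LL (k p : nat) : L := lk k (phiP p) (degP p).
Definition dotBV (k : nat) (B : seq nat) : nat := \sum_(p < k.+2) nth 0%N B p * VV k p.
Definition vF (k : nat) : nat := vk k F d.
Definition LamB (k : nat) (B : seq nat) : L :=
  (\prod_(p < k.+1) LL k p ^+ nth 0%N B p) *
  LL k k.+1 ^ ((nth 0%N B k.+1)%:Z - (Nn r k)%:Z).

Definition wmin (k i w : nat) :=
  (exists B, inB k B /\ nth 0%N B k.+1 = i /\ fp k B != 0 /\ dotBV k B = w) /\
  forall B, inB k B -> nth 0%N B k.+1 = i -> fp k B != 0 -> (w <= dotBV k B)%N.

Definition Hprime (k i : nat) (j : int) : L :=
  if excluded_middle_informative
       (exists w, wmin k i w /\ j = w%:Z - (vF k)%:Z /\ on_np npT (HH r k) i j)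
  then fsum (fun B => inB k B /\ nth 0%N B k.+1 = i /\ (dotBV k B)%:Z = j + (vF k)%:Z)
            (fun B => iota (fp k B) * LamB k B)
  else 0.
Definition Hbar (k i : nat) (j : int) : L :=
  if excluded_middle_informative (0 <= j /\ on_np npT (HH r k) i j)
  then HH r k i `|j|%N else 0.
End Objects.

(* Main.v *)
(** For weights (m, q) given by an edge ending at (N_k, 0), look at leading monomials
    of the pullbacks under pi_k.

    For i < k the pullbacks of psi_i and phi_i are both lambda x^v times a unit
    congruent to 1, with the same lambda and v, and those of psi_k and phi_k have
    the same leading monomial lambda x^V y.  The latter holds for phi_k because its
    residual polynomial vanishes at z_k, hence is a multiple of P_k, and P_k is
    separable; it passes to psi_k through the Tschirnhaus iteration
    theta -> theta + a_{N-1}/N, which starts at phi_k, stops at the approximate root,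
    and never changes the leading monomial since H_k has no term in y^{N_k - 1}.

    At each level the products Lambda^B of given weight (with b_k = 0) are linearly
    independent over K, since distinct exponents of a given weight correspond to
    distinct powers of z_k below deg P_k.  So in F = sum_i c_i psi_k^i no
    cancellation occurs inside c_i, nor between different i, whose leading monomials
    have different y-degrees: the part of F o pi_k on the edge can be read off from
    the expansion.  On the other side F o pi_k = x^v U H_k with U(0,0) = lambda^{N_k}.

    The phi_k are identified with characteristic polynomials: K_k[[x]] is spanned by
    deg phi_k elements over K[[mu_k x^{e_k}]], and a nonzero polynomial of smaller
    degree cannot vanish on the parametrization. *)
Require Import Defs.
From HB Require Import structures.
From mathcomp Require Import all_boot all_order all_algebra.
From mathcomp Require Import boolp zify ring.
Set Implicit Arguments.
Unset Strict Implicit.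
Unset Printing Implicit Defensive.
Import GRing.Theory.
Local Open Scope ring_scope.

(** * Formal power series *)

(** The obstacle is that psi_k is controlled only for those weights (m, q) for which H_k has weight
    at least m N_k, because the Tschirnhaus iteration compares theta with F. The earlier psi_t, t <
    k, need a leading monomial for all weights with m > 0. The two fit together because sigma_{k+1}
    turns the edge weight of H_k into the order in x: a leading monomial for this single weight at
    level k gives one for every admissible weight at level k+1.

    The arithmetic behind the powers of z is q s - m t = 1. A monomial x^D y^i with q D + m i = c
    acquires the factor z^(t D + s i), and q (t D + s i) = t c + i. Hence the indices i on one line
    are congruent mod q, and the exponent of z grows by one when i grows by q; for i < q deg P only
    deg P consecutive powers occur.

    The definition of phi_k does not give its degree, on which its expansion in psi_{k-1} depends;
    the degree is found from psi_0, ..., psi_{k-1} alone, before the leading monomial of phi_k.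
    Separability of P_k at z_k comes from 0 < deg P_k <= d < char K (or characteristic zero). *)

Definition ser (R : Type) := nat -> R.
HB.instance Definition _ (R : Type) := gen_eqMixin (ser R).
HB.instance Definition _ (R : Type) := gen_choiceMixin (ser R).

Lemma serP (R : Type) (f g : ser R) : f =1 g -> f = g.
Proof. exact: funext. Qed.

Section SerRing.
Variable R : comNzRingType.
Implicit Types f g h : ser R.

Definition ser_add f g : ser R := fun n => f n + g n.
Definition ser_opp f : ser R := fun n => - f n.
Definition ser_zero : ser R := fun n => 0.
Definition ser_one : ser R := fun n => (n == 0)%:R.
Definition ser_mul f g : ser R := fun n => \sum_(i < n.+1) f i * g (n - i)%N.

Fact ser_addA : associative ser_add.
Proof. by move=> f g h; apply: serP => n; rewrite /ser_add addrA. Qed.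
Fact ser_addC : commutative ser_add.
Proof. by move=> f g; apply: serP => n; rewrite /ser_add addrC. Qed.
Fact ser_add0 : left_id ser_zero ser_add.
Proof. by move=> f; apply: serP => n; rewrite /ser_add add0r. Qed.
Fact ser_addN : left_inverse ser_zero ser_opp ser_add.
Proof. by move=> f; apply: serP => n; rewrite /ser_add addNr. Qed.

HB.instance Definition _ :=
  GRing.isZmodule.Build (ser R) ser_addA ser_addC ser_add0 ser_addN.

Definition trunc (N : nat) f : {poly R} := \poly_(i < N) f i.

(** Coefficient n of a product sees only coefficients up to n, so associativity and commutativity
    are inherited from [{poly R}]. *)
Lemma ser_mul_trunc f g n N : (n < N)%N ->
  ser_mul f g n = (trunc N f * trunc N g)`_n.
Proof.
move=> nN; rewrite coefM; apply: eq_bigr => i _.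
rewrite !coef_poly (leq_ltn_trans (leq_ord i) nN).
by rewrite (leq_ltn_trans (leq_subr _ _) nN).
Qed.

Fact ser_mulA : associative ser_mul.
Proof.
move=> f g h; apply: serP => n.
have -> : ser_mul f (ser_mul g h) n
        = (trunc n.+1 f * (trunc n.+1 g * trunc n.+1 h))`_n.
  rewrite coefM; apply: eq_bigr => i _.
  by rewrite coef_poly ltn_ord (@ser_mul_trunc _ _ _ n.+1) // ltnS leq_subr.
rewrite mulrA coefM; apply: eq_bigr => i _.
by rewrite (@ser_mul_trunc _ _ _ n.+1) // coef_poly ltnS leq_subr.
Qed.
Fact ser_mulC : commutative ser_mul.
Proof.
by move=> f g; apply: serP => n; rewrite !(@ser_mul_trunc _ _ _ n.+1) // mulrC.
Qed.
Fact ser_mul1 : left_id ser_one ser_mul.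
Proof.
move=> f; apply: serP => n; rewrite /ser_mul big_ord_recl /ser_one /= mul1r subn0.
by rewrite big1 ?addr0 // => i _; rewrite mul0r.
Qed.
Fact ser_mulD : left_distributive ser_mul ser_add.
Proof.
move=> f g h; apply: serP => n.
by rewrite /ser_mul /ser_add -big_split; apply: eq_bigr => i _; rewrite mulrDl.
Qed.
Fact ser_one_neq0 : ser_one != 0.
Proof. by apply/eqP => /(congr1 (@^~ 0%N)) /eqP; rewrite /ser_one /= oner_eq0. Qed.

HB.instance Definition _ :=
  GRing.Zmodule_isComNzRing.Build (ser R)
    ser_mulA ser_mulC ser_mul1 ser_mulD ser_one_neq0.

Lemma serD f g n : (f + g) n = f n + g n. Proof. by []. Qed.
Lemma serN f n : (- f) n = - f n. Proof. by []. Qed.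
Lemma ser0 n : (0 : ser R) n = 0. Proof. by []. Qed.
Lemma ser1 n : (1 : ser R) n = (n == 0)%:R. Proof. by []. Qed.
Lemma serM f g n : (f * g) n = \sum_(i < n.+1) f i * g (n - i)%N.
Proof. by []. Qed.
Lemma ser_sum (I : Type) (r : seq I) (P : pred I) (F : I -> ser R) n :
  (\sum_(i <- r | P i) F i) n = \sum_(i <- r | P i) F i n.
Proof. exact: (big_morph (fun f : ser R => f n) (fun f g => serD f g n) (ser0 n)). Qed.
Lemma ser_mulr0 f g : (f * g) 0%N = f 0%N * g 0%N.
Proof. by rewrite serM big_ord1. Qed.

Definition sC (c : R) : ser R := fun n => if n == 0 then c else 0.
Definition sX (a : nat) : ser R := fun n => (n == a)%:R.

Lemma sXM a f n : (sX a * f) n = if (a <= n)%N then f (n - a)%N else 0.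
Proof.
rewrite serM; case: leqP => an.
  rewrite (bigD1 (inord a)) //= inordK ?ltnS // {1}/sX eqxx mul1r big1 ?addr0 //.
  move=> i ia; rewrite /sX; case: eqP => [e|]; last by rewrite mul0r.
  by case/eqP: ia; apply: val_inj; rewrite /= inordK ?ltnS // -e.
rewrite big1 // => i _; rewrite /sX; case: eqP => [e|]; last by rewrite mul0r.
by have := ltn_ord i; lia.
Qed.
Lemma sCM c f n : (sC c * f) n = c * f n.
Proof.
rewrite serM big_ord_recl /sC /= subn0 big1 ?addr0 // => i _.
by rewrite mul0r.
Qed.
Lemma sX0 : sX 0 = 1. Proof. by apply: serP. Qed.
Lemma sC1 : sC 1 = 1. Proof. by apply: serP => n; rewrite ser1 /sC; case: eqP. Qed.
Lemma sC0 : sC 0 = 0. Proof. by apply: serP => n; rewrite /sC if_same. Qed.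
Lemma sCMC a b : sC (a * b) = sC a * sC b.
Proof. by apply: serP => n; rewrite sCM /sC; case: eqP; rewrite ?mulr0. Qed.
Lemma sXD a b : sX (a + b) = sX a * sX b.
Proof.
apply: serP => n; rewrite sXM /sX; case: leqP => an; last by case: eqP => //; lia.
by congr (_%:R); apply/eqP/eqP; lia.
Qed.
Lemma sX_exp a n : sX a ^+ n = sX (a * n).
Proof. by elim: n => [|n IH]; rewrite ?muln0 ?sX0 // exprS IH mulnS sXD. Qed.

(* The exponent is taken to be e.-1.+1 so that the morphism instance below is
   unconditional; only 0 < e is meaningful. *)
Definition ssub (z : R) (e : nat) f : ser R :=
  fun n => if (e.-1.+1 %| n)%N then f (n %/ e.-1.+1)%N * z ^+ (n %/ e.-1.+1) else 0.

Lemma ssubE z e f n : (0 < e)%N ->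
  ssub z e f n = if (e %| n)%N then f (n %/ e)%N * z ^+ (n %/ e) else 0.
Proof. by rewrite /ssub => /prednK ->. Qed.

(** [bcomp] indexes powers of x by j with e j at most n, the Cauchy product by the exponent itself;
    this passes from one to the other. *)
Lemma sum_dvdn e n (F : nat -> R) : (0 < e)%N ->
  \sum_(i < n.+1 | (e %| i)%N) F i
  = \sum_(j < n.+1 | (e * j <= n)%N) F (e * j)%N.
Proof.
move=> e0; symmetry; rewrite (reindex_onto (fun i : 'I_n.+1 => inord (i %/ e))
   (fun j : 'I_n.+1 => inord (e * j))) /=.
  apply: eq_big => i.
    have iN := ltn_ord i; have le : (i %/ e <= i)%N by apply: leq_div.
    rewrite inordK; last by lia.
    apply/andP/idP => [[le2 /eqP/(congr1 val)]|dv].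
      by rewrite /= inordK ?ltnS // => <-; rewrite dvdn_mulr.
    rewrite mulnC divnK //; split; first by rewrite -ltnS.
    by apply/eqP/val_inj; rewrite /= inordK // ltn_ord.
  case/andP=> le2 /eqP/(congr1 val) /= e1.
  by rewrite -[in RHS]e1; congr F; rewrite (@inordK _ (e * _)).
move=> j le; apply: val_inj; rewrite /= (inordK (m := e * j)) ?ltnS //.
by rewrite mulKn // inord_val.
Qed.

Lemma ssubM_coef z e f g n : (0 < e)%N ->
  (ssub z e f * g) n
  = \sum_(j < n.+1 | (e * j <= n)%N) f j * z ^+ j * g (n - e * j)%N.
Proof.
move=> e0; rewrite serM.
transitivity (\sum_(i < n.+1 | (e %| i)%N)
   f (i %/ e)%N * z ^+ (i %/ e) * g (n - i)%N).
  rewrite [RHS]big_mkcond; apply: eq_bigr => i _; rewrite ssubE //.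
  by case: ifP => // _; rewrite mul0r.
rewrite (sum_dvdn _ (fun i => f (i %/ e)%N * z ^+ (i %/ e) * g (n - i)%N)) //.
by apply: eq_bigr => j _; rewrite mulKn.
Qed.

Fact ssub_additive z e : zmod_morphism (ssub z e).
Proof.
move=> f g; apply: serP => n; rewrite serD serN /ssub; case: ifP => _.
  by rewrite serD serN mulrBl.
by rewrite subrr.
Qed.
Fact ssub_monoid z e : monoid_morphism (ssub z e).
Proof.
split.
  apply: serP => n; rewrite /ssub !ser1; case: ifP => dv; last first.
    by case: eqP => // n0; rewrite n0 dvdn0 in dv.
  case: (n =P 0%N) => [->|n0]; first by rewrite div0n eqxx mul1r.
  case: eqP => [d0|]; last by rewrite mul0r.
  by case: n0; rewrite -(divnK dv) d0.
move=> f g; apply: serP => n.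
rewrite -[ssub z e f]/(ssub z e.-1.+1 f) ssubM_coef // {1}/ssub /=.
set e' := e.-1.+1; case: ifP => dv.
  rewrite serM mulr_suml -(divnK dv) mulnK //; set k := (n %/ e')%N.
  transitivity (\sum_(i < (k * e').+1 | (i < k.+1)%N) f i * g (k - i)%N * z ^+ k).
    by rewrite -(@big_ord_widen _ _ _ _ _ (fun i => f i * g (k - i)%N * z ^+ k)) //
       ltnS leq_pmulr.
  apply: eq_big => [i|i ik]; first by rewrite ltnS (mulnC e') leq_pmul2r.
  have e0 : (0 < e')%N by [].
  have -> : (k * e' - e' * i = e' * (k - i))%N by rewrite mulnBr [(e' * k)%N]mulnC.
  rewrite /ssub dvdn_mulr // mulKn //.
  have -> : z ^+ k = z ^+ i * z ^+ (k - i) by rewrite -exprD subnKC.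
  ring.
rewrite big1 // => j le; by rewrite /ssub -/e' -[X in (X %| _)%N]/e' dvdn_subl ?dvdn_mulr // dv mulr0.
Qed.
HB.instance Definition _ z e :=
  GRing.isZmodMorphism.Build (ser R) (ser R) (ssub z e) (ssub_additive z e).
HB.instance Definition _ z e :=
  GRing.isMonoidMorphism.Build (ser R) (ser R) (ssub z e) (ssub_monoid z e).

Lemma ssub_ssub z e w c f : (0 < e)%N -> (0 < c)%N ->
  ssub w c (ssub z e f) = ssub (z * w ^+ e) (e * c) f.
Proof.
move=> e0 c0; apply: serP => n; rewrite [LHS]ssubE // [RHS]ssubE ?muln_gt0 ?e0 //.
have [cn|cn] := boolP (c %| n)%N; last first.
  case: ifP => // ecn; case/negP: cn; apply: dvdn_trans ecn.
  by rewrite dvdn_mull.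
case/dvdnP: cn => k ->; rewrite mulnK // dvdn_pmul2r // divnMr // ssubE //.
case: ifP => [/dvdnP[j ->]|_]; last by rewrite mul0r.
by rewrite mulnK // -mulrA mulnC exprM -exprMn.
Qed.

Lemma ssub_sC z e c : (0 < e)%N -> ssub z e (sC c) = sC c.
Proof.
move=> e0; apply: serP => n; rewrite ssubE // /sC.
case: (n =P 0%N) => [->|n0]; first by rewrite dvdn0 div0n mulr1.
case: ifP => // dv; case: eqP => [d0|]; rewrite ?mul0r //.
by case: n0; rewrite -(divnK dv) d0.
Qed.
Lemma ssub_sX z e a : (0 < e)%N -> ssub z e (sX a) = sC (z ^+ a) * sX (e * a).
Proof.
move=> e0; apply: serP => n; rewrite ssubE // sCM /sX.
case: (n =P (e * a)%N) => [->|n0]; first by rewrite dvdn_mulr // mulKn // eqxx mul1r mulr1.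
rewrite mulr0; case: ifP => // dv; case: eqP => [d0|]; rewrite ?mul0r //.
by case: n0; rewrite -d0 mulnC divnK.
Qed.

End SerRing.
Arguments sX {R}.

Section SerMap.
Variables (K L : comNzRingType) (iota : {rmorphism K -> L}).
Definition smapr (f : ser K) : ser L := fun n => iota (f n).
Fact smapr_additive : zmod_morphism smapr.
Proof. by move=> f g; apply: serP => n; rewrite /smapr serD serN rmorphB. Qed.
Fact smapr_monoid : monoid_morphism smapr.
Proof.
split=> [|f g]; apply: serP => n; rewrite /smapr.
  by rewrite ser1 rmorph_nat.
by rewrite !serM rmorph_sum; apply: eq_bigr => i _; rewrite rmorphM.
Qed.
HB.instance Definition _ :=
  GRing.isZmodMorphism.Build (ser K) (ser L) smapr smapr_additive.
HB.instance Definition _ :=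
  GRing.isMonoidMorphism.Build (ser K) (ser L) smapr smapr_monoid.
End SerMap.

(** * Polynomials over power series and their weights *)

Section Subst.
Variables (A B : comNzRingType).
(** Common shape of the sigma, tau and pi of the procedure: act on the coefficients in x by [f],
    then put y := Y. Being ring morphisms, they can be composed and applied to expansions
    termwise. *)
Definition sbst (f : {rmorphism A -> B}) (Y : {poly B}) : {poly A} -> {poly B} :=
  comp_poly Y \o map_poly f.
HB.instance Definition _ f Y :=
  GRing.RMorphism.copy (sbst f Y) (comp_poly Y \o map_poly f).
Lemma sbstC f Y c : sbst f Y c%:P = (f c)%:P.
Proof. by rewrite /sbst /= map_polyC comp_polyC. Qed.
Lemma sbstX f Y : sbst f Y 'X = Y.
Proof. by rewrite /sbst /= map_polyX comp_polyX. Qed.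
Lemma sbstE f Y (p : {poly A}) n : (size p <= n)%N ->
  sbst f Y p = \sum_(i < n) (f p`_i)%:P * Y ^+ i.
Proof.
move=> pn; rewrite {1}[p](_ : p = \sum_(i < n) p`_i *: 'X^i); last first.
  by rewrite -poly_def; apply/polyP => i; rewrite coef_poly; case: ltnP => // ni;
     rewrite nth_default // (leq_trans pn).
rewrite rmorph_sum /=; apply: eq_bigr => i _.
by rewrite -mul_polyC rmorphM rmorphXn /= sbstC sbstX.
Qed.
Lemma eq_sbst (f g : {rmorphism A -> B}) Y : f =1 g -> sbst f Y =1 sbst g Y.
Proof. by move=> fg p; rewrite /sbst /= (eq_map_poly fg). Qed.
End Subst.

Lemma sbst_sbst (A B C : comNzRingType) (f : {rmorphism A -> B})
  (g : {rmorphism B -> C}) Y Z p :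
  sbst g Z (sbst f Y p) = sbst (g \o f) (sbst g Z Y) p.
Proof. by rewrite /sbst /= map_comp_poly comp_polyA map_poly_comp. Qed.

Section Bser.
Variable R : comNzRingType.
Implicit Types p : {poly ser R}.

(** A [bser] carries no degree, so the bound is an argument; the map inverts [ofP] only where the
    bound holds. *)
Definition toP (n : nat) (h : bser R) : {poly ser R} := \poly_(i < n.+1) (h i : ser R).
Definition ofP p : bser R := fun i => p`_i.

Lemma bserP (h g : bser R) : (forall i j, h i j = g i j) -> h = g.
Proof. by move=> e; apply: funext => i; apply: funext => j. Qed.
Lemma toPK n h : ydeg_le h n -> ofP (toP n h) = h.
Proof.
move=> hn; apply: bserP => i j; rewrite /ofP coef_poly ltnS.
by case: leqP => // ni; rewrite hn.
Qed.
Lemma size_toP n h : (size (toP n h) <= n.+1)%N.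
Proof. exact: size_poly. Qed.
Lemma ofP_inj : injective ofP.
Proof. by move=> p q e; apply/polyP => i; have := congr1 (fun h => h i) e. Qed.
Lemma ofP_ydeg p n : (size p <= n.+1)%N -> ydeg_le (ofP p) n.
Proof. by move=> pn i j ni; rewrite /ofP nth_default // (leq_trans pn). Qed.
Lemma ofPK p n : (size p <= n.+1)%N -> toP n (ofP p) = p.
Proof. by move=> pn; apply: ofP_inj; rewrite toPK //; apply: ofP_ydeg. Qed.
Lemma ofP0 : ofP 0 = (fun _ _ => 0).
Proof. by apply: bserP => i j; rewrite /ofP coef0. Qed.
Lemma ofPM p q : ofP (p * q) = bmul (ofP p) (ofP q).
Proof.
apply: bserP => i j; rewrite /ofP /bmul coefM ser_sum.
by apply: eq_bigr => u _; rewrite serM.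
Qed.
Lemma ofP1 : ofP 1 = bone.
Proof.
by apply: bserP => i j; rewrite /ofP /bone coef1; case: eqP; rewrite /= ?ser1.
Qed.
Lemma ofPX p n : ofP (p ^+ n) = bexp (ofP p) n.
Proof. by elim: n => [|n IH]; rewrite ?ofP1 // exprS ofPM IH. Qed.
Lemma ofP_xpow a : ofP (sX a)%:P = bxpow a.
Proof.
by apply: bserP => i j; rewrite /ofP /bxpow coefC; case: eqP.
Qed.
Lemma ofPB p q : ofP (p - q) = bsub (ofP p) (ofP q).
Proof. by apply: bserP => i j; rewrite /ofP coefB. Qed.

Lemma toP_monic n h : ymonic h n -> toP n h \is monic /\ size (toP n h) = n.+1.
Proof.
case=> hn [h1 h0]; have e : (toP n h)`_n = 1.
  rewrite coef_poly ltnSn; apply: serP => j; rewrite ser1.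
  by case: j => [|j] //; rewrite h0.
have s : size (toP n h) = n.+1.
  apply/eqP; rewrite eqn_leq size_toP ltnNge; apply/negP => sn.
  by move: e; rewrite nth_default // => /eqP; rewrite eq_sym oner_eq0.
by split=> //; rewrite monicE lead_coefE s e.
Qed.
Lemma ofP_monic n p : p \is monic -> size p = n.+1 -> ymonic (ofP p) n.
Proof.
move=> /monicP; rewrite lead_coefE => pm ps; split; first by apply: ofP_ydeg; rewrite ps.
move: pm; rewrite ps /= /ofP => ->; split=> [|j j0]; rewrite ser1 //.
by case: j j0.
Qed.

Lemma bcompE n p (f : smap R) Y : (0 < me f)%N -> ofP Y = mY f ->
  (size p <= n.+1)%N ->
  bcomp n (ofP p) f = ofP (sbst (ssub (mc f) (me f)) Y p).
Proof.
move=> e0 eY pn; apply: bserP => i j; rewrite (sbstE _ _ pn) /ofP coef_sum ser_sum.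
apply: eq_bigr => u _; rewrite coefCM ssubM_coef //.
by apply: eq_bigr => v _; rewrite -eY -ofPX.
Qed.
End Bser.

Lemma bmap_ofP (K L : comNzRingType) (iota : {rmorphism K -> L}) p :
  bmap iota (ofP p) = ofP (map_poly (smapr iota) p).
Proof. by apply: bserP => i j; rewrite /ofP /bmap coef_map. Qed.

Section Weights.
Variable R : comNzRingType.
Implicit Types p e : {poly ser R}.

(* The weights are q for x and m for y. *)
Definition wgt m q c p := forall i j, p`_i j != 0 -> (c <= m * i + q * j)%N.

Lemma wgtW m q c c' p : (c' <= c)%N -> wgt m q c p -> wgt m q c' p.
Proof. by move=> cc h i j /h; apply: leq_trans. Qed.
Lemma wgt0 m q c : wgt m q c 0.
Proof. by move=> i j; rewrite coef0 ser0 eqxx. Qed.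
Lemma wgtD m q c p e : wgt m q c p -> wgt m q c e -> wgt m q c (p + e).
Proof.
move=> hp he i j; rewrite coefD serD; case: (eqVneq (p`_i j) 0) => [->|/hp //].
by rewrite add0r => /he.
Qed.
Lemma wgt_sum m q c (I : Type) (r : seq I) (P : pred I) (F : I -> {poly ser R}) :
  (forall i, P i -> wgt m q c (F i)) -> wgt m q c (\sum_(i <- r | P i) F i).
Proof.
move=> h; elim/big_rec: _ => [|i p Pi]; first exact: wgt0.
by apply: wgtD; apply: h.
Qed.
Lemma wgtM m q c c' p e : wgt m q c p -> wgt m q c' e -> wgt m q (c + c') (p * e).
Proof.
move=> hp he i j; apply: contra_neqT; rewrite -ltnNge => lt.
rewrite coefM ser_sum big1 // => u _; rewrite serM big1 // => v _.
have := ltn_ord u; have := ltn_ord v; rewrite !ltnS => vj ui.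
case: (eqVneq (p`_u v) 0) => [->|/hp h1]; first by rewrite mul0r.
case: (eqVneq (e`_(i - u) (j - v)%N) 0) => [->|/he h2]; first by rewrite mulr0.
by move: h2; rewrite !mulnBr; have := leq_mul (leqnn m) ui;
   have := leq_mul (leqnn q) vj; lia.
Qed.
Lemma wgtC m q c (f : ser R) :
  (forall j, f j != 0 -> (c <= q * j)%N) -> wgt m q c f%:P.
Proof.
move=> h i j; rewrite coefC; case: (i =P 0%N) => [->|_]; last by rewrite ser0 eqxx.
by move=> /h; rewrite muln0.
Qed.
Lemma wgtC0 m q (f : ser R) : wgt m q 0 f%:P.
Proof. exact: wgtC. Qed.
Lemma wgt00 m q p : wgt m q 0 p. Proof. by []. Qed.

Definition mon (k : R) w i : {poly ser R} := (sC k * sX w)%:P * 'X^i.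
Lemma monE k w i u v : (mon k w i)`_u v = if (u == i) && (v == w) then k else 0.
Proof.
rewrite coefCM coefXn; case: eqP => _ /=; last by rewrite mulr0.
by rewrite mulr1 sCM /sX; case: eqP; rewrite ?mulr1 ?mulr0.
Qed.
Lemma monM k w i k' w' i' : mon k w i * mon k' w' i' = mon (k * k') (w + w') (i + i').
Proof. rewrite /mon sCMC sXD exprD !polyCM; ring. Qed.
Lemma mon1 : mon 1 0 0 = 1.
Proof. by rewrite /mon sC1 sX0 !mul1r. Qed.
Lemma mon0 w i : mon 0 w i = 0.
Proof. by rewrite /mon sC0 mul0r mul0r. Qed.
Lemma monD k k' w i : mon k w i + mon k' w i = mon (k + k') w i.
Proof.
rewrite /mon -mulrDl -polyCD -mulrDl; congr ((_ * _)%:P * _).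
by apply: serP => n; rewrite serD /sC; case: eqP; rewrite ?addr0.
Qed.
Lemma wgt_mon m q k w i : wgt m q (m * i + q * w) (mon k w i).
Proof.
by move=> u v; rewrite monE; case: andP => [[/eqP-> /eqP->]|]; rewrite ?eqxx.
Qed.

(** The coefficient [k] may be 0, and then only a strict lower bound on the weight is claimed. This
    lets leading terms of equal weight be added with no case distinction on cancellation. *)
Definition ld m q p k w i := wgt m q (m * i + q * w).+1 (p - mon k w i).

Lemma ld_wgt m q p k w i : ld m q p k w i -> wgt m q (m * i + q * w) p.
Proof.
move=> h; rewrite -[p](subrK (mon k w i)); apply: wgtD; last exact: wgt_mon.
exact: wgtW h.
Qed.
Lemma ld_mon m q k w i : ld m q (mon k w i) k w i.
Proof. by rewrite /ld subrr; apply: wgt0. Qed.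
Lemma ld1 m q : ld m q 1 1 0 0.
Proof. by rewrite -mon1; apply: ld_mon. Qed.
Lemma ldM m q p k w i p' k' w' i' : ld m q p k w i -> ld m q p' k' w' i' ->
  ld m q (p * p') (k * k') (w + w') (i + i').
Proof.
move=> h h'; rewrite /ld -monM.
have -> : p * p' - mon k w i * mon k' w' i'
  = (p - mon k w i) * p' + mon k w i * (p' - mon k' w' i') by ring.
apply: wgtD.
  by apply: (wgtW _ (wgtM h (ld_wgt h'))); rewrite !mulnDr; lia.
by apply: (wgtW _ (wgtM (@wgt_mon m q k w i) h')); rewrite !mulnDr; lia.
Qed.
Lemma ld_exp m q p k w i n : ld m q p k w i -> ld m q (p ^+ n) (k ^+ n) (w * n) (i * n).
Proof.
move=> h; elim: n => [|n IH]; first by rewrite !muln0; apply: ld1.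
by rewrite !exprS !mulnS; apply: ldM.
Qed.
Lemma ld_prod m q (n : nat) (F : nat -> {poly ser R}) k w :
  (forall t, (t < n)%N -> ld m q (F t) (k t) (w t) 0) ->
  ld m q (\prod_(t < n) F t) (\prod_(t < n) k t) (\sum_(t < n) w t) 0.
Proof.
elim: n => [|n IH] h; first by rewrite !big_ord0; apply: ld1.
rewrite !big_ord_recr /= -[0%N]addn0; apply: ldM; last exact: h.
by apply: IH => t tn; apply: h; apply: ltnW.
Qed.
Lemma ldDw m q p e k w i : ld m q p k w i -> wgt m q (m * i + q * w).+1 e ->
  ld m q (p + e) k w i.
Proof. by move=> h he; rewrite /ld addrAC; apply: wgtD. Qed.
Lemma ld_sum m q w i (I : Type) (r : seq I) (P : pred I)
   (F : I -> {poly ser R}) k :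
  (forall t, P t -> ld m q (F t) (k t) w i) ->
  ld m q (\sum_(t <- r | P t) F t) (\sum_(t <- r | P t) k t) w i.
Proof.
move=> h; apply: (big_rec2 (fun p k => ld m q p k w i)).
  by rewrite /ld mon0 subrr; apply: wgt0.
move=> t k' p Pt h'; rewrite /ld -monD opprD addrACA; apply: wgtD => //; exact: h.
Qed.
Lemma ldP m q p k w i : ld m q p k w i -> p`_i w = k.
Proof.
move=> h; case: (eqVneq (p`_i w - k) 0) => [/subr0_eq //|ne].
by have := h i w; rewrite coefB serD serN monE !eqxx /= ltnn => /(_ ne).
Qed.
Lemma ld_off m q p k w i u v : ld m q p k w i ->
  (m * u + q * v <= m * i + q * w)%N -> (u, v) <> (i, w) -> p`_u v = 0.
Proof.
move=> h le ne; case: (eqVneq (p`_u v) 0) => // nz.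
have := h u v; rewrite coefB serD serN monE.
case: andP => [[/eqP e1 /eqP e2]|_]; first by case: ne; rewrite e1 e2.
by rewrite subr0 => /(_ nz); lia.
Qed.

(* With delta(0) = z^s this is sigma_{k+1} followed by tau_{k+1}. *)
Definition theta (z : R) q m (delta : ser R) : {poly ser R} -> {poly ser R} :=
  sbst (ssub z q) ((sX m)%:P * ('X + delta%:P)).
HB.instance Definition _ z q m delta := GRing.RMorphism.copy (theta z q m delta)
  (sbst (ssub z q) ((sX m)%:P * ('X + delta%:P))).

(** A monomial x^j y^i is sent to x^(q j + m i) times a series, so the (m, q)-weight becomes the
    order in x, that is, the weight (0, 1). *)
Lemma theta_wgt z q m delta c p : (0 < q)%N -> wgt m q c p ->
  wgt 0 1 c (theta z q m delta p).
Proof.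
move=> q0 h; rewrite /theta (sbstE _ _ (leqnn _)); apply: wgt_sum => i _.
rewrite exprMn -polyC_exp sX_exp.
(* The coefficient of y^i contributes [c - m * i] and the power of x^m the rest; the truncated
   subtraction also covers [m * i] above [c]. *)
apply: (@wgtW _ _ ((c - m * i) + (m * i + 0))); first by lia.
apply: wgtM; last first.
  by apply: wgtM => //; apply: wgtC => j; rewrite /sX; case: (j =P _); rewrite ?eqxx // => ->; lia.
apply: wgtC => j /=; rewrite ssubE //; case: ifP => [/dvdnP[n ->]|]; last by rewrite eqxx.
rewrite mulnK //; case: (eqVneq (p`_i n) 0) => [->|/h le _]; first by rewrite mul0r eqxx.
by rewrite mul1n (mulnC n) leq_subLR.
Qed.

Lemma theta_mon z q m delta k w i : (0 < q)%N ->
  theta z q m delta (mon k w i)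
  = mon (k * z ^+ w) (m * i + q * w) 0 * ('X + delta%:P) ^+ i.
Proof.
move=> q0; rewrite /mon rmorphM rmorphXn /= /theta sbstC sbstX rmorphM /=.
rewrite ssub_sC // ssub_sX // exprMn -polyC_exp sX_exp !sCMC sXD !polyCM.
ring.
Qed.

(* That is, p = x^c (f(y) + O(x)). *)
Definition xl p c (f : {poly R}) :=
  (forall i j, (j < c)%N -> p`_i j = 0) /\ forall i, p`_i c = f`_i.
Lemma xl0 c : xl 0 c 0.
Proof. by split=> [i j _|i]; rewrite !coef0. Qed.
Lemma xlD p p' c f f' : xl p c f -> xl p' c f' -> xl (p + p') c (f + f').
Proof.
move=> [h1 h2] [h1' h2']; split=> [i j jc|i]; rewrite !coefD serD.
  by rewrite h1 // h1' // addr0.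
by rewrite h2 h2'.
Qed.
Lemma xl_sum c (I : Type) (r : seq I) (P : pred I) (F : I -> {poly ser R}) f :
  (forall t, P t -> xl (F t) c (f t)) ->
  xl (\sum_(t <- r | P t) F t) c (\sum_(t <- r | P t) f t).
Proof.
move=> h; apply: (big_rec2 (fun p k => xl p c k)); first exact: xl0.
by move=> t f' p Pt; apply: xlD; apply: h.
Qed.
Lemma wgt_xl c p : wgt 0 1 c.+1 p -> xl p c 0.
Proof.
move=> h; have h' i j : (j <= c)%N -> p`_i j = 0.
  by move=> jc; case: (eqVneq (p`_i j) 0) => // /h; lia.
by split=> [i j jc|i]; rewrite ?coef0 h' // ltnW.
Qed.

Lemma shift_exp0 (delta : ser R) i u :
  (('X + delta%:P) ^+ i)`_u 0%N = (('X + (delta 0%N)%:P) ^+ i)`_u.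
Proof.
elim: i u => [|i IH] u; first by rewrite !expr0 !coef1; case: eqP.
rewrite !exprS !mulrDl !coefD !coefXM !coefCM serD ser_mulr0 IH.
by case: eqP => _ //; rewrite IH.
Qed.

(** All terms of higher weight move into the O(x) part, and at x = 0 the factor y + delta(x) becomes
    y + delta(0). *)
Lemma theta_ld z q m delta p k w i : (0 < q)%N -> ld m q p k w i ->
  xl (theta z q m delta p) (m * i + q * w)
     ((k * z ^+ w) *: ('X + (delta 0%N)%:P) ^+ i).
Proof.
move=> q0 /(@theta_wgt z q m delta _ _ q0) /wgt_xl h.
rewrite -[p](subrK (mon k w i)) rmorphD /= -[X in xl _ _ X]add0r.
apply: xlD => //; rewrite theta_mon //; set c := (_ + _)%N.
have coefE u v : (mon (k * z ^+ w) c 0 * ('X + delta%:P) ^+ i)`_u v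
   = if (c <= v)%N then k * z ^+ w * (('X + delta%:P) ^+ i)`_u (v - c)%N else 0.
  rewrite /mon expr0 mulr1 coefCM -(mulrA (sC _)) sCM sXM; case: ifP; rewrite ?mulr0 //.
split=> [u v vc|u]; rewrite coefE; first by rewrite leqNgt vc.
by rewrite leqnn subnn coefZ shift_exp0.
Qed.

(** With m > 0, both the powers of y in f and the O(x) part weigh more than x^c. This is where one
    weight at a level yields all weights at the next. *)
Lemma xl_ld0 c p f m q : (0 < m)%N -> (0 < q)%N -> xl p c f -> ld m q p f`_0 c 0.
Proof.
move=> m0 q0 [h1 h2] i j; rewrite coefB serD serN monE muln0 add0n.
case: (ltngtP j c) => [jc|jc|->]; rewrite ?andbF.
- by rewrite h1 // subr0 eqxx.
- by move=> _; have lt : (q * c < q * j)%N; [by rewrite ltn_pmul2l | lia].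
case: (eqVneq i 0%N) => [->|i0] /=; first by rewrite h2 subrr eqxx.
move=> _; suff : (0 < m * i)%N by lia.
by rewrite muln_gt0 m0 lt0n.
Qed.
(** Used for phi_k: it vanishes at y = S_k, so its pullback has no y-free part and x^c y is the
    lightest monomial left. *)
Lemma xl_ld1 c p f m q : (0 < m)%N -> (0 < q)%N -> xl p c f -> p`_0 = 0 ->
  ld m q p f`_1 c 1.
Proof.
move=> m0 q0 [h1 h2] p0 i j; rewrite coefB serD serN monE muln1.
case: i => [|[|i]].
- by rewrite p0 /= subr0 eqxx.
- case: (ltngtP j c) => [jc|jc|->]; rewrite ?andbF /=.
  + by rewrite h1 // subr0 eqxx.
  + by move=> _; have lt : (q * c < q * j)%N; [by rewrite ltn_pmul2l | lia].
  by rewrite h2 subrr eqxx.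
case: (ltnP j c) => [jc|jc _]; first by rewrite h1 //= subr0 eqxx.
have : (q * c <= q * j)%N by rewrite leq_pmul2l.
by rewrite !mulnS; lia.
Qed.
End Weights.

(** * Simple extensions of subfields and residual polynomials *)

(* The sizes of a polynomial seen through different coercion paths are
   convertible but not syntactically equal, which lia cannot see. *)
Ltac size_lia :=
  repeat match goal with H : context [size (polyseq _)] |- _ => revert H end;
  repeat match goal with |- context [size (polyseq ?p)] =>
      let u := fresh "u" in set u := (size (polyseq p)); clearbody u
  end; lia.

Section Subfield.
Variable L : fieldType.
Implicit Types (Kp : L -> Prop) (a b c z : L) (A P Q : {poly L}).

Definition is_subfield Kp := [/\ Kp 1, forall a b, Kp a -> Kp b -> Kp (a - b),
  forall a b, Kp a -> Kp b -> Kp (a * b) & forall a, Kp a -> Kp a^-1].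

Section Closure.
Variable Kp : L -> Prop.
Hypothesis KF : is_subfield Kp.

Lemma sf1 : Kp 1. Proof. by case: KF. Qed.
Lemma sfB a b : Kp a -> Kp b -> Kp (a - b). Proof. case: KF => _ h _ _; exact: h. Qed.
Lemma sfM a b : Kp a -> Kp b -> Kp (a * b). Proof. case: KF => _ _ h _; exact: h. Qed.
Lemma sfV a : Kp a -> Kp a^-1. Proof. case: KF => _ _ _; exact. Qed.
Lemma sf0 : Kp 0. Proof. by rewrite -(subrr 1); apply: sfB; apply: sf1. Qed.
Lemma sfN a : Kp a -> Kp (- a). Proof. by rewrite -sub0r; apply: sfB; apply: sf0. Qed.
Lemma sfD a b : Kp a -> Kp b -> Kp (a + b).
Proof. by move=> ha hb; rewrite -[b]opprK; apply: sfB => //; apply: sfN. Qed.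
Lemma sfX a n : Kp a -> Kp (a ^+ n).
Proof. by move=> ha; elim: n => [|n IH]; rewrite ?expr0 ?exprS; [apply: sf1|apply: sfM]. Qed.
Lemma sf_nat n : Kp n%:R.
Proof. by elim: n => [|n IH]; [apply: sf0|rewrite mulrSr; apply: sfD => //; apply: sf1]. Qed.
Lemma sf_sum (I : Type) (r : seq I) (T : pred I) (F : I -> L) :
  (forall i, T i -> Kp (F i)) -> Kp (\sum_(i <- r | T i) F i).
Proof.
by move=> h; elim/big_rec: _ => [|i x Ti]; [exact: sf0|apply: sfD; apply: h].
Qed.
Lemma sf_prod (I : Type) (r : seq I) (T : pred I) (F : I -> L) :
  (forall i, T i -> Kp (F i)) -> Kp (\prod_(i <- r | T i) F i).
Proof.
by move=> h; elim/big_rec: _ => [|i x Ti]; [exact: sf1|apply: sfM; apply: h].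
Qed.

Lemma poB A Q : polyover Kp A -> polyover Kp Q -> polyover Kp (A - Q).
Proof. by move=> hA hQ u; rewrite coefB; apply: sfB. Qed.
Lemma poD A Q : polyover Kp A -> polyover Kp Q -> polyover Kp (A + Q).
Proof. by move=> hA hQ u; rewrite coefD; apply: sfD. Qed.
Lemma poM A Q : polyover Kp A -> polyover Kp Q -> polyover Kp (A * Q).
Proof. by move=> hA hQ u; rewrite coefM; apply: sf_sum => i _; apply: sfM. Qed.
Lemma poZ a A : Kp a -> polyover Kp A -> polyover Kp (a *: A).
Proof. by move=> ha hA u; rewrite coefZ; apply: sfM. Qed.
Lemma po0 : polyover Kp 0.
Proof. by move=> u; rewrite coef0; apply: sf0. Qed.
Lemma poC a : Kp a -> polyover Kp a%:P.
Proof. by move=> ha u; rewrite coefC; case: ifP => // _; apply: sf0. Qed.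
Lemma poXn n : polyover Kp 'X^n.
Proof. by move=> u; rewrite coefXn; apply: sf_nat. Qed.
Lemma po_sum (I : Type) (r : seq I) (T : pred I) (F : I -> {poly L}) :
  (forall i, T i -> polyover Kp (F i)) -> polyover Kp (\sum_(i <- r | T i) F i).
Proof.
by move=> h; elim/big_rec: _ => [|i x Ti]; [exact: po0|apply: poD; apply: h].
Qed.

Lemma po_div A : A \is monic -> polyover Kp A -> forall P, polyover Kp P ->
  exists Q T, [/\ polyover Kp Q, polyover Kp T, P = Q * A + T & (size T < size A)%N].
Proof.
move=> Am hA P; elim: {P}(size P) {-2}P (leqnn (size P)) => [|n IH] P Pn hP.
  exists 0, 0; split; rewrite ?mul0r ?addr0 ?size_poly0; try exact: po0.
    by apply/eqP; rewrite -size_poly_leq0.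
  by rewrite size_poly_gt0 monic_neq0.
case: (ltnP (size P) (size A)) => [lt|le].
  by exists 0, P; split; rewrite ?mul0r ?add0r //; exact: po0.
have A0 : (0 < size A)%N by rewrite size_poly_gt0 monic_neq0.
pose B := lead_coef P *: 'X^(size P - size A).
have hB : polyover Kp B by apply: poZ; [exact: hP|exact: poXn].
have [||Q [T [hQ hT e sT]]] := IH (P - B * A).
- have P0 : (0 < size P)%N by apply: leq_trans le.
  apply/leq_sizeP => j nj; rewrite coefB /B -scalerAl coefZ coefXnM.
  rewrite ltnNge (_ : (size P - size A <= j)%N) /=; last by size_lia.
  have [e|ne] := eqVneq j (size P).-1.
    rewrite e; have -> : ((size P).-1 - (size P - size A) = (size A).-1)%N by size_lia.
    have -> : A`_(size A).-1 = 1 by apply/eqP; move: Am; rewrite monicE lead_coefE.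
    by rewrite mulr1 lead_coefE subrr.
  rewrite [P`_j]nth_default; last by size_lia.
  by rewrite nth_default ?mulr0 ?subr0 //; size_lia.
- by apply: poB => //; apply: poM.
exists (Q + B), T; split=> //; first exact: poD.
by rewrite mulrDl addrAC -e subrK.
Qed.
End Closure.

Variables (Kp : L -> Prop) (P : {poly L}) (z : L).
Hypotheses (KF : is_subfield Kp) (Pm : P \is monic) (Po : polyover Kp P)
  (Pirr : irr_over Kp P) (Pz : P.[z] = 0).

(** A nonzero A, made monic, would divide P: the remainder also vanishes at z and is smaller, hence
    zero by induction. Irreducibility forbids a divisor of such a degree, and a nonzero constant
    does not vanish at z. *)
Lemma irr_min A : polyover Kp A -> (size A < size P)%N -> A.[z] = 0 -> A = 0.
Proof.
elim: {A}(size A) {-2}A (leqnn (size A)) => [|n IH] A An hA AP Az.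
  by apply/eqP; rewrite -size_poly_leq0.
apply/eqP/negPn/negP => A0.
have lA : lead_coef A != 0 by rewrite lead_coef_eq0.
pose B := (lead_coef A)^-1 *: A.
have sB : size B = size A by rewrite size_scale // invr_eq0.
have Bm : B \is monic by rewrite monicE lead_coefZ mulVf.
have hB : polyover Kp B by apply: poZ => //; apply: sfV => //; apply: hA.
have Bz : B.[z] = 0 by rewrite hornerZ Az mulr0.
have [Q [T [hQ hT e sT]]] := po_div KF Bm hB Po.
have Tz : T.[z] = 0 by move: Pz; rewrite e hornerD hornerM Bz mulr0 add0r.
have T0 : T = 0.
  apply: IH => //; last by rewrite -sB in AP; apply: ltn_trans AP.
  by rewrite sB in sT; size_lia.
case: Pirr => P1 /(_ Q B hQ hB); rewrite {1}e T0 addr0 => /(_ erefl) [sQ|sB1].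
  have Qm : Q \is monic by move: Pm; rewrite e T0 addr0 monicMr.
  move: AP; rewrite e T0 addr0 size_Mmonic ?monic_neq0 // sQ sB; size_lia.
have /size1_polyC Bc : (size B <= 1)%N by rewrite sB1.
by move: Bz sB1; rewrite Bc hornerC => ->; rewrite size_polyC eqxx.
Qed.

Lemma adjoin_basis Kp' c : (forall c, Kp' c <-> exists p, polyover Kp p /\ c = p.[z]) ->
  Kp' c -> exists p, [/\ polyover Kp p, (size p <= (size P).-1)%N & c = p.[z]].
Proof.
move=> h /h [p [hp ->]]; have [Q [T [hQ hT e sT]]] := po_div KF Pm Po hp.
exists T; split=> //; first by size_lia.
by rewrite e hornerD hornerM Pz mulr0 add0r.
Qed.

(** Euclid's algorithm: dividing P by the monic multiple of p expresses the value of the remainder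
    at z through that of p, so an inverse of the former gives one of the latter. If the remainder
    vanishes at z, so does the quotient, which [irr_min] permits only for constant p. *)
Lemma adjoin_inv p : polyover Kp p -> (size p < size P)%N -> p.[z] != 0 ->
  exists u, polyover Kp u /\ u.[z] * p.[z] = 1.
Proof.
elim: {p}(size p) {-2}p (leqnn (size p)) => [|n IH] p pn hp pP pz.
  by move: pn pz; rewrite size_poly_leq0 => /eqP ->; rewrite horner0 eqxx.
have p0 : p != 0 by apply: contraNneq pz => ->; rewrite horner0.
have lp : lead_coef p != 0 by rewrite lead_coef_eq0.
pose B := (lead_coef p)^-1 *: p.
have sB : size B = size p by rewrite size_scale // invr_eq0.
have Bm : B \is monic by rewrite monicE lead_coefZ mulVf.
have hlp : Kp (lead_coef p)^-1 by apply: sfV => //; apply: hp.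
have hB : polyover Kp B by apply: poZ.
have [Q [T [hQ hT e sT]]] := po_div KF Bm hB Po.
have eT : T.[z] = - (Q.[z] * ((lead_coef p)^-1 * p.[z])).
  by apply/eqP; rewrite -addr_eq0 addrC -Pz e hornerD hornerM hornerZ.
have [Tz|Tz] := eqVneq T.[z] 0; last first.
  have [||u [hu eu]] := IH T _ hT _ Tz; try by rewrite sB in sT; size_lia.
  exists (- ((lead_coef p)^-1 *: (u * Q))); split.
    rewrite -sub0r; apply: poB => //; first exact: po0.
    by apply: poZ => //; apply: poM.
  by rewrite hornerN hornerZ hornerM -eu eT; ring.
have Qz : Q.[z] = 0.
  by move/eqP: eT; rewrite Tz eq_sym oppr_eq0 !mulf_eq0 invr_eq0 (negPf lp) (negPf pz) /= orbF => /eqP.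
have BN0 : B.[z] != 0 by rewrite hornerZ mulf_neq0 // invr_eq0.
have szB : (0 < size B)%N by rewrite size_poly_gt0 monic_neq0.
case: (ltnP 1 (size B)) => sB1.
  have Q0 : Q = 0.
    apply: irr_min => //; have [->|Q0] := eqVneq Q 0.
      by rewrite size_poly0; case: Pirr => /ltnW.
    have sQ : (0 < size Q)%N by rewrite size_poly_gt0.
    rewrite e size_polyDl size_Mmonic //; first by size_lia.
    by rewrite (leq_trans sT) //; size_lia.
  have eP : P = T by rewrite e Q0 mul0r add0r.
  by move: sT; rewrite sB -eP; size_lia.
have /size1_polyC pc : (size p <= 1)%N by rewrite -sB.
exists ((lead_coef p)^-1)%:P; split; first exact: poC.
by rewrite hornerC; move: lp; rewrite pc lead_coefC hornerC => lp; rewrite mulVf.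
Qed.

Lemma adjoin_subfield Kp' : (forall c, Kp' c <-> exists p, polyover Kp p /\ c = p.[z]) ->
  is_subfield Kp'.
Proof.
move=> h; split.
- by apply/h; exists 1; rewrite hornerC; split=> //; apply: poC => //; apply: sf1.
- move=> a b /h [p [hp ->]] /h [q [hq ->]]; apply/h; exists (p - q).
  by rewrite hornerD hornerN; split=> //; apply: poB.
- move=> a b /h [p [hp ->]] /h [q [hq ->]]; apply/h; exists (p * q).
  by rewrite hornerM; split=> //; apply: poM.
move=> a ha; have [p [hp sp ->]] := adjoin_basis h ha.
apply/h; have [->|pz] := eqVneq p.[z] 0.
  by exists 0; rewrite horner0 invr0; split=> //; apply: po0.
have [|u [hu e]] := adjoin_inv hp _ pz.
  by case: Pirr => P1 _; size_lia.
exists u; split=> //.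
by rewrite -[LHS]mul1r -e mulfK.
Qed.

(** The derivative is smaller than P and has leading coefficient deg P, which is nonzero in L, so by
    [irr_min] it cannot vanish at z. *)
Lemma irr_separable : (((size P).-1)%:R : L) != 0 -> P^`().[z] != 0.
Proof.
move=> l0; apply/eqP => dz; have P1 : (1 < size P)%N by case: Pirr.
have /(congr1 (fun p : {poly L} => p`_(size P).-2)) : P^`() = 0.
  apply: irr_min => //.
    by move=> u; rewrite coef_deriv -mulr_natr; apply: sfM => //; apply: sf_nat.
  by rewrite lt_size_deriv // monic_neq0.
rewrite coef0 coef_deriv prednK; last by size_lia.
have -> : P`_(size P).-1 = 1 by apply/eqP; move: Pm; rewrite monicE lead_coefE.
by move/eqP; rewrite (negPf l0).
Qed.

Section Residual.
Variables (q m s t M c : nat) (D : nat -> nat) (kap : nat -> L).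
Hypotheses (q0 : (0 < q)%N) (qs : (q * s = m * t + 1)%N).
Hypothesis hact : forall i, (i < M)%N -> kap i != 0 -> (q * D i + m * i = c)%N.

(** Multiplying by q gives q (t D + s i) = t c + i. Hence i is fixed mod q, and the exponent differs
    from [i %/ q] by a constant. *)
Lemma residual_exp i0 : (i0 < M)%N -> kap i0 != 0 ->
  exists E, forall i, (i < M)%N -> kap i != 0 ->
    (t * D i + s * i = E + i %/ q)%N /\ (i %% q = i0 %% q)%N.
Proof.
move=> i0M k0; have key i : (i < M)%N -> kap i != 0 -> (q * (t * D i + s * i) = t * c + i)%N.
  move=> iM ki; rewrite -(hact iM ki) mulnDr [(q * (s * i))%N]mulnA qs.
  by rewrite mulnDl mul1n !mulnDr addnA; congr (_ + _ + _)%N; size_lia.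
have md i : (i < M)%N -> kap i != 0 -> (i %% q = i0 %% q)%N.
  move=> iM ki; apply/eqP; rewrite -(eqn_modDl (t * c)) -!key //.
  by rewrite !modnMr.
exists ((t * c + i0 %% q) %/ q)%N => i iM ki; split; last exact: md.
have e : (q * (t * D i + s * i) = i %/ q * q + (t * c + i0 %% q))%N.
  by rewrite key // -(md i iM ki) addnCA -divn_eq.
have -> : (t * c + i0 %% q = q * (t * D i + s * i - i %/ q))%N.
  by rewrite mulnBr e [(q * (i %/ q))%N]mulnC addKn.
rewrite mulKn // subnK //.
by rewrite -(leq_pmul2l q0) e [(q * _)%N]mulnC leq_addr.
Qed.

(** The residual polynomial of the monomials [kap i] x^(D i) y^i on one line. Distinct active i are
    congruent mod q, so they have distinct quotients and do not mix. *)
Definition residual : {poly L} := \sum_(i < M) kap i *: 'X^(i %/ q).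

Lemma residual_coef i0 i : (i0 < M)%N -> kap i0 != 0 -> (i < M)%N ->
  (i %% q = i0 %% q)%N -> residual`_(i %/ q) = kap i.
Proof.
move=> i0M k0 iM im; have [E hE] := residual_exp i0M k0.
rewrite coef_sum (bigD1 (Ordinal iM)) //= coefZ coefXn eqxx mulr1 big1 ?addr0 //.
move=> j ji; rewrite coefZ coefXn; have [->|kj] := eqVneq (kap j) 0; first by rewrite mul0r.
case: eqP => [e|]; last by rewrite mulr0.
case/eqP: ji; apply: val_inj => /=.
by rewrite (divn_eq j q) (divn_eq i q) e im (hE j _ kj).2.
Qed.

Lemma residual_over : (forall i, (i < M)%N -> Kp (kap i)) -> polyover Kp residual.
Proof. by move=> h; apply: po_sum => // i _; apply: poZ => //; [exact: h|exact: poXn]. Qed.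

Lemma residual_sum : exists E, 
  \sum_(i < M) kap i * z ^+ (t * D i + s * i) = z ^+ E * residual.[z].
Proof.
have [[i0 k0]|no] := pselect (exists i : 'I_M, kap i != 0).
  have [E hE] := residual_exp (ltn_ord i0) k0; exists E.
  rewrite /residual horner_sum mulr_sumr; apply: eq_bigr => i _.
  rewrite hornerZ hornerXn; have [->|ki] := eqVneq (kap i) 0; first by rewrite !mul0r mulr0.
  by rewrite (hE i (ltn_ord i) ki).1 exprD mulrCA.
have z0 (i : 'I_M) : kap i = 0.
  by apply/eqP/negPn/negP => ki; apply: no; exists i.
exists 0%N; rewrite /residual !big1 ?horner0 ?mulr0 // => i _; rewrite z0 ?mul0r ?scale0r //.
Qed.

Lemma size_residual n : (forall i, (i < M)%N -> (i %/ q < n)%N) -> (size residual <= n)%N.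
Proof.
move=> h; apply: (leq_trans (size_sum _ _ _)); apply/bigmax_leqP => i _.
apply: (leq_trans (size_scale_leq _ _)); rewrite size_polyXn; exact: h.
Qed.
End Residual.

Section ResidualUse.
Variables (q m s t c : nat) (D : nat -> nat) (kap : nat -> L).
Hypotheses (q0 : (0 < q)%N) (qs : (q * s = m * t + 1)%N) (z0 : z != 0).
Let l := (size P).-1.

(** Up to a power of z, the sum is the value at z of the residual polynomial, which has degree below
    deg P because i < q l; [irr_min] makes it zero, and its coefficients are the [kap i]. *)
Lemma residual_indep :
  (forall i, (i < q * l)%N -> kap i != 0 -> (q * D i + m * i = c)%N) ->
  (forall i, (i < q * l)%N -> Kp (kap i)) ->
  \sum_(i < q * l) kap i * z ^+ (t * D i + s * i) = 0 ->
  forall i, (i < q * l)%N -> kap i = 0.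
Proof.
move=> hact hK; have [E ->] := residual_sum q0 qs hact.
move/eqP; rewrite mulf_eq0 expf_eq0 (negPf z0) andbF /= => /eqP R0 i iM.
have [//|ki] := eqVneq (kap i) 0.
rewrite -(residual_coef q0 qs hact iM ki iM erefl).
suff -> : residual q (q * l) kap = 0 by rewrite coef0.
apply: irr_min => //; first exact: residual_over.
have P1 : (1 < size P)%N by case: Pirr.
apply: (@leq_ltn_trans l); last by rewrite /l; size_lia.
by apply: size_residual => j; rewrite ltn_divLR // mulnC.
Qed.

(* The residual polynomial vanishes at z and has degree at most deg P, so it is
   a multiple of P; the second sum is z^s times its logarithmic derivative. *)
Lemma residual_simple i0 :
  (i0 < (q * l).+1)%N -> kap i0 != 0 ->
  (forall i, (i < (q * l).+1)%N -> kap i != 0 -> (q * D i + m * i = c)%N) ->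
  (forall i, (i < (q * l).+1)%N -> Kp (kap i)) ->
  \sum_(i < (q * l).+1) kap i * z ^+ (t * D i + s * i) = 0 ->
  (q%:R : L) != 0 -> (l%:R : L) != 0 ->
  kap (q * l)%N != 0 /\
  \sum_(i < (q * l).+1) kap i * z ^+ (t * D i) * (i%:R * (z ^+ s) ^+ i.-1) != 0.
Proof.
move=> i0M k0 hact hK; have P1 : (1 < size P)%N by case: Pirr.
have [E -> /eqP] := residual_sum q0 qs hact.
rewrite mulf_eq0 expf_eq0 (negPf z0) andbF /= => /eqP Rz qn0 ln0.
have [E' hE'] := residual_exp q0 qs hact i0M k0.
set R := residual q (q * l).+1 kap in Rz.
have hR : polyover Kp R by apply: residual_over.
have Ri : R`_(i0 %/ q) = kap i0 by exact: (residual_coef q0 qs hact i0M k0).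
have qdiv j : (j < (q * l).+1)%N -> (j %/ q <= l)%N.
  by rewrite ltnS => h; rewrite -(mulKn l q0); apply: leq_div2r.
(* Degree l can only come from i = q l; without this term the residual polynomial would be smaller
   than P and vanish, although [kap i0] is one of its coefficients. *)
have klN : kap (q * l)%N != 0.
  apply: contraNneq k0 => kl; rewrite -Ri.
  suff -> : R = 0 by rewrite coef0.
  apply: irr_min => //; apply: (@leq_ltn_trans l); last by rewrite /l; size_lia.
  apply/leq_sizeP => j lj; rewrite coef_sum big1 // => i _; rewrite coefZ coefXn.
  case: eqP => [e|_]; last by rewrite mulr0.
  have il := qdiv i (ltn_ord i).
  have jl : (i %/ q = l)%N by size_lia.
  have -> : i = (q * l)%N :> nat.
    apply/eqP; rewrite eqn_leq -ltnS ltn_ord /=.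
    by rewrite [X in (_ <= X)%N](divn_eq i q) jl [(l * q)%N]mulnC leq_addr.
  by rewrite kl mul0r.
split=> //.
(* The index q l is active and all active indices are congruent mod q, so q divides each of them. *)
have rho i : (i < (q * l).+1)%N -> kap i != 0 -> (i = q * (i %/ q))%N.
  move=> iM ki; rewrite {1}(divn_eq i q) (hE' i iM ki).2.
  by rewrite -(hE' _ (ltnSn _) klN).2 modnMr addn0 mulnC.
have RP : R = kap (q * l)%N *: P.
  apply/eqP; rewrite -subr_eq0; apply/eqP/irr_min.
  - by apply: poB => //; apply: poZ => //; apply: hK.
  - have Rl : R`_l = kap (q * l)%N.
      have -> : R`_l = R`_((q * l) %/ q) by rewrite mulKn.
      exact: (residual_coef q0 qs hact (ltnSn _) klN).
    rewrite -[X in (_ < X)%N](ltn_predK P1) -/l ltnS.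
    apply/leq_sizeP => j lj; rewrite coefB coefZ.
    have [->|ne] := eqVneq j l.
      rewrite Rl; have -> : P`_l = 1 by apply/eqP; move: Pm; rewrite monicE lead_coefE.
      by rewrite mulr1 subrr.
    rewrite [P`_j]nth_default ?mulr0 ?subr0; last by rewrite /l in ne lj *; size_lia.
    apply: nth_default; apply: (@leq_trans l.+1); last by size_lia.
    by apply: size_residual => i iM; rewrite ltnS; apply: qdiv.
  by rewrite hornerD hornerN hornerZ Pz Rz mulr0 subrr.
(* The factor z^s restores the exponent t D + s i lost through [i.-1]; with i = q (i %/ q) the sum
   becomes z^E' q z R'(z). *)
set Z := (X in X != 0); suff : z ^+ s * Z != 0 by rewrite mulf_eq0 negb_or => /andP[].
rewrite /Z mulr_sumr.
have -> : \sum_(i < (q * l).+1) z ^+ s * (kap i * z ^+ (t * D i) * (i%:R * (z ^+ s) ^+ i.-1))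
        = z ^+ E' * q%:R * (z * R^`().[z]).
  rewrite /R /residual raddf_sum /= horner_sum !mulr_sumr; apply: eq_bigr => i _.
  have [->|ki] := eqVneq (kap i) 0; first by rewrite scale0r deriv0 horner0; ring.
  have [e1 _] := hE' i (ltn_ord i) ki; have e2 := rho i (ltn_ord i) ki.
  rewrite derivZ derivXn hornerZ hornerMn hornerXn.
  have -> : (i : nat)%:R = q%:R * (i %/ q)%:R :> L by rewrite {1}e2 natrM.
  have [d0|d0] := posnP (i %/ q); first by rewrite d0 !(mulr0, mul0r, mulr0n).
  have i1 : (0 < i)%N by rewrite e2 muln_gt0 q0.
  transitivity (kap i * (q%:R * (i %/ q)%:R) * z ^+ (t * D i + s * i)).
    rewrite exprD -[in X in _ = _ * (_ * z ^+ (s * X))](prednK i1) mulnS exprD (exprM z s); ring.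
  rewrite e1 exprD -[in X in z ^+ E' * z ^+ X](prednK d0) exprS -mulr_natr; ring.
rewrite RP derivZ hornerZ !mulf_neq0 ?expf_neq0 //.
exact: irr_separable.
Qed.
End ResidualUse.
End Subfield.

(** * Rationality over a subfield and spanning families *)

Section Rationality.
Variables (L : fieldType) (Kp : L -> Prop).
Hypothesis KF : is_subfield Kp.

Definition rats (f : ser L) := forall j, Kp (f j).
Definition ratp (p : {poly ser L}) := forall i, rats p`_i.

Lemma rats_sC c : Kp c -> rats (sC c).
Proof. by move=> hc j; rewrite /sC; case: eqP => // _; apply: sf0. Qed.
Lemma rats_sX a : rats (sX a).
Proof. by move=> j; apply: sf_nat. Qed.
Lemma ratsD f g : rats f -> rats g -> rats (f + g).
Proof. by move=> hf hg j; rewrite serD; apply: sfD. Qed.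
Lemma ratsM f g : rats f -> rats g -> rats (f * g).
Proof. by move=> hf hg j; rewrite serM; apply: sf_sum => // i _; apply: sfM. Qed.
Lemma rats_ssub z e f : Kp z -> rats f -> rats (ssub z e f).
Proof.
move=> hz hf j; rewrite /ssub; case: ifP => _; last exact: sf0.
by apply: sfM => //; apply: sfX.
Qed.
Lemma rats_sum (I : Type) (r : seq I) (T : pred I) (F : I -> ser L) :
  (forall i, T i -> rats (F i)) -> rats (\sum_(i <- r | T i) F i).
Proof. by move=> h j; rewrite ser_sum; apply: sf_sum => // i Ti; apply: h. Qed.

Lemma ratpD p q : ratp p -> ratp q -> ratp (p + q).
Proof. by move=> hp hq i; rewrite coefD; apply: ratsD. Qed.
Lemma ratpM p q : ratp p -> ratp q -> ratp (p * q).
Proof. by move=> hp hq i; rewrite coefM; apply: rats_sum => // u _; apply: ratsM. Qed.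
Lemma ratpC f : rats f -> ratp f%:P.
Proof.
by move=> hf i; rewrite coefC; case: eqP => // _ j; rewrite ser0; apply: sf0.
Qed.
Lemma ratpX : ratp 'X.
Proof.
move=> i; rewrite coefX; case: eqP => _ j; last exact: sf0.
exact: (sf_nat KF (j == 0%N)).
Qed.
Lemma ratpXn p n : ratp p -> ratp (p ^+ n).
Proof.
move=> hp; elim: n => [|n IH]; last by rewrite exprS; apply: ratpM.
by rewrite expr0; apply: ratpC => j; rewrite ser1; apply: sf_nat.
Qed.
Lemma ratp_sbst (A : comNzRingType) (f : {rmorphism A -> ser L}) Y (p : {poly A}) :
  (forall i, rats (f p`_i)) -> ratp Y -> ratp (sbst f Y p).
Proof.
move=> hf hY i; rewrite (sbstE _ _ (leqnn _)) coef_sum; apply: rats_sum => u _.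
by apply: (@ratpM); [apply: ratpC|apply: ratpXn].
Qed.
Lemma ratp_theta z q m delta p : Kp z -> rats delta -> ratp p ->
  ratp (theta z q m delta p).
Proof.
move=> hz hd hp; apply: ratp_sbst; first by move=> i; apply: rats_ssub.
by apply: ratpM; [apply/ratpC/rats_sX|apply: ratpD; [exact: ratpX|exact: ratpC]].
Qed.
Lemma ratp_shift a p : ratp ((sX a)%:P * p) -> ratp p.
Proof.
by move=> h i j; have := h i (j + a)%N; rewrite coefCM sXM leq_addl addnK.
Qed.

Definition slice (p : {poly ser L}) j : {poly L} := \poly_(i < size p) p`_i j.
Lemma sliceE p j i : (slice p j)`_i = p`_i j.
Proof. by rewrite coef_poly; case: ltnP => // h; rewrite nth_default. Qed.
Lemma sliceM p q j : slice (p * q) j = \sum_(v < j.+1) slice p v * slice q (j - v).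
Proof.
apply/polyP => i; rewrite sliceE coefM ser_sum coef_sum.
transitivity (\sum_(u < i.+1) \sum_(v < j.+1) p`_u v * q`_(i - u) (j - v)%N).
  by apply: eq_bigr => u _; rewrite serM.
rewrite exchange_big; apply: eq_bigr => v _; rewrite coefM; apply: eq_bigr => u _.
by rewrite !sliceE.
Qed.

(** Below degree n the left-hand polynomial is B C, a triangular system for the coefficients of C
    with the invertible constant term of B on the diagonal. Then A is what remains. *)
Lemma weierstrass_split_over (A B C : {poly L}) n :
  polyover Kp (A * 'X^n + B * C) -> polyover Kp B -> B`_0 != 0 ->
  (forall i, (n <= i)%N -> Kp C`_i) -> polyover Kp A /\ polyover Kp C.
Proof.
move=> hD hB B0 hC.
have hC' : polyover Kp C.
  move=> i; elim/ltn_ind: i => i IH; case: (ltnP i n) => [lt|]; last exact: hC.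
  have := hD i; rewrite coefD coefMXn lt add0r coefM big_ord_recl subn0 => h.
  have -> : C`_i = (B`_0)^-1 * (B`_0 * C`_i) by rewrite mulKf.
  apply: sfM => //; first by apply: sfV.
  rewrite -[_ * _](addrK (\sum_(u < i) B`_(bump 0 u) * C`_(i - bump 0 u))).
  apply: sfB => //; apply: sf_sum => // u _; apply: sfM => //.
  by apply: IH; have := ltn_ord u; rewrite /bump; lia.
split=> // i; have := hD (i + n)%N; rewrite coefD coefMXn ltnNge leq_addl addnK /=.
move=> h; rewrite -[A`_i](addrK (B * C)`_(i + n)); apply: sfB => //.
exact: poM.
Qed.

(** Uniqueness of Weierstrass preparation, read by powers of x. The x^j-part of U G is U_j y^n + U_0
    G_j plus terms from earlier slices, and [weierstrass_split_over] solves for U_j and G_j inside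
    the subfield. *)
Lemma weierstrass_rat a (U G : {poly ser L}) n :
  ratp ((sX a)%:P * (U * G)) -> U`_0 0%N != 0 ->
  (forall i, (i < n)%N -> G`_i 0%N = 0) -> G`_n = 1 -> (size G <= n.+1)%N ->
  ratp U /\ ratp G.
Proof.
move=> /ratp_shift hQ U0 G0 Gn sG.
have GE i j : (n <= i)%N -> G`_i j = (((i == n) && (j == 0))%N)%:R.
  rewrite leq_eqVlt => /orP[/eqP<-|ni]; first by rewrite Gn ser1 eqxx.
  by rewrite (gtn_eqF ni) nth_default //; apply: (leq_trans sG ni).
have sG0 : slice G 0 = 'X^n.
  apply/polyP => i; rewrite sliceE coefXn; case: (ltnP i n) => ni; last first.
    by rewrite GE // eqxx andbT.
  by rewrite G0 // (ltn_eqF ni).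
have key j : polyover Kp (slice U j) /\ polyover Kp (slice G j).
  elim/ltn_ind: j => j IH.
  have hQj : polyover Kp (slice (U * G) j) by move=> i; rewrite sliceE; apply: hQ.
  move: hQj; rewrite sliceM; case: j IH => [|j] IH.
    rewrite big_ord1 subn0 sG0 => h; split; last exact: poXn.
    by move=> i; have := h (i + n)%N; rewrite coefMXn ltnNge leq_addl addnK.
  rewrite big_ord_recl big_ord_recr /= /bump /= add1n subnn subn0 sG0.
  set T := \sum_(i < j) _ => h.
  have hT : polyover Kp T.
    apply: po_sum => // i _; have := ltn_ord i; rewrite /= => ij.
    by apply: poM => //; [apply: (IH _ _).1|apply: (IH _ _).2]; lia.
  apply: (@weierstrass_split_over _ (slice U 0) _ n).
  - have := poB KF h hT; congr polyover; ring.
  - exact: (IH 0%N _).1.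
  - by rewrite sliceE.
  - by move=> i ni; rewrite sliceE GE // andbF; apply: sf0.
by split=> i j; rewrite -sliceE; [apply: (key j).1|apply: (key j).2].
Qed.
End Rationality.

(** In [is_run] the unit is a series in y with no degree bound. Since G is y^n at x = 0 and has
    degree n, the coefficient of y^(i+n) x^j in U G is that of y^i x^j in U, as soon as U has no
    terms above M at smaller powers of x. *)
Lemma unit_ydeg (L : fieldType) a (U G : bser L) n M :
  weierstrass G n -> ydeg_le (bmul (bxpow a) (bmul U G)) M -> ydeg_le U M.
Proof.
case=> [[Gd [G1 G1']] G0] h.
have hUG i j : (M < i)%N -> bmul U G i j = 0.
  move=> Mi; rewrite -(h i (j + a)%N Mi) {2}/bmul big_ord_recl /=.
  rewrite [X in _ + X]big1 => [|u _]; last first.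
    by rewrite big1 // => v _; rewrite /bxpow /= mul0r.
  have aj : (a < (j + a).+1)%N by lia.
  rewrite (bigD1 (Ordinal aj)) //= /bxpow !eqxx mul1r big1 ?addr0 => [|v va].
    by rewrite subn0 addnK.
  by rewrite (_ : (v == a :> nat) = false) ?mul0r //; apply/negbTE.
move=> i j; elim/ltn_ind: j i => j IH i Mi.
have := hUG (i + n)%N j; rewrite /bmul => /(_ (ltn_addr _ Mi)).
have iN : (i < (i + n).+1)%N by lia.
rewrite (bigD1 (Ordinal iN)) //= big_ord_recr /= subnn addKn G1 mulr1.
rewrite [X in X + _ + _]big1 => [|v _]; last by rewrite IH ?mul0r.
rewrite add0r big1 ?addr0 // => u ui; apply: big1 => v _.
case: (ltnP M u) => Mu; last by rewrite Gd ?mulr0 //; lia.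
have := ltn_ord v; rewrite ltnS leq_eqVlt => /orP[/eqP ->|vj]; last by rewrite IH ?mul0r.
rewrite subnn; case: (ltngtP (i + n - u)%N n) => [lt|gt|e].
- by rewrite G0 ?mulr0.
- by rewrite Gd ?mulr0.
by case/eqP: ui; apply: val_inj => /=; have := ltn_ord u; lia.
Qed.

Section Span.
Variables (K L : fieldType).

Definition spans (Kp : L -> Prop) (rho : ser K -> ser L) (I : finType) (b : I -> ser L) :=
  (forall i, rats Kp (b i)) /\
  forall f, rats Kp f -> exists c : I -> ser K, f = \sum_i rho (c i) * b i.

(** Determinant trick: multiplication by S acts on the generators by a matrix A over K[[x]], the
    generators form a null vector of S - A, and the adjugate gives det(S - A) b_i = 0, in particular
    for b_i = 1. The family only generates, so minimality must come from elsewhere ([phi_min]). *)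
Lemma charpoly_root (Kp : L -> Prop) (rho : {rmorphism ser K -> ser L})
    (I : finType) (b : I -> ser L) i0 (S : ser L) :
  is_subfield Kp -> spans Kp rho b -> b i0 = 1 -> rats Kp S ->
  exists chi : {poly ser K}, [/\ chi \is monic, size chi = #|I|.+1 &
     (map_poly rho chi).[S] = 0].
Proof.
move=> KF [hb hs] b1 hS.
have /choice [M hM] : forall i, exists c : I -> ser K, S * b i = \sum_j rho (c j) * b j.
  by move=> i; apply: hs; apply: ratsM.
pose A : 'M[ser K]_#|I| := \matrix_(i, j) M (enum_val i) (enum_val j).
exists (char_poly A); split; rewrite ?char_poly_monic ?size_char_poly //.
pose B : 'M[ser L]_#|I| := S%:M - map_mx rho A.
have -> : (map_poly rho (char_poly A)).[S] = \det B.
  rewrite map_char_poly /char_poly -[LHS]/(horner_eval S _) -det_map_mx.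
  congr (\det _); apply/matrixP => i j; rewrite !mxE /horner_eval.
  rewrite -[LHS]/((_ - _).[S]).
  by rewrite hornerD hornerN hornerC hornerMn hornerX.
pose v : 'cV[ser L]_#|I| := \col_i b (enum_val i).
have Bv : B *m v = 0.
  apply/matrixP => i j; rewrite mulmxBl mul_scalar_mx !mxE hM.
  rewrite (reindex_onto (@enum_val _ (mem I)) enum_rank) /=; last by move=> *; rewrite enum_rankK.
  apply/eqP; rewrite subr_eq0; apply/eqP; apply: eq_big => [k|k _].
    by rewrite enum_valK eqxx.
  by rewrite !mxE.
have : \adj B *m (B *m v) = 0 by rewrite Bv mulmx0.
rewrite mulmxA mul_adj_mx mul_scalar_mx => /matrixP/(_ (enum_rank i0) 0).
by rewrite !mxE enum_rankK b1 mulr1.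
Qed.

(** New generators are x^i z^u b(zeta x^q) with i < q and u < deg P: sort the exponents of f by
    their residue mod q, then expand each coefficient in powers of z. *)
Lemma spans_step (Kp Kp' : L -> Prop) (P : {poly L}) z zeta q (rho rho' : ser K -> ser L)
    (I : finType) (b : I -> ser L) i0 :
  is_subfield Kp -> is_subfield Kp' -> P \is monic -> polyover Kp P -> (1 < size P)%N ->
  P.[z] = 0 ->
  (forall c, Kp' c <-> exists p, polyover Kp p /\ c = p.[z]) ->
  Kp' zeta -> zeta != 0 -> (0 < q)%N ->
  (forall c, rho' c = ssub zeta q (rho c)) ->
  spans Kp rho b -> b i0 = 1 ->
  exists (I' : finType) (b' : I' -> ser L) (i0' : I'),
   [/\ spans Kp' rho' b', b' i0' = 1 & #|I'| = (q * (size P).-1 * #|I|)%N].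
Proof.
move=> KF KF' Pm Po P1 Pz hK' hz z0 q0 hrho [hb hs] b1.
set l := (size P).-1; have l0 : (0 < l)%N by rewrite /l; size_lia.
have KK' c : Kp c -> Kp' c.
  by move=> hc; apply/hK'; exists c%:P; rewrite hornerC; split=> //; apply: poC.
have Kz : Kp' z.
  by apply/hK'; exists 'X; rewrite hornerX; split=> //; apply: (poXn KF 1).
pose I' : finType := ('I_q * 'I_l * I)%type.
pose b' (x : I') := sX x.1.1 * sC (z ^+ x.1.2) * ssub zeta q (b x.2).
exists I', b', (Ordinal q0, Ordinal l0, i0); split; last first.
- by rewrite !card_prod !card_ord.
- by rewrite /b' /= b1 rmorph1 mulr1 expr0 sX0 sC1 mul1r.
split=> [x|f hf].
  apply: ratsM => //; last by apply: rats_ssub => // j; apply/KK'/hb.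
  by apply: ratsM => //; [apply: rats_sX|apply: rats_sC => //; apply: sfX].
(* The substitution x := zeta x^q multiplies the coefficient of index [n %/ q] by zeta^(n %/ q),
   which is divided out beforehand. *)
have /choice [p hp] : forall n, exists p,
    [/\ polyover Kp p, (size p <= l)%N & f n * zeta ^- (n %/ q) = p.[z]].
  move=> n; apply: (adjoin_basis KF Pm Po Pz hK').
  by apply: sfM => //; apply: sfV => //; apply: sfX.
have /choice [c hc] : forall iu : 'I_q * 'I_l, exists c : I -> ser K,
    (fun n => (p (n * q + iu.1)%N)`_iu.2) = \sum_j rho (c j) * b j.
  by move=> iu; apply: hs => n; case: (hp (n * q + iu.1)%N).
exists (fun x : I' => c x.1 x.2).
transitivity (\sum_(iu : 'I_q * 'I_l) sX iu.1 * sC (z ^+ iu.2) *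
   ssub zeta q ((fun n => (p (n * q + iu.1)%N)`_iu.2) : ser L)); last first.
  rewrite -(pair_bigA _ (fun iu j => rho' (c iu j) * b' (iu, j))) /=.
  apply: eq_bigr => iu _; rewrite hc rmorph_sum mulr_sumr; apply: eq_bigr => j _.
  by rewrite rmorphM /b' /= hrho; ring.
rewrite -(pair_bigA _ (fun (i : 'I_q) (u : 'I_l) => sX i * sC (z ^+ u) *
   ssub zeta q ((fun n => (p (n * q + i)%N)`_u) : ser L))) /=.
apply: serP => N; rewrite ser_sum.
have iN : (N %% q < q)%N by rewrite ltn_mod.
rewrite (bigD1 (Ordinal iN)) //= [X in _ + X]big1 ?addr0 => [|i iq]; last first.
  rewrite ser_sum big1 // => u _; rewrite -mulrA sXM; case: leqP => // le.
  rewrite sCM ssubE //; case: ifP => [dv|_]; last by rewrite mulr0.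
  case/eqP: iq; apply: val_inj => /=; rewrite -(subnK le) -(divnK dv).
  by rewrite modnMDl modn_small.
rewrite ser_sum; transitivity (\sum_(u < l) (p N)`_u * z ^+ u * zeta ^+ (N %/ q)).
  rewrite -mulr_suml -(horner_coef_wide z) //; last by case: (hp N).
  by case: (hp N) => _ _ <-; rewrite mulfVK // expf_neq0.
apply: eq_bigr => u _; rewrite -(mulrA (sX _)) sXM leq_mod.
have -> : (N - N %% q = N %/ q * q)%N by rewrite {1}(divn_eq N q) addnK.
rewrite sCM ssubE // dvdn_mull // mulnK // -divn_eq; ring.
Qed.
End Span.

(** * Multi-indices and independence of the leading coefficients *)

Lemma adic_expansion (A : comNzRingType) (theta : {poly A}) N0 M (p : {poly A}) :
  theta \is monic -> size theta = N0.+1 -> (size p <= N0 * M)%N ->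
  exists a : nat -> {poly A}, (forall i, (size (a i) <= N0)%N) /\
    p = \sum_(i < M) a i * theta ^+ i.
Proof.
move=> tm ts; elim: M p => [|M IH] p.
  rewrite muln0 size_poly_leq0 => /eqP ->; exists (fun _ => 0).
  by rewrite big_ord0; split=> // i; rewrite size_poly0.
move=> sp; have e := Pdiv.RingMonic.rdivp_eq tm p.
set Q := Pdiv.Ring.rdivp p theta in e; set T := Pdiv.Ring.rmodp p theta in e.
have sT : (size T <= N0)%N by rewrite -ltnS -ts Pdiv.Ring.ltn_rmodpN0 ?monic_neq0.
have [|a [ha eQ]] := IH Q.
  have [->|Q0] := eqVneq Q 0; first by rewrite size_poly0.
  have sQ : (0 < size Q)%N by rewrite size_poly_gt0.
  have sQt : size (Q * theta) = (size Q + N0)%N by rewrite size_Mmonic // ts addnS.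
  move: sp; rewrite e size_polyDl; first by rewrite sQt mulnS addnC leq_add2l.
  by rewrite sQt; apply: (leq_ltn_trans sT); rewrite -[X in (X < _)%N]add0n ltn_add2r.
exists (fun i => if i is j.+1 then a j else T); split; first by case.
rewrite big_ord_recl expr0 mulr1 addrC {1}e; congr (_ + _).
rewrite {1}eQ mulr_suml; apply: eq_bigr => i _ /=.
by rewrite exprSr mulrA.
Qed.

Section Boxes.
Variable n : nat -> nat.

Definition boxed k (B : seq nat) :=
  size B = k.+1 /\ forall i, (1 <= i <= k)%N -> (nth 0%N B i < n i)%N.

(** Lists the tails (b_0, ..., b_{k-1}). The unbounded exponent of x is left out, being absorbed
    into a coefficient in K[[x]], so the list is finite. *)
Fixpoint box k : seq (seq nat) :=
  if k is k'.+1 then [seq rcons B i | B <- box k', i <- iota 0 (n k)] else [:: [::]].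

Lemma boxP k B : reflect (boxed k (0%N :: B)) (B \in box k).
Proof.
apply: (iffP idP); rewrite /boxed.
  elim: k B => [|k IH] B /=; first by rewrite inE => /eqP ->; split=> // i; lia.
  case/allpairsP=> -[B' i] /= [hB']; rewrite mem_iota add0n => /= hi ->.
  have [] := IH B' hB' => -[sB] hb; rewrite size_rcons; split=> [|[|j] //= jk].
    by rewrite sB.
  rewrite nth_rcons sB; case: (ltnP j k) => [lt|le]; first by apply: (hb j.+1); lia.
  by have -> : j = k; [lia|rewrite eqxx].
elim: k B => [|k IH] B [] /=; first by case: B.
case/lastP: B => [|B i] //; rewrite size_rcons => -[] sB h.
apply/allpairsP; exists (B, i) => /=; split=> //.
  apply: IH; rewrite /= sB; split=> // -[|j] // jk.
  have jk' : (j < k)%N by lia.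
  have j1 : (0 < j.+1 <= k.+1)%N by lia.
  by have := h _ j1; rewrite /= nth_rcons sB jk'.
have k1 : (0 < k.+1 <= k.+1)%N by rewrite leqnn.
by rewrite mem_iota /= add0n; have := h _ k1; rewrite /= nth_rcons sB ltnn eqxx.
Qed.
Lemma box_uniq k : uniq (box k).
Proof.
elim: k => [|k IH] //=; apply: allpairs_uniq => //; first exact: iota_uniq.
by move=> [B i] [B' i'] _ _ /= /rcons_inj [-> ->].
Qed.
Lemma boxed_cons k v v' B : boxed k (v :: B) -> boxed k (v' :: B).
Proof. by move=> [sB hB]; split=> // -[|i] // /hB. Qed.
End Boxes.

Definition dot (V : nat -> nat) k (B : seq nat) := (\sum_(p < k.+1) nth 0 B p * V p)%N.
Lemma dot_cons V k v B :
  dot V k (v :: B) = (v * V 0 + \sum_(t < k) nth 0 B t * V t.+1)%N.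
Proof. by rewrite /dot big_ord_recl. Qed.
Lemma dot_rcons V k B i : size B = k.+1 ->
  dot V k.+1 (rcons B i) = (dot V k B + i * V k.+1)%N.
Proof.
move=> sB; rewrite /dot big_ord_recr /= nth_rcons sB ltnn eqxx; congr (_ + _)%N.
by apply: eq_bigr => p _; rewrite nth_rcons sB ltn_ord.
Qed.

Definition lam (L : comNzRingType) (la : nat -> L) k (B : seq nat) :=
  \prod_(p < k.+1) la p ^+ nth 0%N B p.
Lemma lam_cons (L : comNzRingType) (la : nat -> L) k v B :
  lam la k (v :: B) = la 0%N ^+ v * \prod_(t < k) la t.+1 ^+ nth 0%N B t.
Proof. by rewrite /lam big_ord_recl. Qed.
Lemma lam_rcons (L : comNzRingType) (la : nat -> L) k B i : size B = k.+1 ->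
  lam la k.+1 (rcons B i) = lam la k B * la k.+1 ^+ i.
Proof.
move=> sB; rewrite /lam big_ord_recr /= nth_rcons sB ltnn eqxx; congr (_ * _).
by apply: eq_bigr => p _; rewrite nth_rcons sB ltn_ord.
Qed.

Section Independence.
Variables (K L : fieldType) (iota : {rmorphism K -> L}) (n : nat -> nat).

(** Independence over K is asked only among indices of the same weight, since only these can cancel
    in a leading coefficient. *)
Definition LI k (V : nat -> nat) (la : nat -> L) :=
  forall (s : seq (seq nat)) (f : seq nat -> K) w, uniq s ->
  (forall B, B \in s -> boxed n k B /\ dot V k B = w) ->
  \sum_(B <- s) iota (f B) * lam la k B = 0 -> forall B, B \in s -> f B = 0.

Lemma LI0 V la : (0 < V 0)%N -> la 0%N != 0 -> LI 0 V la.
Proof.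
move=> V0 l0 s f w us hs; case: s us hs => [|B [|B' s]] //= us hs.
  rewrite big_seq1 => /eqP; rewrite mulf_eq0 fmorph_eq0 => /orP[/eqP fB|].
    by move=> B'; rewrite inE => /eqP ->.
  by rewrite prodf_seq_eq0 => /hasP[p _]; rewrite expf_eq0 ord1 (negPf l0) andbF.
suff e : B = B' by move: us; rewrite e inE eqxx.
have [|[sB _] dB] := hs B; first by rewrite inE eqxx.
have [|[sB' _] dB'] := hs B'; first by rewrite !inE eqxx orbT.
move: dB dB'; rewrite /dot !big_ord1; case: B B' sB sB' {us hs} => [|b [|]] // [|b' [|]] //= _ _.
by move=> <- /eqP; rewrite eqn_pmul2r // => /eqP ->.
Qed.

Lemma big_fiber (R : nmodType) (M : nat) (s : seq (seq nat)) (g : seq nat -> nat) (G : seq nat -> R) :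
  (forall B, B \in s -> (g B < M)%N) ->
  \sum_(B <- s) G B = \sum_(i < M) \sum_(B <- s | g B == i) G B.
Proof.
move=> h; under [RHS]eq_bigr do rewrite big_mkcond.
rewrite exchange_big big_seq [RHS]big_seq; apply: eq_bigr => B Bs /=.
rewrite -big_mkcond (bigD1 (Ordinal (h B Bs))) //= big1 ?addr0 // => i /andP[/eqP e ne].
by case/eqP: ne; apply: val_inj.
Qed.

(** Group by the last exponent i. The passage to [V'], [la'] multiplies a product of old weight D by
    z^(t D + s0 i). The group sums without this factor lie in Kp, so [residual_indep] makes each
    vanish, and each is a relation of fixed weight at the previous level. *)
Lemma LI_step (Kp : L -> Prop) (P : {poly L}) z q m s0 t k (V V' : nat -> nat) (la la' : nat -> L) :
  is_subfield Kp -> P \is monic -> polyover Kp P -> irr_over Kp P -> P.[z] = 0 ->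
  z != 0 -> (0 < q)%N -> (q * s0 = m * t + 1)%N -> (forall c, Kp (iota c)) ->
  n k.+1 = (q * (size P).-1)%N ->
  (forall p, (p <= k.+1)%N -> Kp (la p)) -> la k.+1 != 0 ->
  (forall p, (p <= k)%N -> V' p = (q * V p)%N) -> V' k.+1 = (q * V k.+1 + m)%N ->
  (forall p, (p <= k)%N -> la' p = la p * (z ^+ t) ^+ V p) ->
  la' k.+1 = la k.+1 * (z ^+ t) ^+ V k.+1 * z ^+ s0 ->
  LI k V la -> LI k.+1 V' la'.
Proof.
move=> KF Pm Po Pi Pz z0 q0 qs Ki nk hla lk0 hV hVk hl hlk IH s f w us hs.
pose g (B : seq nat) := nth 0%N B k.+1.
have dec B : B \in s -> exists B' i, [/\ B = rcons B' i, size B' = k.+1, g B = i, (i < n k.+1)%N &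
    boxed n k B' /\ (q * (dot V k B' + i * V k.+1) + m * i = w)%N].
  move=> Bs; have [[sB hB] dB] := hs B Bs.
  case/lastP: B sB hB dB {Bs} => [|B' i] //; rewrite size_rcons => -[sB'] hB dB.
  have gB : g (rcons B' i) = i by rewrite /g nth_rcons sB' ltnn eqxx.
  exists B', i; split=> //; first by rewrite -{1}gB; apply: hB; rewrite leqnn.
  split; first split=> // j jk.
    have jk' : (j < k.+1)%N by lia.
    have j1 : (1 <= j <= k.+1)%N by lia.
    by have := hB j j1; rewrite nth_rcons sB' jk'.
  rewrite -dB dot_rcons // hVk mulnDr.
  have -> : dot V' k B' = (q * dot V k B')%N.
    rewrite /dot big_distrr /=; apply: eq_bigr => p _.
    by rewrite hV 1?mulnCA // -ltnS.
  lia.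
(* For fixed new weight w, the exponent i determines the old weight of the whole product; the
   truncated quotient has this meaning only for the i that occur in [s]. *)
pose D i := ((w - m * i) %/ q)%N.
have hD B' i : (q * (dot V k B' + i * V k.+1) + m * i = w)%N -> D i = (dot V k B' + i * V k.+1)%N.
  by move=> e; rewrite /D -e addnK mulKn.
pose kap i := (\sum_(B <- s | g B == i) iota (f B) * lam la k (take k.+1 B)) * la k.+1 ^+ i.
have tk B' i : size B' = k.+1 -> take k.+1 (rcons B' i) = B'.
  by move=> sB; rewrite -sB -cats1 take_size_cat.
have act i : kap i != 0 -> exists2 B, B \in s & g B = i.
  move=> ki; apply: contra_neqP ki => no; rewrite /kap big_seq_cond big1 ?mul0r // => B /andP[Bs /eqP gB].
  by case: no; exists B.
rewrite (@big_fiber _ (q * (size P).-1) _ g) => [hsum|B Bs]; last first.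
  by have [B' [i [_ _ -> ? _]]] := dec B Bs; rewrite -nk.
have k0 : forall i, (i < q * (size P).-1)%N -> kap i = 0.
  apply: (@residual_indep _ _ _ _ KF Pm Po Pi Pz q m s0 t w D kap q0 qs z0).
  - move=> i _ /act [B Bs gB]; have [B' [i' [eB sB' gB' _ [_ e]]]] := dec B Bs.
    by move: gB'; rewrite gB => ei; rewrite -ei in e; rewrite (hD _ _ e).
  - move=> i _; apply: sfM => //; last by apply: sfX => //; apply: hla.
    apply: sf_sum => // B _; apply: sfM => //; apply: sf_prod => // p _; apply: sfX => //.
    by apply: hla; apply: ltnW.
  rewrite -[RHS]hsum; apply: eq_bigr => i _; rewrite /kap !mulr_suml big_seq_cond [RHS]big_seq_cond.
  apply: eq_bigr => B /andP[Bs /eqP gB]; have [B' [i' [eB sB' gB' _ [_ e]]]] := dec B Bs.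
  have ei : i' = i by rewrite -gB' gB.
  rewrite eB tk // lam_rcons // ei hlk.
  have -> : lam la' k B' = lam la k B' * (z ^+ t) ^+ dot V k B'.
    rewrite /lam /dot expr_sum -big_split /=; apply: eq_bigr => p _.
    by rewrite (hl _ (ltn_ord p)) exprMn (mulnC _ (V p)) exprM.
  rewrite ei in e; rewrite (hD _ _ e) exprD (exprM z t) (exprM z s0) exprD.
  by rewrite !exprMn (mulnC i) (exprM _ (V k.+1)); ring.
move=> B Bs; have [B' [i [eB sB' gB iN [bB e]]]] := dec B Bs.
pose si := [seq take k.+1 B | B <- s & g B == i].
have hsi B0 : B0 \in si -> exists2 B1, B1 \in s /\ g B1 = i & [/\ B1 = rcons B0 i, boxed n k B0 & dot V k B0 = dot V k B'].
  case/mapP=> B1; rewrite mem_filter => /andP[/eqP g1 B1s] ->.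
  have [B1' [i1 [eB1 s1 gi1 _ [b1 e1]]]] := dec B1 B1s; exists B1 => //.
  have ei : i1 = i by rewrite -gi1 g1.
  rewrite eB1 tk // -ei; split=> //.
  by move: (hD _ _ e) (hD _ _ e1); rewrite ei; lia.
rewrite eB -[f _]/((fun B0 => f (rcons B0 i)) B').
apply: (IH si _ (dot V k B')); last first.
- by apply/mapP; exists B; [rewrite mem_filter gB eqxx|rewrite eB tk].
- have := k0 i; rewrite -nk => /(_ iN) /eqP; rewrite mulf_eq0 expf_eq0 (negPf lk0) andbF orbF => /eqP.
  move=> h0; rewrite -[RHS]h0 big_map big_filter big_seq_cond [RHS]big_seq_cond.
  apply: eq_bigr => B1 /andP[B1s /eqP g1].
  have [B1' [i1 [eB1 s1 gi1 _ [b1 e1]]]] := dec B1 B1s.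
  have ei : i1 = i by rewrite -gi1 g1.
  by rewrite eB1 tk // ei.
- by move=> B0 /hsi [B1 _ [_ b1 d1]].
rewrite map_inj_in_uniq ?filter_uniq // => B1 B2.
rewrite !mem_filter => /andP[/eqP g1 h1] /andP[/eqP g2 h2].
have [B1' [i1 [e1 s1 gi1 _ _]]] := dec B1 h1.
have [B2' [i2 [e2 s2 gi2 _ _]]] := dec B2 h2.
by rewrite e1 e2 !tk // -gi1 -gi2 g1 g2 => ->.
Qed.
End Independence.

(** * Leading terms of adic expansions *)

(* At level 0 slope zero is allowed, since there the polynomials of small
   y-degree do not involve y. *)
Definition allowed k m q := (0 < q)%N /\ ((0 < m)%N \/ k = 0%N).

(** Asking for all weights at once makes w the order in x and c the trailing coefficient in y
    ([AL_div], [VL_AL]); a single weight would not. *)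
Definition AL (L : fieldType) k (p : {poly ser L}) c w i :=
  forall m q, allowed k m q -> ld m q p c w i.

Section AllowedLeads.
Variable L : fieldType.
Implicit Types p : {poly ser L}.

Lemma AL_coef k p c w i : AL k p c w i -> p`_i w = c.
Proof. by move/(_ 1%N 1%N) => h; apply: (ldP (h _)); split=> //; left. Qed.
(* The weights (1, i + 1) see that x^w divides the coefficient of y^i. *)
Lemma AL_div k p c w i0 : AL k p c w i0 -> forall i j, (j < w)%N -> p`_i j = 0.
Proof.
move=> h i j jw; case: (eqVneq (p`_i j) 0) => // nz.
have /ld_wgt : ld 1 i.+1 p c w i0 by apply: h; split=> //; left.
move/(_ i j nz); rewrite !mul1n !mulSn => le.
suff : (i * j + i <= i * w)%N by lia.
by rewrite -mulnSr leq_mul2l jw orbT.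
Qed.
End AllowedLeads.

Lemma vval_eq (L : fieldType) (h : bser L) v i :
  h i v != 0 -> (forall i j, (j < v)%N -> h i j = 0) -> vval h = v.
Proof.
move=> hv hlt; rewrite /vval.
have ex : exists v, (exists i, h i v != 0) /\ (forall i j, h i j != 0 -> (v <= j)%N).
  exists v; split=> [|i' j]; first by exists i.
  by apply: contra_neqT; rewrite -ltnNge; apply: hlt.
have [[i' nz] le] := ClassicalEpsilon.epsilon_spec (inhabits 0%N) _ ex.
set u := ClassicalEpsilon.epsilon _ _ in nz le *.
apply/eqP; rewrite eqn_leq (le _ _ hv) leqNgt; apply/negP => lt.
by rewrite hlt ?eqxx in nz.
Qed.

Lemma lval_eq (L : fieldType) (h : bser L) i :
  h i (vval h) != 0 -> (forall i', (i' < i)%N -> h i' (vval h) = 0) -> lval h = h i (vval h).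
Proof.
move=> nz lt; rewrite /lval.
have ex : exists l, exists i0, h i0 (vval h) = l /\ l != 0 /\
    forall i, (i < i0)%N -> h i (vval h) = 0.
  by exists (h i (vval h)), i.
have [i0 [e [ne h0]]] := ClassicalEpsilon.epsilon_spec (inhabits 0) _ ex.
set l := ClassicalEpsilon.epsilon _ _ in e ne h0 *; rewrite -e.
case: (ltngtP i i0) => [/h0 z|/lt z|->//]; first by rewrite z eqxx in nz.
by rewrite -e z eqxx in ne.
Qed.

Lemma fsum_eq (L : comNzRingType) (S : seq nat -> Prop) (f : seq nat -> L) s :
  uniq s -> (forall B, B \in s <-> S B) -> fsum S f = \sum_(B <- s) f B.
Proof.
move=> us hs; rewrite /fsum.
have ex : exists v, exists s, uniq s /\ (forall B, B \in s <-> S B) /\ v = \sum_(B <- s) f B.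
  by exists (\sum_(B <- s) f B), s.
have [s' [us' [hs' ->]]] := ClassicalEpsilon.epsilon_spec (inhabits 0) _ ex.
apply: perm_big; apply: uniq_perm => // B.
by apply/idP/idP => h; [apply/hs/hs'|apply/hs'/hs].
Qed.

Section LeadSum.
Variables (K L : fieldType) (iota : {rmorphism K -> L}) (n : nat -> nat) (k : nat).
Variables (Pi : {rmorphism {poly ser K} -> {poly ser L}}) (mu : L) (e : nat).
Variables (V : nat -> nat) (la : nat -> L) (Psi : nat -> {poly ser K}).
Hypotheses (e0 : (0 < e)%N) (V0 : V 0 = e) (l0 : la 0%N = mu)
  (PiC : forall c, Pi c%:P = (ssub mu e (smapr iota c))%:P)
  (hPsi : forall t, (t < k)%N -> AL k (Pi (Psi t)) (la t.+1) (V t.+1) 0)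
  (hLI : LI iota n k V la).

Definition PsiProd (B : seq nat) := \prod_(t < k) Psi t ^+ nth 0%N B t.
(** As x has weight e, a tail B admits at most one exponent of x giving total weight w; [sel]
    completes the tails for which it exists. *)
Definition sel (S : seq (seq nat)) w := [seq ((w - dot V k (0%N :: B)) %/ e)%N :: B |
   B <- S & (dot V k (0%N :: B) <= w)%N && (e %| w - dot V k (0%N :: B))%N].

Lemma sel_uniq S w : uniq S -> uniq (sel S w).
Proof.
move=> uS; rewrite map_inj_in_uniq ?filter_uniq // => B B' _ _ [_] //.
Qed.
Lemma selP S w v B : (v :: B \in sel S w) <-> B \in S /\ dot V k (v :: B) = w.
Proof.
split.
  case/mapP=> B'; rewrite mem_filter => /andP[/andP[le dv] B'S] [-> ->]; split=> //.
  by move: le dv; rewrite !dot_cons V0 mul0n add0n => le dv; rewrite divnK // subnK.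
move=> [BS <-]; apply/mapP; exists B.
  by rewrite mem_filter BS !dot_cons V0 mul0n add0n leq_addl addnK dvdn_mull.
by rewrite !dot_cons V0 mul0n add0n addnK mulnK.
Qed.

(** Exponents of x other than the one singled out by [sel] give weight above w. If there is no such
    exponent, the leading coefficient 0 says that nothing of weight w occurs. *)
Lemma lead_term m q w (c : ser K) B : allowed k m q ->
  (forall v, c v != 0 -> (w <= dot V k (v :: B))%N) ->
  ld m q (Pi (c%:P * PsiProd B))
    (if (dot V k (0%N :: B) <= w)%N && (e %| w - dot V k (0%N :: B))%N then
       iota (c ((w - dot V k (0%N :: B)) %/ e)%N)
         * lam la k (((w - dot V k (0%N :: B)) %/ e)%N :: B) else 0) w 0.
Proof.
move=> al hc; rewrite rmorphM PiC.
set D := dot V k (0%N :: B); set M := lam la k (0%N :: B).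
have hD v : dot V k (v :: B) = (v * e + D)%N by rewrite /D !dot_cons V0 mul0n add0n.
have hM v : lam la k (v :: B) = mu ^+ v * M by rewrite /M !lam_cons l0 expr0 mul1r.
have hP : ld m q (Pi (PsiProd B)) M D 0.
  rewrite rmorph_prod /M lam_cons expr0 mul1r /D dot_cons mul0n add0n.
  apply: (@ld_prod _ m q k (fun t => Pi (Psi t ^+ nth 0%N B t))
      (fun t => la t.+1 ^+ nth 0%N B t) (fun t => nth 0 B t * V t.+1)%N) => t tk.
  rewrite rmorphXn mulnC; have := @ld_exp _ m q _ _ _ _ (nth 0%N B t) (hPsi tk al).
  by rewrite mul0n mulnC.
set f := ssub mu e (smapr iota c).
have hf j : f j != 0 -> (w <= j + D)%N.
  rewrite /f ssubE //; case: ifP => [/dvdnP[v ->]|]; last by rewrite eqxx.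
  rewrite mulnK // /smapr; have [->|cv] := eqVneq (c v) 0; first by rewrite rmorph0 mul0r eqxx.
  by move=> _; rewrite -hD; apply: hc.
case: (leqP D w) => [Dw|wD] /=; last first.
  rewrite /ld mon0 subr0; apply: (wgtW _ (wgtM (@wgtC0 _ m q f) (ld_wgt hP))).
  by rewrite !muln0 !add0n ltn_pmul2l //; case: al.
have hf' : ld m q f%:P (f (w - D)%N) (w - D) 0.
  rewrite /ld /mon expr0 mulr1 -polyCB; apply: wgtC => j.
  rewrite serD serN sCM /sX muln0 add0n; case: (j =P _) => [->|/eqP ne].
    by rewrite mulr1 subrr eqxx.
  rewrite mulr0 subr0 => /hf le; rewrite ltn_pmul2l; last by case: al.
  by rewrite ltn_neqAle eq_sym ne leq_subLR addnC.
have h := ldM hf' hP; rewrite subnK // addn0 in h.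
set kk := (X in ld _ _ _ X _ _); have -> : kk = f (w - D)%N * M; last exact: h.
rewrite /kk /f ssubE //; case: ifP => dv; last by rewrite mul0r.
by rewrite hM /smapr mulrA.
Qed.

(** Take for w the least weight of an occurring index. The coefficient [ka] is then a K-combination
    of products of weight w with some nonzero coefficient, so [LI] keeps it from vanishing. *)
Lemma lead_sum (S : seq (seq nat)) (c : seq nat -> ser K) :
  uniq S -> (forall B, B \in S -> boxed n k (0%N :: B)) ->
  (exists B, B \in S /\ c B <> 0) ->
  exists w, let ka := \sum_(B <- sel S w) iota (c (behead B) (head 0%N B)) * lam la k B in
   [/\ ka != 0, exists B v, [/\ B \in S, c B v != 0 & dot V k (v :: B) = w],
     forall B v, B \in S -> c B v != 0 -> (w <= dot V k (v :: B))%N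
     & AL k (Pi (\sum_(B <- S) (c B)%:P * PsiProd B)) ka w 0].
Proof.
move=> uS bS [B0 [B0S cB0]].
pose Q w := `[< exists B v, [/\ B \in S, c B v != 0 & dot V k (v :: B) = w] >].
have exQ : exists w, Q w.
  have [v cv] : exists v, c B0 v != 0.
    apply: contrapT => no; apply: cB0; apply: serP => v; apply/eqP/negPn/negP => cv.
    by apply: no; exists v.
  by exists (dot V k (v :: B0)); apply/asboolP; exists B0, v.
case: (ex_minnP exQ) => w /asboolP wQ wmin; exists w => /=.
set ka := (X in X != 0).
have hmin B v : B \in S -> c B v != 0 -> (w <= dot V k (v :: B))%N.
  by move=> BS cv; apply: wmin; apply/asboolP; exists B, v.
split=> //.
  have [B [v [BS cv dv]]] := wQ; apply: contraNneq cv => k0.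
  have hb : forall B', B' \in sel S w -> boxed n k B' /\ dot V k B' = w.
    case=> [|v' B']; first by case/mapP.
    by case/selP=> hB d; split=> //; exact: (@boxed_cons n k 0%N v' B' (bS _ hB)).
  have := hLI (f := fun B' => c (behead B') (head 0%N B')) (sel_uniq w uS) hb k0.
  by move/(_ (v :: B)) => /= -> //; apply/selP.
move=> m q al; rewrite rmorph_sum /= /ka /sel big_map big_filter [X in ld _ _ _ X _ _]big_mkcond /=.
rewrite [X in ld _ _ X _ _ _]big_seq [X in ld _ _ _ X _ _]big_seq; apply: ld_sum => B BS.
by apply: lead_term => // v; apply: hmin.
Qed.

Hypothesis Psim : forall t, (t < k)%N ->
  Psi t \is monic /\ size (Psi t) = (\prod_(u < t) n u.+1)%N.+1.

Lemma psi_expansion (a : {poly ser K}) : (size a <= \prod_(u < k) n u.+1)%N ->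
  exists c, a = \sum_(B <- box n k) (c B)%:P * PsiProd B.
Proof.
rewrite /PsiProd.
elim: k a Psim => [|k' IH] a hP.
  move=> sa; have {}sa : (size a <= 1)%N by move: sa; rewrite big_ord0.
  rewrite {1}(size1_polyC sa); exists (fun _ => a`_0).
  by rewrite big_seq1 big_ord0 mulr1.
rewrite big_ord_recr /= => sa; have [pm ps] := hP k' (ltnSn _).
have [b [hb eb]] := adic_expansion pm ps sa.
have /choice [c hc] : forall i, exists c, b i = \sum_(B <- box n k') (c B)%:P *
    \prod_(t < k') Psi t ^+ nth 0%N B t.
  by move=> i; apply: IH => // t tk; apply: hP; apply: ltnW.
exists (fun B => c (nth 0%N B k') (take k' B)).
rewrite big_allpairs_dep /= eb exchange_big /= -[n k'.+1]subn0 -/(index_iota 0 _) big_mkord subn0.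
apply: eq_bigr => i _; rewrite hc mulr_suml big_seq [RHS]big_seq.
apply: eq_bigr => B /boxP [] /= [sB] _.
rewrite nth_rcons sB ltnn eqxx -cats1 take_size_cat // cats1 big_ord_recr /=.
rewrite nth_rcons sB ltnn eqxx -mulrA; congr (_ * (_ * _)).
by apply: eq_bigr => t _; rewrite nth_rcons sB ltn_ord.
Qed.

Lemma lead_exists (a : {poly ser K}) : a != 0 -> (size a <= \prod_(u < k) n u.+1)%N ->
  exists w ka, ka != 0 /\ AL k (Pi a) ka w 0.
Proof.
move=> a0 /psi_expansion [c ea].
have [|||w /= [h1 _ _ h2]] := @lead_sum (box n k) c.
- exact: box_uniq.
- by move=> B /boxP.
- apply: contrapT => no; case/eqP: a0; rewrite ea big_seq big1 // => B Bb.
  have -> : c B = 0 by apply: contrapT => cB; apply: no; exists B.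
  by rewrite mul0r.
by rewrite -ea in h2; eexists; eexists; split; [exact: h1|exact: h2].
Qed.
End LeadSum.

(* Leading monomials in distinct powers of y cannot cancel. *)
Lemma compare_leads (L : fieldType) m q c0 (M : nat) (G : {poly ser L})
   (T : nat -> {poly ser L}) (act : pred nat) (kap : nat -> L) (D : nat -> nat) :
  G = \sum_(i < M) T i -> wgt m q c0 G ->
  (forall i, (i < M)%N -> act i -> kap i != 0 /\ ld m q (T i) (kap i) (D i) i) ->
  (forall i, (i < M)%N -> ~~ act i -> T i = 0) ->
  (forall i, (i < M)%N -> act i -> (c0 <= m * i + q * D i)%N) /\
  forall i j, (m * i + q * j = c0)%N ->
    G`_i j = if [&& (i < M)%N, act i & D i == j] then kap i else 0.
Proof.
move=> eG hG hact hna.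
have coefG i j c : (forall i, (i < M)%N -> act i -> (c <= m * i + q * D i)%N) ->
    (m * i + q * j = c)%N ->
    G`_i j = if [&& (i < M)%N, act i & D i == j] then kap i else 0.
  move=> hc ec; rewrite eG coef_sum ser_sum.
  have T0 (i' : 'I_M) : ~~ [&& (i == i'), act i' & D i' == j] -> (T i')`_i j = 0.
    case a : (act i') => /=; last by rewrite hna ?coef0 ?a.
    have [_ h] := hact i' (ltn_ord i') a; move=> ne; apply: (ld_off h).
      by rewrite ec; apply: hc.
    by case=> e1 e2; move: ne; rewrite e1 e2 !eqxx.
  case: ifP => [/and3P[iM ai /eqP Di]|no].
    rewrite (bigD1 (Ordinal iM)) //= big1 ?addr0 => [|i' ne].
      by have [_ h] := hact i iM ai; rewrite -Di (ldP h).
    apply: T0; apply: contraNN ne => /andP[/eqP e _]; apply/eqP/val_inj; exact: esym.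
  rewrite big1 // => i' _; apply: T0; apply/negP => /andP[/eqP e].
  by rewrite -e => /andP[ai Di]; rewrite ai Di e ltn_ord in no.
(* At the least weight of an active term the coefficient of G equals some [kap i], hence is nonzero,
   so the bound c0 for G bounds every active term. *)
have low : forall i, (i < M)%N -> act i -> (c0 <= m * i + q * D i)%N.
  move=> i0 i0M a0.
  have exc : exists c, `[< exists i, [/\ (i < M)%N, act i & (m * i + q * D i = c)%N] >].
    by exists (m * i0 + q * D i0)%N; apply/asboolP; exists i0.
  case: (ex_minnP exc) => c /asboolP [i [iM ai ec]] cmin.
  have hc i' : (i' < M)%N -> act i' -> (c <= m * i' + q * D i')%N.
    by move=> iM' ai'; apply: cmin; apply/asboolP; exists i'.
  apply: leq_trans (hc i0 i0M a0); rewrite -ec; apply: hG.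
  by rewrite (coefG _ _ c) // iM ai eqxx; case: (hact i iM ai).
by split=> // i j; apply: coefG.
Qed.

(** * Approximate roots *)

Section PowerDifference.
Variable A : comNzRingType.
Implicit Types x y : {poly A}.

Lemma size_monic_exp x n : x \is monic -> size (x ^+ n) = ((size x).-1 * n).+1.
Proof.
move=> xm; have x0 : (0 < size x)%N by rewrite size_poly_gt0 monic_neq0.
elim: n => [|n IH]; first by rewrite muln0 size_poly1.
by rewrite exprSr size_Mmonic ?monic_neq0 ?monic_exp // IH; move: x0; size_lia.
Qed.

Lemma size_monic_prod x y u v d : x \is monic -> y \is monic -> size x = d.+1 ->
  size y = d.+1 -> x ^+ u * y ^+ v \is monic /\ size (x ^+ u * y ^+ v) = ((u + v) * d).+1.
Proof.
move=> xm ym sx sy; split; first by rewrite monicMl monic_exp.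
by rewrite size_Mmonic ?monic_neq0 ?monic_exp // !size_monic_exp // sx sy /=; size_lia.
Qed.

(** The cofactor is a sum of N+1 monic polynomials of degree N d. Its leading coefficient N+1 is
    what must be invertible, for uniqueness of the root and for the progress of the iteration. *)
Lemma power_diff x y d N : x \is monic -> y \is monic -> size x = d.+1 -> size y = d.+1 ->
  exists S, [/\ x ^+ N.+1 - y ^+ N.+1 = (x - y) * S, (size S <= (N * d).+1)%N
     & S`_(N * d) = N.+1%:R].
Proof.
move=> xm ym sx sy.
exists (\sum_(i < N.+1) x ^+ (N.+1.-1 - i) * y ^+ i); split; first exact: subrXX.
  apply: (leq_trans (size_sum _ _ _)); apply/bigmax_leqP => i _ /=.
  have [_ ->] := size_monic_prod (N - i) i xm ym sx sy.
  by rewrite subnK // -ltnS.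
rewrite coef_sum (eq_bigr (fun _ => 1)) ?sumr_const ?card_ord // => i _ /=.
have [/monicP m s] := size_monic_prod (N - i) i xm ym sx sy.
by move: m; rewrite lead_coefE s /= subnK // -ltnS.
Qed.
End PowerDifference.

Section ApproximateRoots.
Variables (K : fieldType) (N dk : nat) (F : {poly ser K}).
Hypotheses (NK : (N.+1%:R : K) != 0) (dk0 : (0 < dk)%N)
  (Fm : F \is monic) (Fs : size F = (N.+1 * dk).+1).

Let unitN (f : ser K) : f * N.+1%:R = 0 -> f = 0.
Proof.
move=> e; apply: serP => j; have /eqP := congr1 (fun g : ser K => g j) e.
have -> : (N.+1%:R : ser K) = sC N.+1%:R.
  apply: serP => i; elim: N.+1 => [|u IH]; first by rewrite sC0.
  by rewrite !mulrSr serD IH /sC ser1; case: eqP => _; rewrite ?addr0.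
by rewrite mulrC sCM mulf_eq0 (negPf NK) => /eqP.
Qed.

(** If x and y differ, the difference of their powers has degree at least N dk, with leading
    coefficient (N+1) times that of x - y; both errors are smaller. *)
Lemma approx_root_unique (x y : {poly ser K}) :
  x \is monic -> y \is monic -> size x = dk.+1 -> size y = dk.+1 ->
  (size (F - x ^+ N.+1)%R <= N * dk)%N -> (size (F - y ^+ N.+1)%R <= N * dk)%N -> x = y.
Proof.
move=> xm ym sx sy hx hy; have [S [e sS cS]] := power_diff N xm ym sx sy.
have h : (size ((x - y) * S)%R <= N * dk)%N.
  have -> : (x - y) * S = (F - y ^+ N.+1) - (F - x ^+ N.+1) by rewrite -e; ring.
  by apply: (leq_trans (size_polyD _ _)); rewrite size_polyN geq_max hx hy.
apply/eqP; rewrite -subr_eq0; apply/negPn/negP => b0.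
set b := x - y in h b0.
have sb : (0 < size b)%N by rewrite size_poly_gt0.
have : (b * S)`_((size b).-1 + N * dk) = lead_coef b * N.+1%:R.
  have lt : ((size b).-1 < ((size b).-1 + N * dk).+1)%N by size_lia.
  rewrite coefM (bigD1 (Ordinal lt)) //= addKn cS lead_coefE big1 ?addr0 // => i ne.
  case: (ltnP i (size b)) => ib; last by rewrite nth_default ?mul0r.
  rewrite [S`__]nth_default ?mulr0 //; apply: (leq_trans sS).
  suff : (i < (size b).-1)%N by size_lia.
  have : (i != (size b).-1 :> nat) by apply: contraNneq ne => ei; apply/eqP/val_inj.
  size_lia.
rewrite nth_default; last by apply: (leq_trans h); size_lia.
by move/esym/unitN/eqP; rewrite lead_coef_eq0 (negPf b0).
Qed.

Variables (L : fieldType) (k m q : nat) (Pi : {rmorphism {poly ser K} -> {poly ser L}}).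
Variables (v V : nat) (u0 la : L).
Hypotheses (al : allowed k m q) (la0 : la != 0) (u00 : u0 != 0)
  (good : forall a : {poly ser K}, a != 0 -> (size a <= dk)%N ->
     exists w ka, ka != 0 /\ AL k (Pi a) ka w 0)
  (Fw : wgt m q (m * N.+1 + q * v) (Pi F))
  (Fv : (Pi F)`_N.+1 v = u0)
  (Fv' : forall j, (m * N + q * j = m * N.+1 + q * v)%N -> (Pi F)`_N j = 0).

(** In the expansion of F in powers of theta only theta^(N+1) can produce x^v y^(N+1), which forces
    [v] and [u0]. The term with a_N cannot lie on the edge, since F has no y^N there, so it weighs
    more; hence a_N is too heavy to alter the leading monomial of theta. *)
Lemma adic_lead (a : nat -> {poly ser K}) theta : ld m q (Pi theta) la V 1 ->
  (forall i, (size (a i) <= dk)%N) -> F - theta ^+ N.+1 = \sum_(i < N.+1) a i * theta ^+ i ->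
  [/\ v = (N.+1 * V)%N, u0 = la ^+ N.+1 & wgt m q (m + q * V).+1 (Pi (a N))].
Proof.
move=> ht ha eF.
have /choice [wk hwk] : forall i, exists wk : nat * L, a i != 0 ->
    wk.2 != 0 /\ AL k (Pi (a i)) wk.2 wk.1 0.
  move=> i; have [->|ai] := eqVneq (a i) 0; first by exists (0%N, 0); rewrite eqxx.
  by have [w [ka [h1 h2]]] := good ai (ha i); exists (w, ka).
pose T i := Pi ((if i == N.+1 then 1 else a i) * theta ^+ i).
pose act i := (i == N.+1) || (a i != 0).
pose kap i := (if i == N.+1 then 1 else (wk i).2) * la ^+ i.
pose D i := ((if i == N.+1 then 0 else (wk i).1) + V * i)%N.
have [||||low coefF] := @compare_leads L m q (m * N.+1 + q * v) N.+2 (Pi F) T act kap D.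
- rewrite big_ord_recr /= /T eqxx mul1r -[F](subrK (theta ^+ N.+1)) {1}eF rmorphD rmorph_sum.
  by congr (_ + _); apply: eq_bigr => i _; rewrite (ltn_eqF (ltn_ord i)).
- by [].
- move=> i _ ai; have : kap i != 0.
    rewrite /kap mulf_neq0 ?expf_neq0 //; move: ai; rewrite /act; case: eqP => /= _.
      by rewrite oner_eq0.
    by case/hwk.
  split=> //; rewrite /T rmorphM rmorphXn /kap /D -[X in ld _ _ _ _ _ X]add0n.
  have h := @ld_exp _ m q _ _ _ _ i ht; rewrite mul1n in h.
  apply: ldM h; move: ai; rewrite /act; case: eqP => /= _.
    by rewrite rmorph1 => _; apply: ld1.
  by move/hwk => [_]; apply.
- move=> i _; rewrite /act negb_or negbK /T => /andP[/negPf -> /eqP ->].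
  by rewrite mul0r rmorph0.
have q0 : (0 < q)%N by case: al.
have DN : D N.+1 = v.
  have := coefF N.+1 v erefl; rewrite Fv ltnSn /= /act eqxx /=.
  by case: eqP => // _ e; move: u00; rewrite e eqxx.
have eu : u0 = la ^+ N.+1.
  by have := coefF N.+1 v erefl; rewrite Fv ltnSn /act eqxx DN eqxx /kap eqxx mul1r.
have ev : v = (N.+1 * V)%N by rewrite -DN /D eqxx add0n mulnC.
split=> //.
have [->|aN] := eqVneq (a N) 0; first by rewrite rmorph0; apply: wgt0.
have aN' : act N by rewrite /act aN orbT.
have [kN lN] := hwk N aN.
have Nne : (N == N.+1) = false by apply/negbTE; rewrite neq_ltn ltnSn.
have kN0 : kap N != 0 by rewrite /kap Nne mulf_neq0 ?expf_neq0.
have le := low N (leqnSn _) aN'.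
have ne : (m * N + q * D N != m * N.+1 + q * v)%N.
  apply/eqP => e; have := coefF N _ e; rewrite (Fv' e) leqnSn aN' eqxx /= => z.
  by rewrite -z eqxx in kN0.
apply: (wgtW _ (ld_wgt (lN m q al))); rewrite muln0 add0n.
have : (m * N.+1 + q * v < m * N + q * D N)%N by rewrite ltn_neqAle eq_sym ne.
rewrite /D Nne ev; set W := (wk N).1; lia.
Qed.

Lemma approx_root_lead psi theta : psi \is monic -> size psi = dk.+1 ->
  (size (F - psi ^+ N.+1)%R <= N * dk)%N ->
  theta \is monic -> size theta = dk.+1 -> ld m q (Pi theta) la V 1 ->
  [/\ v = (N.+1 * V)%N, u0 = la ^+ N.+1 & ld m q (Pi psi) la V 1].
Proof.
move=> pm ps pN.
elim: {theta}(size (F - theta ^+ N.+1)%R) {-2}theta (leqnn (size (F - theta ^+ N.+1)%R))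
  => [|M IH] theta sE tm ts ht.
  have e : theta = psi by apply: approx_root_unique => //; apply: leq_trans sE _.
  (* The error is 0 here; the zero expansion still yields the values of [v] and [u0]. *)
  have [||h1 h2 _] := @adic_lead (fun _ => 0) theta ht; first by rewrite size_poly0.
    move: sE; rewrite leqn0 size_poly_eq0 => /eqP ->.
    by rewrite big1 // => i _; rewrite mul0r.
  by rewrite -e.
set E := F - theta ^+ N.+1 in sE.
have sE' : (size E <= dk * N.+1)%N.
  apply/leq_sizeP => j; rewrite leq_eqVlt => /orP[/eqP <-|lt]; rewrite coefB.
    have [] := size_monic_prod N.+1 0 tm tm ts ts; rewrite expr0 mulr1 addn0 => /monicP m1 s1.
    move: m1 (monicP Fm); rewrite !lead_coefE s1 Fs /= [(dk * _)%N]mulnC => -> ->.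
    by rewrite subrr.
  have [_] := size_monic_prod N.+1 0 tm tm ts ts; rewrite expr0 mulr1 addn0 => s1.
  by rewrite !nth_default ?subr0 // ?s1 ?Fs mulnC.
have [a [ha eE]] := adic_expansion tm ts sE'.
have [h1 h2 wa] := adic_lead ht ha eE.
case: (leqP (size E) (N * dk)) => [small|big].
  by have e : theta = psi; [apply: approx_root_unique|rewrite -e].
pose c : {poly ser K} := (sC N.+1%:R^-1)%:P.
pose R := \sum_(i < N) a i * theta ^+ i.
have sR : (size R <= N * dk)%N.
  apply: (leq_trans (size_sum _ _ _)); apply/bigmax_leqP => i _.
  apply: (leq_trans (size_polyMleq _ _)); rewrite size_monic_exp // ts /=.
  have := ha i; have : (dk * i + dk <= N * dk)%N.
    by rewrite -mulnSr mulnC leq_mul2r ltn_ord orbT.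
  by rewrite addnS /=; size_lia.
have eER : E = R + a N * theta ^+ N by rewrite eE big_ord_recr.
have sEa : (size E <= size (a N) + N * dk)%N.
  rewrite eER; apply: (leq_trans (size_polyD _ _)); rewrite geq_max.
  apply/andP; split; first by apply: (leq_trans sR); size_lia.
  apply: (leq_trans (size_polyMleq _ _)); rewrite size_monic_exp // ts /=.
  by rewrite addnS /= mulnC.
have [sa|sa] := posnP (size (a N)); first by move: sEa; rewrite sa add0n leqNgt big.
(* Newton step with c = 1/(N+1): to first order theta^(N+1) changes by a_N theta^N, the top term of
   the error. *)
pose theta' := theta + c * a N.
have sca : (size (c * a N)%R <= size (a N))%N.
  apply: (leq_trans (size_polyMleq _ _)); have := size_polyC_leq1 (sC (N.+1%:R^-1 : K)).
  by rewrite -/c; size_lia.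
have ts' : size theta' = dk.+1.
  by rewrite size_polyDl // ts ltnS (leq_trans sca).
have tm' : theta' \is monic.
  by rewrite monicE lead_coefDl -?monicE // ts ltnS (leq_trans sca).
have sEq : size E = (size (a N) + N * dk)%N.
  apply/eqP; rewrite eqn_leq sEa /= eER addrC.
  have saM : size (a N * theta ^+ N)%R = (size (a N) + N * dk)%N.
    rewrite size_Mmonic ?monic_exp // -?size_poly_gt0 // size_monic_exp // ts /=.
    by rewrite addnS /= mulnC.
  by rewrite size_polyDl saM //; apply: (leq_ltn_trans sR); size_lia.
have [S [eS sS cS]] := power_diff N tm' tm ts' ts.
(* Both terms have leading coefficient N+1 in degree N dk. Once a_N theta^N has cancelled, the new
   error is therefore strictly smaller than the old one, whose size is [size (a N) + N * dk]. *)
have sS' : (size (S - N.+1%:R * theta ^+ N)%R <= N * dk)%N.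
  apply/leq_sizeP => j; rewrite leq_eqVlt => /orP[/eqP <-|lt].
    have [] := size_monic_prod N 0 tm tm ts ts; rewrite expr0 mulr1 addn0 => /monicP m1 s1.
    move: m1; rewrite lead_coefE s1 /= => m1.
    by rewrite coefB cS mulr_natl coefMn m1 subrr.
  have [_] := size_monic_prod N 0 tm tm ts ts; rewrite expr0 mulr1 addn0 => s1.
  rewrite coefB mulr_natl coefMn !nth_default ?mul0rn ?subr0 // ?s1 //.
  exact: leq_trans sS lt.
apply: (IH theta') => //; last first.
  rewrite /theta' rmorphD; apply: ldDw => //; rewrite rmorphM muln1.
  exact: (wgtM (@wgt00 _ m q (Pi c)) wa).
have cN : c * N.+1%:R = 1.
  rewrite /c -polyC_natr -polyCM; congr (_%:P); apply: serP => i.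
  have -> : (N.+1%:R : ser K) = sC N.+1%:R.
    apply: serP => i'; elim: N.+1 => [|u IHu]; first by rewrite sC0.
    by rewrite !mulrSr serD IHu /sC ser1; case: eqP => _; rewrite ?addr0.
  by rewrite -sCMC mulVf // sC1.
have -> : F - theta' ^+ N.+1 = R - c * a N * (S - N.+1%:R * theta ^+ N).
  have -> : F - theta' ^+ N.+1 = E - (theta' ^+ N.+1 - theta ^+ N.+1) by rewrite /E; ring.
  rewrite eS eER; have -> : theta' - theta = c * a N by rewrite /theta'; ring.
  transitivity (R - c * a N * S + (c * N.+1%:R) * (a N * theta ^+ N)); last by ring.
  by rewrite cN; ring.
rewrite -ltnS; apply: leq_trans sE.
apply: (leq_ltn_trans (size_polyD _ _)); rewrite gtn_max sEq size_polyN.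
apply/andP; split; first by size_lia.
by apply: (leq_ltn_trans (size_polyMleq _ _)); size_lia.
Qed.
End ApproximateRoots.

(** * Shifts and degenerate Newton polygons *)

Section Shifts.
Variable R : comNzRingType.
Implicit Types (p : {poly ser R}) (c : ser R).

Lemma ssub11 (f : ser R) : ssub 1 1 f = f.
Proof. by apply: serP => n; rewrite ssubE // dvd1n divn1 expr1n mulr1. Qed.

Definition shiftP c : {poly ser R} -> {poly ser R} := sbst (ssub 1 1) ('X + c%:P).
HB.instance Definition _ c := GRing.RMorphism.copy (shiftP c) (sbst (ssub 1 1) ('X + c%:P)).

Lemma shiftPE c p n : (size p <= n)%N ->
  shiftP c p = \sum_(i < n) (p`_i)%:P * ('X + c%:P) ^+ i.
Proof.
by move=> pn; rewrite /shiftP (sbstE _ _ pn); apply: eq_bigr => i _ /=; rewrite ssub11.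
Qed.
Lemma shift_slice0 c p i : c 0%N = 0 -> (shiftP c p)`_i 0%N = p`_i 0%N.
Proof.
move=> c0; rewrite (shiftPE c (leqnn _)) coef_sum ser_sum.
transitivity (\sum_(u < size p) p`_u 0%N * (i == u)%:R).
  apply: eq_bigr => u _; rewrite coefCM ser_mulr0 shift_exp0 c0.
  by rewrite addr0 coefXn.
case: (ltnP i (size p)) => ip.
  rewrite (bigD1 (Ordinal ip)) //= eqxx mulr1 big1 ?addr0 // => u ne.
  case: eqP => [e|]; last by rewrite mulr0.
  by case/eqP: ne; apply: val_inj.
rewrite nth_default // big1 // => u _; rewrite gtn_eqF ?mulr0 //.
exact: leq_trans ip.
Qed.
Lemma shift_monic c p N : p \is monic -> size p = N.+1 ->
  shiftP c p \is monic /\ size (shiftP c p) = N.+1.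
Proof.
move=> pm ps; have [_ s] : ('X + c%:P) \is monic /\ size ('X + c%:P) = 2.
  by rewrite -[c]opprK polyCN monicXsubC size_XsubC.
have m : 'X + c%:P \is monic by rewrite -[c]opprK polyCN monicXsubC.
rewrite (shiftPE c (eq_leq ps)) big_ord_recr /= addrC.
have -> : p`_N = 1 by move/monicP: pm; rewrite lead_coefE ps.
rewrite mul1r; set T := \sum_(i < N) _.
have sN : size (('X + c%:P) ^+ N) = N.+1 by rewrite size_monic_exp // s mul1n.
have sT : (size T < N.+1)%N.
  rewrite ltnS; apply: (leq_trans (size_sum _ _ _)); apply/bigmax_leqP => i _.
  apply: (leq_trans (size_polyMleq _ _)); rewrite size_monic_exp // s mul1n addnS /=.
  apply: (leq_trans (leq_add (size_polyC_leq1 _) (leqnn _))); exact: ltn_ord.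
split; last by rewrite size_polyDl sN.
by rewrite monicE lead_coefDl ?sN // -monicE monic_exp.
Qed.
Lemma shift_next c p N : p \is monic -> size p = N.+2 ->
  (shiftP c p)`_N = p`_N + N.+1%:R * c.
Proof.
move=> pm ps.
have m : 'X + c%:P \is monic by rewrite -[c]opprK polyCN monicXsubC.
have s : size ('X + c%:P) = 2 by rewrite -[c]opprK polyCN size_XsubC.
rewrite (shiftPE c (eq_leq ps)) !big_ord_recr /= !coefD !coefCM.
have -> : p`_N.+1 = 1 by move/monicP: pm; rewrite lead_coefE ps.
have -> : (('X + c%:P) ^+ N)`_N = 1.
  have /monicP : ('X + c%:P) ^+ N \is monic by rewrite monic_exp.
  by rewrite lead_coefE size_monic_exp // s mul1n.
have -> : (('X + c%:P) ^+ N.+1)`_N = N.+1%:R * c.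
  rewrite addrC exprDn coef_sum (bigD1 (inord N)) //= inordK ?ltnS ?leqnSn //.
  rewrite subSnn expr1 coefMn coefCM coefXn eqxx mulr1.
  rewrite binSn mulr_natl big1 ?addr0 // => i ne.
  rewrite -polyC_exp coefMn coefCM coefXn.
  case: eqP => [e|]; last by rewrite mulr0 mul0rn.
  by case/eqP: ne; apply: val_inj; rewrite /= inordK ?ltnS ?leqnSn.
rewrite mulr1 mul1r coef_sum big1 ?add0r // => i _.
rewrite coefCM [X in _ * X]nth_default ?mulr0 // size_monic_exp // s mul1n; exact: ltn_ord.
Qed.
Lemma ofP_tshift c : ofP ('X + c%:P) = @mY R (tshift (c : nat -> R)).
Proof.
apply: bserP => i j; rewrite /ofP coefD coefX coefC serD /=.
by case: i => [|[|i]] /=; rewrite ?add0r ?addr0.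
Qed.
Lemma bcomp_tshift c p n : (size p <= n.+1)%N ->
  bcomp n (ofP p) (@tshift R c) = ofP (shiftP c p).
Proof. by move=> pn; exact: (bcompE _ (ofP_tshift c) pn). Qed.
Lemma ofP_sigmap z q m s t :
  ofP ((sX m)%:P * ('X + (sC (z ^+ s))%:P)) = @mY R (sigmap z q m s t).
Proof.
apply: bserP => i j; rewrite /ofP coefCM sXM coefD coefX coefC serD /=.
case: (ltngtP j m) => [lt|lt|->]; last rewrite subnn.
- by [].
- have -> : ((i == 1%N)%:R : ser R) (j - m)%N = 0.
    case: (i == 1%N) => //; rewrite -[LHS]/((((j - m)%N == 0%N)%:R) : R).
    by case: eqP => //; lia.
  rewrite add0r; case: i => [|i] //=; rewrite /sC; case: eqP => //; lia.
by case: i => [|[|i]] /=; rewrite ?add0r ?addr0 //.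
Qed.
End Shifts.

(** Both shifts act on y after the change of x, so sigma followed by tau is a single [theta], with
    delta the sum of z^s and the Tschirnhaus shift. *)
Lemma shift_theta (R : comNzRingType) z q m (d1 d2 : ser R) p : (0 < q)%N ->
  shiftP d2 (sbst (ssub z q) ((sX m)%:P * ('X + d1%:P)) p) = theta z q m (d2 + d1) p.
Proof.
move=> q0; rewrite /shiftP sbst_sbst rmorphM rmorphD /= !sbstC sbstX /= !ssub11.
rewrite /theta polyCD addrA; apply: eq_sbst => f /=; exact: ssub11.
Qed.

Section Degenerate.
Variables (L : fieldType) (A : int -> Prop) (Kp : L -> Prop) (h : bser L).
Variables (q m N N' : nat) (P : {poly L}) (z : L).
Hypotheses (hm : ymonic h N') (N0 : (0 < N')%N)
  (hA : A = npT \/ (A = npP /\ weierstrass h N')) (hd : degen A Kp h q m P N).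

Definition PbP : {poly ser L} :=
  \sum_(u < size P) (sC P`_u * sX (m * ((size P).-1 - u)))%:P * 'X^(q * u).

Let q0 : (0 < q)%N. Proof. by case: hd. Qed.
Let Pm : P \is monic. Proof. by case: hd => _ [_ [_ []]]. Qed.
Let Ps : size P = (size P).-1.+1.
Proof. by rewrite prednK // size_poly_gt0 monic_neq0. Qed.

Lemma ofP_PbP : ofP PbP = Pbiv P q m.
Proof.
apply: bserP => i j; rewrite /ofP /PbP coef_sum ser_sum /Pbiv.
have T (u : 'I_(size P)) : ((sC P`_u * sX (m * ((size P).-1 - u)))%:P * 'X^(q * u))`_i j
   = if (i == q * u)%N && (j == m * ((size P).-1 - u))%N then P`_u else 0.
  rewrite coefCM coefXn; case: eqP => _ /=; last by rewrite mulr0.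
  by rewrite mulr1 sCM /sX; case: eqP; rewrite ?mulr1 ?mulr0.
rewrite (eq_bigr _ (fun u _ => T u)).
case: ifP => [/and3P[/dvdnP[u ->]]|no].
  rewrite mulnK // => ul /eqP ->; have uP : (u < size P)%N by rewrite Ps ltnS.
  rewrite (bigD1 (Ordinal uP)) //= mulnC !eqxx /= big1 ?addr0 // => u' ne.
  case: eqP => //= /eqP; rewrite eqn_pmul2l // => /eqP e.
  by case/eqP: ne; apply: val_inj.
rewrite big1 // => u _; case: andP => // -[/eqP ei /eqP ej].
by move: no; rewrite ei ej dvdn_mulr // mulKn // eqxx -ltnS -Ps ltn_ord.
Qed.

Lemma PbP_monic : PbP \is monic /\ size PbP = (q * (size P).-1).+1.
Proof.
have e : PbP = 'X^(q * (size P).-1) + \sum_(u < (size P).-1)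
    (sC P`_u * sX (m * ((size P).-1 - u)))%:P * 'X^(q * u).
  rewrite /PbP [in LHS]Ps big_ord_recr /= addrC; congr (_ + _).
  have -> : P`_(size P).-1 = 1 by move/monicP: Pm; rewrite lead_coefE.
  by rewrite subnn muln0 sX0 sC1 !mul1r.
set T := \sum_(u < _) _ in e.
have sT : (size T < (q * (size P).-1).+1)%N.
  rewrite ltnS; apply: (leq_trans (size_sum _ _ _)); apply/bigmax_leqP => u _.
  apply: (leq_trans (size_polyMleq _ _)); rewrite size_polyXn addnS /=.
  apply: (leq_trans (leq_add (size_polyC_leq1 _) (leqnn _))).
  by rewrite add1n ltn_pmul2l // ltn_ord.
split; last by rewrite e size_polyDl size_polyXn.
by rewrite monicE e lead_coefDl ?size_polyXn // lead_coefXn.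
Qed.

Lemma bnd_ofP : exists c, c != 0 /\ forall i j, bnd A h i j = c * (PbP ^+ N)`_i j.
Proof.
case: hd => _ [_ [_ [_ [_ [_ [c [c0 hc]]]]]]]; exists c; split=> // i j.
by rewrite hc -ofP_PbP -ofPX.
Qed.

Lemma np_top : on_np A h N' 0.
Proof.
case: hm => hdeg [h1 _]; case: hA => [->|[-> [_ hW]]].
  (* The horizontal line j = 0. *)
  exists 0, 1, 0, N', 0%N, N', 0%N; rewrite h1 oner_neq0 leqnn.
  by do !split=> //; move=> i j _; lia.
(* The principal polygon needs a line of negative slope: i + N' j = N' supports h because every
   point with i < N' has j at least 1. *)
exists 1, N'%:Z, N'%:Z, N', 0%N, N', 0%N; rewrite h1 oner_neq0 leqnn.
split; first by [].
split; last by do !split=> //; lia.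
split=> [|i j nz]; first by lia.
case: (ltngtP i N') => [lt|gt|->]; last by lia.
  case: j nz => [|j nz]; first by rewrite hW ?eqxx.
  have : (N' <= N' * j.+1)%N by rewrite leq_pmulr.
  lia.
by rewrite hdeg ?eqxx in nz.
Qed.

Lemma bndE i j : on_np A h i j%:Z -> bnd A h i j = h i j.
Proof. by move=> hi; rewrite /bnd; destruct (ClassicalEpsilon.excluded_middle_informative _). Qed.
Lemma bnd_or i j : bnd A h i j = h i j \/ bnd A h i j = 0.
Proof.
by rewrite /bnd; destruct (ClassicalEpsilon.excluded_middle_informative _); [left|right].
Qed.

(** The monic top term of h lies on the polygon, and the top term of the boundary power sits at (q
    deg P N, 0); each must be a term of the other polynomial. *)
Lemma degen_degree : N' = (q * (size P).-1 * N)%N.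
Proof.
have [c [c0 hb]] := bnd_ofP; have [pm ps] := PbP_monic; have [hdeg [h1 _]] := hm.
have sN : size (PbP ^+ N) = (q * (size P).-1 * N).+1 by rewrite size_monic_exp // ps.
apply/eqP; rewrite eqn_leq; apply/andP; split; rewrite leqNgt; apply/negP => lt.
  have := hb N' 0%N; rewrite bndE; last exact: np_top.
  rewrite h1 nth_default ?sN // mulr0 => /eqP; by rewrite oner_eq0.
have := hb (q * (size P).-1 * N)%N 0%N.
have -> : (PbP ^+ N)`_(q * (size P).-1 * N) = 1.
  have /monicP : PbP ^+ N \is monic by rewrite monic_exp.
  by rewrite lead_coefE sN.
rewrite mulr1; case: (bnd_or (q * (size P).-1 * N) 0) => -> e.
  by rewrite hdeg // in e; rewrite -e eqxx in c0.
by rewrite -e eqxx in c0.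
Qed.

(** [straight] leaves the constant of its line open; it is m N' because (N', 0) lies on the
    polygon. *)
Lemma degen_wgt i j : h i j != 0 -> (m * N' <= m * i + q * j)%N.
Proof.
case: hd => _ [_ [[_ [c [[_ hs] [_ hp]]]] _]]; have [_ [h1 _]] := hm.
have nz : h N' 0%N != 0 by rewrite h1 oner_neq0.
by have := hp N' 0%N nz np_top => ec /hs; lia.
Qed.

(** A root z = 0 would force P = X, by minimality of P against X. The boundary polynomial would then
    be a multiple of y^(q N), against the two points with distinct abscissae required by
    [straight]. *)
Lemma degen_root_neq0 : is_subfield Kp -> P.[z] = 0 -> z != 0.
Proof.
move=> KF Pz; apply/eqP => z0; case: hd => _ [_ [hst [_ [Po [Pi _]]]]].
have P1 : (1 < size P)%N by case: Pi.
have s2 : size P = 2.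
  apply/eqP; rewrite eqn_leq P1 andbT leqNgt; apply/negP => P2.
  have /eqP : 'X = 0 :> {poly L}.
    by apply: (irr_min KF Pm Po Pi Pz (poXn KF 1)); rewrite ?size_polyX ?hornerX.
  by rewrite polyX_eq0.
have e : PbP = 'X^q.
  rewrite /PbP s2 big_ord_recl big_ord1 /=.
  have -> : P`_0 = 0 by rewrite -horner_coef0 -{1}z0.
  have -> : P`_1 = 1 by move/monicP: Pm; rewrite lead_coefE s2.
  by rewrite sC0 !mul0r add0r muln0 sX0 sC1 !mul1r muln1.
have [c [c0 hb]] := bnd_ofP.
have hq i j : h i j != 0 -> on_np A h i j%:Z -> i = (q * N)%N.
  move=> nz hi; have := hb i j; rewrite bndE // e -exprM coefXn.
  case: (i =P _) => // _ e0; move: nz.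
  by rewrite e0 -[X in c * X]/(0 : L) mulr0 eqxx.
case: hst => hAm [c' [hs [[i1 [j1 [i2 [j2 [lt [n1 [n2 [e1 e2]]]]]]]] _]]].
have o1 : on_np A h i1 j1 by exists m%:Z, q%:Z, c', i1, j1, i1, j1; rewrite leqnn.
have o2 : on_np A h i2 j2 by exists m%:Z, q%:Z, c', i2, j2, i2, j2; rewrite leqnn.
by move: lt; rewrite (hq _ _ n1 o1) (hq _ _ n2 o2) ltnn.
Qed.
End Degenerate.

(** * Minimal polynomials of the parametrizations *)

Lemma bunit_monic (R : comNzRingType) (p : {poly ser R}) :
  p \is monic -> bunit (ofP p) -> p = 1.
Proof.
move=> pm [h' [[n hn]]]; rewrite -(toPK hn) -ofPM -ofP1 => /ofP_inj e.
set h := toP n h' in e.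
have h0 : h != 0 by apply: contra_eq_neq e => ->; rewrite mulr0 eq_sym oner_neq0.
have p0 : (0 < size p)%N by rewrite size_poly_gt0 monic_neq0.
have sh : (0 < size h)%N by rewrite size_poly_gt0.
have s : (size h + size p).-1 = 1%N.
  by rewrite -size_Mmonic // mulrC e size_poly1.
have s1 : (size p <= 1)%N by move: s p0 sh; size_lia.
move: pm; rewrite (size1_polyC s1) monicE lead_coefC => /eqP ->.
by [].
Qed.

Lemma sbst_coef0 (A B : comNzRingType) (f : {rmorphism A -> B}) Y (p : {poly A}) :
  (sbst f Y p)`_0 = (map_poly f p).[Y`_0].
Proof. by rewrite /sbst /= -horner_coef0 horner_comp horner_coef0. Qed.

Section MinimalPolynomial.
Variables (K L : fieldType) (k dk : nat) (rho : {rmorphism ser K -> ser L}).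
Variable Y : {poly ser L}.
Hypothesis good : forall a : {poly ser K}, a != 0 -> (size a <= dk)%N ->
     exists w ka, ka != 0 /\ AL k (sbst rho Y a) ka w 0.

(** The y-free coefficient of a pullback is the value at the parametrization. By [good] it is
    nonzero for a nonzero polynomial of degree below dk, so the remainder of phi modulo chi
    vanishes, and irreducibility of phi leaves only phi = chi. *)
Lemma phi_min (chi phi : {poly ser K}) : (0 < dk)%N ->
  chi \is monic -> size chi = dk.+1 -> (map_poly rho chi).[Y`_0] = 0 ->
  phi \is monic -> birreducible (ofP phi) -> (map_poly rho phi).[Y`_0] = 0 -> phi = chi.
Proof.
move=> dk0 cm cs; rewrite -!sbst_coef0 => c0 pm pirr p0.
have e := Pdiv.RingMonic.rdivp_eq cm phi.
set Q := Pdiv.Ring.rdivp phi chi in e; set T := Pdiv.Ring.rmodp phi chi in e.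
have sT : (size T <= dk)%N by rewrite -ltnS -cs Pdiv.Ring.ltn_rmodpN0 ?monic_neq0.
have T0 : T = 0.
  apply/eqP/negPn/negP => Tn; have [w [ka [ka0 h]]] := good Tn sT.
  have := p0; rewrite e rmorphD rmorphM coefD coef0M c0 mulr0 add0r => z.
  by have := AL_coef h; rewrite z ser0 => e0; rewrite -e0 eqxx in ka0.
rewrite T0 addr0 in e.
have Qm : Q \is monic by move: pm; rewrite e monicMr.
case: pirr => _ [_ [_ /(_ (ofP Q) (ofP chi))]].
have bp (p : {poly ser K}) : bpoly (ofP p).
  by exists (size p); apply: ofP_ydeg; apply: leqnSn.
move=> /(_ (bp _) (bp _)); rewrite -ofPM -e => /(_ erefl) [] u.
  by rewrite e (bunit_monic Qm u) mul1r.
by move: dk0 cs; rewrite (bunit_monic cm u) size_poly1; case: (dk).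
Qed.
End MinimalPolynomial.

Lemma shift_exp_coef0 (R : comNzRingType) (c : R) i : (('X + c%:P) ^+ i)`_0 = c ^+ i.
Proof. by rewrite -horner_coef0 horner_exp !hornerE. Qed.
Lemma shift_exp_coef1 (R : comNzRingType) (c : R) i :
  (('X + c%:P) ^+ i)`_1 = i%:R * c ^+ i.-1.
Proof.
elim: i => [|i IH]; first by rewrite expr0 coef1 mul0r.
rewrite exprS mulrDl coefD coefXM coefCM /= shift_exp_coef0 IH.
case: i {IH} => [|i] /=; first by rewrite expr0 mul0r mulr0 addr0 mulr1.
by rewrite -[i.+2%:R]/(1 + i.+1%:R) exprS; ring.
Qed.

Section PhiStep.
Variables (K L : fieldType) (k dk : nat) (Pi : {rmorphism {poly ser K} -> {poly ser L}}).
Variables (Kp : L -> Prop) (P : {poly L}) (z : L) (q m s t : nat) (delta : ser L).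
Hypotheses (KF : is_subfield Kp) (Pm : P \is monic) (Po : polyover Kp P)
  (Pirr : irr_over Kp P) (Pz : P.[z] = 0) (z0 : z != 0)
  (qs : (q * s = m * t + 1)%N) (al : allowed k m q)
  (qL : (q%:R : L) != 0) (lL : ((size P).-1%:R : L) != 0)
  (delta0 : delta 0%N = z ^+ s).
Hypotheses (rat : forall a, ratp Kp (Pi a))
  (good : forall a : {poly ser K}, a != 0 -> (size a <= dk)%N ->
     exists w ka, ka != 0 /\ AL k (Pi a) ka w 0).
Variables (psi phi : {poly ser K}) (la : L) (V : nat).
Let n := (q * (size P).-1)%N.
Hypotheses (psim : psi \is monic) (psis : size psi = dk.+1)
  (phim : phi \is monic) (phis : size phi = (dk * n).+1)
  (psil : ld m q (Pi psi) la V 1) (la0 : la != 0)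
  (phi0 : (theta (z ^+ t) q m delta (Pi phi))`_0 = 0).

Lemma phi_lead_step : exists c f,
  xl (theta (z ^+ t) q m delta (Pi phi)) c f /\ f`_1 != 0.
Proof.
have q0 : (0 < q)%N by case: al.
have Kla : Kp la by rewrite -(ldP psil); apply: rat.
have sE : (size (phi - psi ^+ n)%R <= dk * n)%N.
  have pn : size (psi ^+ n) = (dk * n).+1 by rewrite size_monic_exp // psis.
  apply/leq_sizeP => j; rewrite leq_eqVlt => /orP[/eqP <-|lt]; rewrite coefB.
    have /monicP : psi ^+ n \is monic by rewrite monic_exp.
    by rewrite lead_coefE pn /= => ->; move/monicP: phim; rewrite lead_coefE phis => ->; rewrite subrr.
  by rewrite !nth_default ?subr0 // ?pn ?phis.
have [a [ha ea]] := adic_expansion psim psis sE.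
have /choice [wk hwk] : forall i, exists wk : nat * L, a i != 0 ->
    wk.2 != 0 /\ AL k (Pi (a i)) wk.2 wk.1 0.
  move=> i; have [->|ai] := eqVneq (a i) 0; first by exists (0%N, 0); rewrite eqxx.
  by have [w [ka [h1 h2]]] := good ai (ha i); exists (w, ka).
pose T i := Pi ((if i == n then 1 else a i) * psi ^+ i).
pose act i := (i == n) || (a i != 0).
pose kap i := (if i == n then 1 else (wk i).2) * la ^+ i.
pose D i := ((if i == n then 0 else (wk i).1) + V * i)%N.
have hact i : act i -> [/\ kap i != 0, ld m q (T i) (kap i) (D i) i & Kp (kap i)].
  move=> ai; have [c0 cl cK] : [/\ (if i == n then 1 else (wk i).2) != 0,
      ld m q (Pi (if i == n then 1 else a i)) (if i == n then 1 else (wk i).2)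
         (if i == n then 0 else (wk i).1)%N 0 & Kp (if i == n then 1 else (wk i).2)].
    move: ai; rewrite /act; case: eqP => /= _.
      by move=> _; rewrite oner_eq0 rmorph1; split=> //; [apply: ld1|apply: sf1].
    by case/hwk => h1 h2; split=> //; [apply: h2|rewrite -(AL_coef h2); apply: rat].
  split; first by rewrite /kap mulf_neq0 ?expf_neq0.
    have h := @ld_exp _ m q _ _ _ _ i psil; rewrite mul1n in h.
    by rewrite /T rmorphM rmorphXn; apply: ldM cl h.
  by apply: sfM => //; apply: sfX.
have exc : exists c, `[< exists i, [/\ (i < n.+1)%N, act i & (m * i + q * D i = c)%N] >].
  by exists (m * n + q * D n)%N; apply/asboolP; exists n; rewrite /act eqxx.
case: (ex_minnP exc) => c /asboolP [i0 [i0n a0 ec]] cmin.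
have hc i : (i < n.+1)%N -> act i -> (c <= m * i + q * D i)%N.
  by move=> iM ai; apply: cmin; apply/asboolP; exists i.
pose kap' i := if act i && (m * i + q * D i == c)%N then kap i else 0.
pose f := \sum_(i < n.+1) (kap' i * (z ^+ t) ^+ D i) *: ('X + (delta 0%N)%:P) ^+ i.
have hx : xl (theta (z ^+ t) q m delta (Pi phi)) c f.
  have -> : Pi phi = \sum_(i < n.+1) T i.
    rewrite -[phi](subrK (psi ^+ n)) {1}ea rmorphD rmorph_sum big_ord_recr /= /T eqxx mul1r.
    by congr (_ + _); apply: eq_bigr => i _; rewrite (ltn_eqF (ltn_ord i)).
  rewrite rmorph_sum; apply: xl_sum => i _; rewrite /kap'.
  case ai : (act i) => /=; last first.
    move: ai; rewrite /act /T; case: eqP => //= _ /negbFE/eqP ->.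
    by rewrite mul0r !rmorph0 mul0r scale0r; apply: xl0.
  have [_ h _] := hact i ai; case: eqP => [<-|/eqP ne]; first exact: theta_ld.
  rewrite mul0r scale0r; apply: wgt_xl; apply: theta_wgt => //.
  by apply: wgtW (ld_wgt h); rewrite ltn_neqAle eq_sym ne hc.
have f0 : \sum_(i < n.+1) kap' i * z ^+ (t * D i + s * i) = 0.
  have [_ /(_ 0%N)] := hx; rewrite phi0 ser0 => e0; rewrite [RHS]e0 /f coef_sum.
  apply: eq_bigr => i _; rewrite coefZ shift_exp_coef0 delta0 exprD !(exprM z).
  by rewrite mulrA.
exists c, f; split=> //.
have -> : f`_1 = \sum_(i < n.+1) kap' i * z ^+ (t * D i) * (i%:R * (z ^+ s) ^+ i.-1).
  rewrite /f coef_sum; apply: eq_bigr => i _.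
  by rewrite coefZ shift_exp_coef1 delta0 (exprM z).
have k0 : kap' i0 != 0 by rewrite /kap' a0 ec eqxx; case: (hact i0 a0).
have hk i : kap' i != 0 -> (q * D i + m * i = c)%N.
  by rewrite /kap'; case: andP => [[_ /eqP <-]|]; rewrite ?eqxx // addnC.
have hK i : Kp (kap' i).
  by rewrite /kap'; case: andP => [[/hact[]]|] // _; apply: sf0.
by case: (residual_simple KF Pm Po Pirr Pz q0 qs z0 i0n k0 (fun i _ => @hk i) (fun i _ => hK i) f0 qL lL).
Qed.
End PhiStep.

(** * Induction along the procedure *)

Lemma size_sbst_linear (A B : comNzRingType) (f : {rmorphism A -> B}) (Y : {poly B}) (p : {poly A}) :
  (size Y <= 2)%N -> (size (sbst f Y p) <= size p)%N.
Proof.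
move=> sY; rewrite (sbstE f Y (leqnn _)); apply: (leq_trans (size_sum _ _ _)).
apply/bigmax_leqP => i _; apply: (leq_trans (size_polyMleq _ _)).
have h : (size (Y ^+ i) <= i.+1)%N.
  apply: (leq_trans (size_poly_exp_leq _ _)); rewrite ltnS.
  by rewrite -{2}[i : nat]mul1n leq_mul2r; apply/orP; right; move: sY; case: (size Y) => [|[|[|]]].
have := size_polyC_leq1 (f p`_i); have := ltn_ord i.
move: h; set u := size _; set v := size _; set w := size _; set x := nat_of_ord i; lia.
Qed.

Lemma serMn (R : comNzRingType) (f : ser R) n j : (f *+ n) j = f j *+ n.
Proof. by elim: n => [|n IH] //; rewrite !mulrS serD IH. Qed.

Lemma tschirnhaus (L : fieldType) (p : {poly ser L}) N (g : ser L) :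
  p \is monic -> size p = N.+2 -> (N.+1%:R : L) != 0 ->
  (forall j, g j = - p`_N j / N.+1%:R) -> (shiftP g p)`_N = 0.
Proof.
move=> pm ps N0 hg; rewrite shift_next // mulr_natl; apply: serP => j.
by rewrite serD serMn hg -[_ / _ *+ _]mulr_natr mulfVK // subrr.
Qed.

Section Levels.
Variables (K L : fieldType) (iota : {rmorphism K -> L}) (d : nat) (F : bser K) (r : run L).
Variables (psi phi : nat -> bser K) (phideg : nat -> nat).

Definition piP k : {poly ser L} := toP 1 (mY (Defs.pi r k)).
Definition Pi k : {poly ser K} -> {poly ser L} :=
  sbst (ssub (mc (Defs.pi r k)) (me (Defs.pi r k)) \o smapr iota) (piP k).
HB.instance Definition _ k := GRing.RMorphism.copy (Pi k)
  (sbst (ssub (mc (Defs.pi r k)) (me (Defs.pi r k)) \o smapr iota) (piP k)).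
Definition psiP t : {poly ser K} := toP (d %/ Nn r t) (psi t).
Definition phiQ t : {poly ser K} := toP (phideg t) (phi t).
Definition ql i := (qq r i * (size (PP r i)).-1)%N.
Definition dk k := (\prod_(u < k) ql u.+1)%N.
Definition HP k : {poly ser L} := toP (Nn r k) (HH r k).
Local Notation V k := (VV iota r phi phideg k).
Local Notation Lam k := (LL iota r phi phideg k).

Record level k : Prop := Level {
  lv_sf : is_subfield (Kf r k);
  lv_iota : forall c, Kf r k (iota c);
  lv_Y : ydeg_le (mY (Defs.pi r k)) 1;
  lv_me : (0 < me (Defs.pi r k))%N;
  lv_mc : Kf r k (mc (Defs.pi r k));
  lv_mc0 : mc (Defs.pi r k) != 0;
  lv_Yrat : ratp (Kf r k) (piP k);
  lv_N : (0 < Nn r k)%N;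
  lv_d : d = (dk k * Nn r k)%N;
  lv_H : ymonic (HH r k) (Nn r k);
  lv_H0 : forall j, HH r k (Nn r k).-1 j = 0;
  lv_HW : (0 < k)%N -> weierstrass (HH r k) (Nn r k);
  lv_Hrat : ratp (Kf r k) (HP k);
  lv_F : exists U u0 v,
    [/\ Pi k (toP d F) = (sX v)%:P * (U * HP k), u0 != 0 & AL k U u0 0 0];
  lv_V : forall t, (t < k)%N -> [/\ Lam k t.+1 != 0,
     AL k (Pi k (psiP t)) (Lam k t.+1) (V k t.+1) 0 &
     AL k (Pi k (phiQ t)) (Lam k t.+1) (V k t.+1) 0];
  lv_LI : LI iota ql k (V k) (Lam k);
  lv_psi : forall t, (t <= k)%N -> psiP t \is monic /\ size (psiP t) = (dk t).+1;
  lv_span : exists (I : finType) (b : I -> ser L) i0,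
     [/\ spans (Kf r k) (ssub (mc (Defs.pi r k)) (me (Defs.pi r k)) \o smapr iota) b, b i0 = 1
       & #|I| = dk k] }.

Hypotheses (Hchar : forall p, p \in [pchar K] -> (d < p)%N) (d0 : (0 < d)%N)
  (HF : ymonic F d) (Hrun : is_run iota d F r)
  (Hpsi : forall k, (k <= gg r)%N -> approx_root d F (Nn r k) (psi k))
  (Hphi : forall k, (k <= gg r)%N -> phi_spec iota r phi phideg k).

Lemma small_natK n : (0 < n <= d)%N -> (n%:R : K) != 0.
Proof.
case/andP=> n0 nd; apply/negP => nz.
have [p pK] := natf0_pchar n0 nz.
have : (p %| n)%N by rewrite (dvdn_pcharf pK).
by move/(dvdn_leq n0) => pn; have := Hchar pK; rewrite ltnNge (leq_trans pn).
Qed.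
Lemma small_natL n : (0 < n <= d)%N -> (n%:R : L) != 0.
Proof. by move=> h; rewrite -(rmorph_nat iota) fmorph_eq0 small_natK. Qed.

Lemma FP_monic : toP d F \is monic /\ size (toP d F) = d.+1.
Proof. exact: toP_monic. Qed.

Lemma phiQ_ofP t : (t <= gg r)%N -> ofP (phiQ t) = phi t.
Proof. by move=> tg; rewrite toPK //; case: (Hphi tg) => -[]. Qed.

Section PiFacts.
Variable k : nat.
Hypotheses (hY : ydeg_le (mY (Defs.pi r k)) 1) (hme : (0 < me (Defs.pi r k))%N).

Lemma bcomp_Pi n (p : {poly ser K}) : (size p <= n.+1)%N ->
  bcomp n (bmap iota (ofP p)) (Defs.pi r k) = ofP (Pi k p).
Proof.
move=> pn; rewrite bmap_ofP (@bcompE _ n _ _ (piP k)) ?toPK //; last first.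
  by rewrite (leq_trans (size_poly _ _)).
by rewrite /Pi /sbst /= map_poly_comp.
Qed.

Lemma VL_0 : mc (Defs.pi r k) != 0 -> V k 0 = me (Defs.pi r k) /\ Lam k 0 = mc (Defs.pi r k).
Proof.
move=> mc0; have ex : bxser = ofP (sX 1)%:P :> bser K.
  by apply: bserP => i j; rewrite ofP_xpow.
have eP : bcomp 0 (bmap iota (phiP phi 0)) (Defs.pi r k)
    = ofP (sC (mc (Defs.pi r k)) * sX (me (Defs.pi r k)))%:P.
  rewrite /phiP eqxx ex bcomp_Pi ?size_polyC_leq1 //; congr ofP.
  rewrite /Pi sbstC; congr (_%:P) => /=.
  have -> : smapr iota (sX 1) = sX 1 by apply: serP => n; rewrite /smapr /sX rmorph_nat.
  by rewrite ssub_sX // muln1 expr1.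
have eC i j : ofP (sC (mc (Defs.pi r k)) * sX (me (Defs.pi r k)))%:P i j
   = if (i == 0%N) && (j == me (Defs.pi r k)) then mc (Defs.pi r k) else 0.
  rewrite /ofP coefC; case: (i == 0%N) => //=; rewrite sCM /sX.
  by case: eqP; rewrite ?mulr1 ?mulr0.
have eV : V k 0 = me (Defs.pi r k).
  rewrite /VV /vk /degP eqxx eP; apply: (@vval_eq _ _ _ 0); first by rewrite eC !eqxx.
  by move=> i j jm; rewrite eC (ltn_eqF jm) andbF.
split=> //; move: eV; rewrite /VV /LL /vk /lk /degP eqxx eP => eV.
by rewrite (@lval_eq _ _ 0) ?eV ?eC ?eqxx.
Qed.

Lemma VL_AL t c w i : (t <= gg r)%N -> (i <= 1)%N -> c != 0 -> AL k (Pi k (phiQ t)) c w i ->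
  V k t.+1 = w /\ Lam k t.+1 = c.
Proof.
move=> tg i1 c0 h.
have eP : bcomp (phideg t) (bmap iota (phi t)) (Defs.pi r k) = ofP (Pi k (phiQ t)).
  by rewrite -(phiQ_ofP tg) bcomp_Pi // size_toP.
have cw : ofP (Pi k (phiQ t)) i w = c by apply: (AL_coef h).
have eV : vval (ofP (Pi k (phiQ t))) = w.
  by apply: (@vval_eq _ _ _ i); [rewrite cw|apply: (AL_div h)].
rewrite /VV /LL /vk /lk /phiP /degP /= eP; split=> //.
rewrite (@lval_eq _ _ i) eV ?cw // => i' lt.
have /ld_off : ld 1 1 (Pi k (phiQ t)) c w i by apply: h; split=> //; left.
by apply; [rewrite leq_add2r !mul1n ltnW|case=> e; rewrite e ltnn in lt].
Qed.
End PiFacts.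

Lemma psi_monic k dd : (k <= gg r)%N -> (0 < Nn r k)%N -> d = (dd * Nn r k)%N ->
  psiP k \is monic /\ size (psiP k) = dd.+1.
Proof.
move=> kg N0 ed; have [pm _] := Hpsi kg; have [h1 h2] := toP_monic pm.
by split=> //; rewrite h2 {1}ed mulnK.
Qed.

Definition ylead k := Lam k k.+1 != 0 /\ AL k (Pi k (phiQ k)) (Lam k k.+1) (V k k.+1) 1.

Section AtLevel.
Variable k : nat.
Hypotheses (kg : (k <= gg r)%N) (lv : level k).

Lemma dk_gt0 : (0 < dk k)%N.
Proof. by move: d0; rewrite (lv_d lv) muln_gt0 => /andP[]. Qed.

Lemma PiC c : Pi k c%:P = (ssub (mc (Defs.pi r k)) (me (Defs.pi r k)) (smapr iota c))%:P.
Proof. by rewrite /Pi sbstC. Qed.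

Lemma level_good (a : {poly ser K}) : a != 0 -> (size a <= dk k)%N ->
  exists w ka, ka != 0 /\ AL k (Pi k a) ka w 0.
Proof.
have [e1 e2] := VL_0 (lv_Y lv) (lv_me lv) (lv_mc0 lv).
apply: (@lead_exists _ _ iota ql k (Pi k) _ _ (V k) (Lam k) psiP (lv_me lv) e1 e2 PiC).
- by move=> t tk; case: (lv_V lv tk).
- exact: (lv_LI lv).
by move=> t tk; apply: (lv_psi lv); apply: ltnW.
Qed.

Lemma level_rat a : ratp (Kf r k) (Pi k a).
Proof.
apply: ratp_sbst; [exact: (lv_sf lv)| |exact: (lv_Yrat lv)].
by move=> i; apply: rats_ssub; [exact: (lv_sf lv)|exact: (lv_mc lv)|move=> j; apply: (lv_iota lv)].
Qed.

Lemma level_phi : [/\ phiQ k \is monic, size (phiQ k) = (dk k).+1 & (Pi k (phiQ k))`_0 = 0].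
Proof.
have [pm [pirr p0]] := Hphi kg; have [fm fs] := toP_monic pm.
have [I [b [i0 [hs b1 cI]]]] := lv_span lv.
set rho : {rmorphism ser K -> ser L} := ssub (mc (Defs.pi r k)) (me (Defs.pi r k)) \o smapr iota.
have hS : rats (Kf r k) (piP k)`_0 by apply: (lv_Yrat lv).
have [chi [cm cs c0]] := @charpoly_root _ _ _ rho _ _ _ _ (lv_sf lv) hs b1 hS.
have e : phiQ k = chi.
  apply: (@phi_min _ _ k (dk k) rho (piP k) level_good) => //.
  - exact: dk_gt0.
  - by rewrite cs cI.
  - by rewrite phiQ_ofP.
  have eS : ofP ((piP k)`_0)%:P = Sser r k.
    apply: bserP => i j; rewrite /ofP /Sser coefC; case: (i == 0%N) => //.
    by rewrite coef_poly.
  move: p0; rewrite -(phiQ_ofP kg) bmap_ofP.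
  rewrite (@bcompE _ _ _ (SMap (mc (Defs.pi r k)) (me (Defs.pi r k)) (Sser r k)) ((piP k)`_0)%:P) //.
  - rewrite -ofP0 => /ofP_inj/(congr1 (fun p : {poly ser L} => p`_0)).
    by rewrite sbst_coef0 coef0 coefC eqxx -map_poly_comp.
  - exact: (lv_me lv).
  by rewrite (leq_trans (size_poly _ _)) // size_toP.
by rewrite e cs cI; split=> //; rewrite /Pi sbst_coef0.
Qed.

Lemma UH_coef m q U u0 i j : wgt m q (m * Nn r k) (HP k) -> ld m q U u0 0 0 ->
  (m * i + q * j = m * Nn r k)%N -> (U * HP k)`_i j = u0 * (HP k)`_i j.
Proof.
move=> hH hU e.
have -> : U * HP k = (U - mon u0 0 0) * HP k + mon u0 0 0 * HP k by ring.
have h := wgtM hU hH; rewrite coefD serD.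
have [->|nz] := eqVneq (((U - mon u0 0 0) * HP k)`_i j) 0; last first.
  by have := h i j nz; rewrite !muln0 e add0n addSn ltnn.
by rewrite add0r /mon sX0 expr0 !mulr1 coefCM sCM.
Qed.

Lemma level_lead m q : allowed k m q -> wgt m q (m * Nn r k) (HP k) ->
  ld m q (Pi k (phiQ k)) (Lam k k.+1) (V k k.+1) 1 -> Lam k k.+1 != 0 ->
  exists U, [/\ Pi k (toP d F) = (sX (Nn r k * V k k.+1))%:P * (U * HP k),
     AL k U (Lam k k.+1 ^+ Nn r k) 0 0 &
     ld m q (Pi k (psiP k)) (Lam k k.+1) (V k k.+1) 1].
Proof.
move=> al hH hphi la0; have [U [u0 [v [eF u00 hU]]]] := lv_F lv.
have [Fm Fs] := FP_monic; have [pm ps _] := level_phi.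
have [psm pss] := lv_psi lv (leqnn k).
have N0 := lv_N lv; have ed := lv_d lv; have [_ aF] := Hpsi kg.
have dkE : (d %/ Nn r k = dk k)%N by rewrite ed mulnK.
have hd : (0 < Nn r k <= d)%N by rewrite N0 ed leq_pmull // dk_gt0.
have NK := small_natK hd.
have [N' eN] : exists N', Nn r k = N'.+1 by exists (Nn r k).-1; rewrite prednK.
have hu := hU m q al.
have cF i j : (m * i + q * j = m * Nn r k + q * v)%N ->
    (Pi k (toP d F))`_i j = if (v <= j)%N then u0 * (HP k)`_i (j - v)%N else 0.
  move=> e; rewrite eF coefCM sXM; case: leqP => // vj.
  by apply: (UH_coef hH hu); rewrite mulnBr; have := leq_mul (leqnn q) vj; lia.
have [Hm Hs] := toP_monic (lv_H lv).
have HN : (HP k)`_(Nn r k) = 1 by move/monicP: Hm; rewrite lead_coefE Hs.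
rewrite eN in NK.
have Fs' : size (toP d F) = (N'.+1 * dk k).+1 by rewrite Fs -eN [in LHS]ed mulnC.
have Fw : wgt m q (m * N'.+1 + q * v) (Pi k (toP d F)).
  rewrite eF -eN addnC; apply: wgtM; last by rewrite -[(m * _)%N]add0n; apply: wgtM.
  apply: wgtC => j; rewrite /sX; case: (j =P v) => [->|]; by rewrite ?eqxx.
have Fv : (Pi k (toP d F))`_N'.+1 v = u0.
  by rewrite cF ?eN // leqnn subnn -eN HN ser1 mulr1.
have Fv' j : (m * N' + q * j = m * N'.+1 + q * v)%N -> (Pi k (toP d F))`_N' j = 0.
  move=> e; rewrite cF ?eN //; case: ifP => // _.
  have := lv_H0 lv (j - v)%N; rewrite {1}eN /= => h0.
  by rewrite coef_poly; case: ifP => _; rewrite ?h0 ?ser0 mulr0.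
have pN : (size (toP d F - psiP k ^+ N'.+1)%R <= N' * dk k)%N.
  apply/leq_sizeP => j jN; apply: serP => x.
  have := aF j x; rewrite dkE -/(ofP _) -eN.
  have -> : bsub F (bexp (psi k) (Nn r k)) = ofP (toP d F - psiP k ^+ Nn r k).
    rewrite ofPB ofPX !toPK //; first by case: (Hpsi kg) => -[].
    by case: HF.
  by apply; move: jN; rewrite {1}ed eN mulnS mulnC addKn.
have [ev eu hl] := approx_root_lead NK dk_gt0 Fm Fs' al la0 u00 level_good Fw Fv Fv'
    psm pss pN pm ps hphi.
by exists U; rewrite eN -ev -eu.
Qed.
End AtLevel.

Lemma level0 : level 0 /\ ylead 0.
Proof.
have [hK [hN [hH [hp _]]]] := Hrun.
have [Fm Fs] := FP_monic.
pose c0 : ser L := fun j => - iota (F d.-1 j) / d%:R.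
have ep : Defs.pi r 0 = tshift c0 by [].
have hY : ydeg_le (mY (Defs.pi r 0)) 1 by rewrite ep => -[|[|i]] j.
have eY : piP 0 = 'X + c0%:P.
  by apply: ofP_inj; rewrite toPK // ep -ofP_tshift.
have ePi p : Pi 0 p = shiftP c0 (map_poly (smapr iota) p).
  rewrite /Pi eY ep /sbst /= map_poly_comp /=; congr (_ \Po _).
have hmap p n : p \is monic -> size p = n.+1 ->
    map_poly (smapr iota) p \is monic /\ size (map_poly (smapr iota) p) = n.+1.
  move=> pm ps; split; first exact: monic_map.
  by rewrite size_map_poly_id0 // (monicP pm) rmorph1 oner_neq0.
have hPi p n : p \is monic -> size p = n.+1 -> Pi 0 p \is monic /\ size (Pi 0 p) = n.+1.
  by move=> pm ps; rewrite ePi; have [h1 h2] := hmap p n pm ps; apply: shift_monic.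
have [Hm Hs] := hPi _ _ Fm Fs.
have eH : HH r 0 = ofP (Pi 0 (toP d F)).
  have hme : (0 < me (Defs.pi r 0))%N by rewrite ep.
  rewrite hH -hp -(@bcomp_Pi 0 hY hme d) ?Fs // toPK //; by case: HF.
have eHP : HP 0 = Pi 0 (toP d F) by rewrite /HP eH hN ofPK // Hs.
have KF : is_subfield (Kf r 0).
  split.
  - by apply/hK; exists 1; rewrite rmorph1.
  - by move=> x y /hK [u ->] /hK [v ->]; apply/hK; exists (u - v); rewrite rmorphB.
  - by move=> x y /hK [u ->] /hK [v ->]; apply/hK; exists (u * v); rewrite rmorphM.
  by move=> x /hK [u ->]; apply/hK; exists u^-1; rewrite fmorphV.
have hi c : Kf r 0 (iota c) by apply/hK; exists c.
have dL : (d%:R : L) != 0 by apply: small_natL; rewrite d0 leqnn.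
have c0rat : rats (Kf r 0) c0.
  move=> j; apply: sfM => //; first by apply: sfN.
  by apply: sfV => //; apply: sf_nat.
have Yrat : ratp (Kf r 0) (piP 0).
  by rewrite eY; apply: ratpD => //; [exact: ratpX|exact: ratpC].
have Prat a : ratp (Kf r 0) (Pi 0 a).
  apply: ratp_sbst => // i; rewrite ep /=; apply: rats_ssub => //; first exact: sf1.
  by move=> j; apply: hi.
have dk0 : dk 0 = 1%N by rewrite /dk big_ord0.
have me1 : me (Defs.pi r 0) = 1%N by rewrite ep.
have mc1 : mc (Defs.pi r 0) = 1 by rewrite ep.
have lv : level 0.
  apply: Level; rewrite ?me1 ?mc1 ?hN ?dk0 ?mul1n ?oner_neq0 //.
  - exact: sf1.
  - by rewrite eH; apply: ofP_monic.
  - have [d' ed] : exists d', d = d'.+1 by exists d.-1; rewrite prednK.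
    have [h1 h2] := hmap _ _ Fm Fs.
    have z : (shiftP c0 (map_poly (smapr iota) (toP d F)))`_d' = 0.
      apply: tschirnhaus; rewrite -?ed // => j.
      by rewrite coef_map /smapr /c0 coef_poly ed ltnS leqnSn.
    by move=> j; rewrite eH /ofP ePi [in X in nth _ _ X]ed /= z.
  - by rewrite eHP.
  - exists 1, 1, 0%N; rewrite sX0 !mul1r eHP oner_neq0; split=> //.
    by move=> m q _; apply: ld1.
  - have [e1 e2] : V 0 0 = 1%N /\ Lam 0 0 = 1.
      by have := @VL_0 0 hY; rewrite me1 mc1; apply; rewrite ?oner_neq0.
    by apply: LI0; rewrite ?e1 ?e2 ?oner_neq0.
  - move=> t; rewrite leqn0 => /eqP ->; rewrite dk0.
    by apply: psi_monic => //; rewrite hN ?mul1n.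
  exists 'I_1, (fun _ => 1), ord0; split; rewrite ?card_ord //; split=> [_ j|f hf].
    by rewrite ser1; apply: sf_nat.
  have /choice [c hc] : forall j, exists b, f j = iota b by move=> j; apply/hK.
  exists (fun _ => c); rewrite big_ord1 mulr1 /= ssub11.
  by apply: serP => j; rewrite hc.
split=> //.
have [pm ps p0] := level_phi (leq0n _) lv; rewrite dk0 in ps.
have [qm qs] := hPi _ _ pm ps.
have eX : Pi 0 (phiQ 0) = 'X.
  apply/polyP => -[|[|i]]; first by rewrite p0 coefX.
    by move/monicP: qm; rewrite lead_coefE qs coefX.
  by rewrite nth_default ?qs // coefX.
have hl : AL 0 (Pi 0 (phiQ 0)) 1 0 1.
  move=> m q _; rewrite eX.
  have -> : 'X = mon 1 0 1 :> {poly ser L} by rewrite /mon sC1 sX0 !mul1r expr1.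
  exact: ld_mon.
have [e1 e2] : V 0 1 = 0%N /\ Lam 0 1 = 1.
  by apply: VL_AL hl; rewrite ?me1 ?oner_neq0.
by rewrite /ylead e1 e2 oner_neq0.
Qed.
Lemma level_next k : (k < gg r)%N -> level k -> ylead k -> level k.+1 /\ ylead k.+1.
Proof.
move=> kg lv [la0 hphi]; have kg' := ltnW kg.
have [_ [_ [_ [_ [hstep _]]]]] := Hrun.
have [_ [hdeg [hroot [hKf [qs [_ [hcomp [hU0 [hW [hH hpi]]]]]]]]]] := hstep k kg.
clear hstep.
set z := zz r k.+1 in hroot hKf hcomp hpi; set q := qq r k.+1 in hdeg qs hcomp hpi.
set m := mm r k.+1 in hdeg qs hcomp hpi; set s := ss r k.+1 in qs hcomp hpi.
set t := tt r k.+1 in qs hcomp hpi; set P := PP r k.+1 in hdeg hroot hKf.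
set N := Nn r k.+1 in hdeg hW hH hpi; set G := GG r k.+1 in hcomp hW hH hpi.
have Pz : P.[z] = 0 by apply/eqP.
have [q0 [_ [[hAm _] [Pm [Po [Pirr _]]]]]] := hdeg.
have hA : Apoly k = npT \/ (Apoly k = npP /\ weierstrass (HH r k) (Nn r k)).
  by case: (k) (lv_HW lv) => [|k'] h; [left|right; split=> //; apply: h].
have eN := degen_degree (lv_H lv) (lv_N lv) hA hdeg.
have HPE i j : (HP k)`_i j = HH r k i j.
  by rewrite -[LHS]/(ofP (HP k) i j) toPK //; case: (lv_H lv).
have hw : wgt m q (m * Nn r k) (HP k).
  by move=> i j; rewrite HPE; apply: (degen_wgt (lv_H lv) (lv_N lv) hA hdeg).
have KF := lv_sf lv.
have z0 : z != 0 := degen_root_neq0 hdeg KF Pz.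
have al : allowed k m q.
  by split=> //; move: hAm; rewrite /Apoly; case: (k) => [|k'] h; [right|left].
have dkS : dk k.+1 = (dk k * ql k.+1)%N by rewrite /dk big_ord_recr.
have N0 : (0 < N)%N by move: (lv_N lv); rewrite eN muln_gt0 => /andP[].
have ql0 : (0 < ql k.+1)%N by move: (lv_N lv); rewrite eN muln_gt0 => /andP[].
have ed : d = (dk k.+1 * N)%N by rewrite dkS -mulnA [LHS](lv_d lv) eN.
have P1 : (1 < size P)%N by case: Pirr.
have l0 : (0 < (size P).-1)%N by move: P1; size_lia.
have qld : (ql k.+1 <= d)%N.
  by rewrite ed dkS mulnAC leq_pmull // muln_gt0 dk_gt0 // N0.
have qL : (q%:R : L) != 0.
  by apply: small_natL; rewrite q0 (leq_trans _ qld) // leq_pmulr.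
have lL : ((size P).-1%:R : L) != 0.
  by apply: small_natL; rewrite l0 (leq_trans _ qld) // leq_pmull.
have NL : (N%:R : L) != 0.
  by apply: small_natL; rewrite N0 ed leq_pmull // dkS muln_gt0 dk_gt0.
have KF' : is_subfield (Kf r k.+1) := adjoin_subfield KF Pm Po Pirr Pz hKf.
have KK' c : Kf r k c -> Kf r k.+1 c.
  by move=> hc; apply/hKf; exists c%:P; rewrite hornerC; split=> //; apply: poC.
have Kz : Kf r k.+1 z.
  by apply/hKf; exists 'X; rewrite hornerX; split=> //; apply: (poXn KF 1).
have Kzn n : Kf r k.+1 (z ^+ n) by apply: sfX.
pose gam : ser L := fun j => - G N.-1 j / N%:R.
have gam0 : gam 0%N = 0.
  by case: hW => _ h; rewrite /gam h ?oppr0 ?mul0r // prednK.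
pose delta := gam + sC (z ^+ s).
have delta0 : delta 0%N = z ^+ s by rewrite /delta serD gam0 add0r.
pose Ys : {poly ser L} := (sX m)%:P * ('X + (sC (z ^+ s))%:P).
have sYs : (size Ys <= 2)%N.
  apply: (leq_trans (size_polyMleq _ _)).
  have := size_polyC_leq1 (sX m : ser L); rewrite -[sC (z ^+ s)]opprK polyCN size_XsubC; size_lia.
have eS n (p : {poly ser L}) : (size p <= n.+1)%N ->
    bcomp n (ofP p) (sigmap z q m s t) = ofP (sbst (ssub (z ^+ t) q) Ys p).
  by move=> pn; apply: (@bcompE _ _ _ (sigmap z q m s t)) => //; apply: ofP_sigmap.
pose Th := theta (z ^+ t) q m delta.
have eTh p : shiftP gam (sbst (ssub (z ^+ t) q) Ys p) = Th p by apply: shift_theta.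
have [Gm Gs] := toP_monic hW.1.
set GP := toP N G in Gm Gs.
have eHP : HH r k.+1 = ofP (shiftP gam GP).
  by rewrite hH -(@bcomp_tshift _ gam GP N) ?Gs // toPK //; case: hW => -[].
have [sGm sGs] := shift_monic gam Gm Gs.
have eHP' : HP k.+1 = shiftP gam GP by rewrite /HP eHP ofPK ?sGs.
have [Hm Hs] := toP_monic (lv_H lv).
set UP := toP (Nn r k) (UU r k.+1).
have e1 : sbst (ssub (z ^+ t) q) Ys (HP k) = (sX (aa r k.+1))%:P * (UP * GP).
  have eHk : HH r k = ofP (HP k) by rewrite toPK //; case: (lv_H lv).
  have hc := hcomp; rewrite eHk eS ?Hs // in hc.
  apply: ofP_inj; rewrite hc !ofPM ofP_xpow !toPK //; first by case: hW => -[].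
  apply: (@unit_ydeg _ (aa r k.+1) _ _ _ _ hW); rewrite -hc; apply: ofP_ydeg.
  by rewrite (leq_trans (size_sbst_linear _ _ sYs)) // Hs.
have eThH : Th (HP k) = (sX (aa r k.+1))%:P * (shiftP gam UP * HP k.+1).
  by rewrite -eTh e1 !rmorphM eHP' /= /shiftP sbstC /= ssub11.
have UP0 : (shiftP gam UP)`_0 0%N != 0.
  by rewrite shift_slice0 // coef_poly.
have ratYs p : ratp (Kf r k) p -> ratp (Kf r k.+1) (sbst (ssub (z ^+ t) q) Ys p).
  move=> hp; apply: ratp_sbst => //.
    by move=> i; apply: rats_ssub => // j; apply/KK'/hp.
  apply: ratpM => //; first by apply: ratpC => //; apply: rats_sX.
  by apply: ratpD => //; [exact: ratpX|apply: ratpC => //; apply: rats_sC].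
have [_ ratG] : ratp (Kf r k.+1) UP /\ ratp (Kf r k.+1) GP.
  apply: (@weierstrass_rat _ _ KF' (aa r k.+1) UP GP N); rewrite -?e1 ?Gs //.
  - by apply: ratYs; apply: (lv_Hrat lv).
  - by rewrite coef_poly.
  - by move=> i iN; rewrite coef_poly ltnS ltnW //; apply: hW.2.
  by move/monicP: Gm; rewrite lead_coefE Gs.
have ratgam : rats (Kf r k.+1) gam.
  move=> j; apply: sfM => //; last by apply: sfV => //; apply: sf_nat.
  apply: sfN => //; have := ratG N.-1 j; rewrite coef_poly prednK // leqnSn.
  by [].
have ratdelta : rats (Kf r k.+1) delta by apply: ratsD => //; apply: rats_sC.
set pk := Defs.pi r k in hpi *.
have eme : me (Defs.pi r k.+1) = (me pk * q)%N by rewrite hpi /= muln1.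
have emc : mc (Defs.pi r k.+1) = mc pk * (z ^+ t) ^+ me pk.
  by rewrite hpi /= expr1n mulr1.
have sY : (size (piP k) <= 2)%N by apply: size_poly.
have eY1 : mY (Defs.pi r k.+1) = ofP (Th (piP k)).
  have eYk : mY pk = ofP (piP k) by rewrite toPK //; apply: (lv_Y lv).
  rewrite hpi /= eYk eS // bcomp_tshift ?eTh //.
  by rewrite (leq_trans (size_sbst_linear _ _ sYs)).
have sTY : (size (Th (piP k)) <= 2)%N.
  rewrite (leq_trans _ sY) // -eTh; apply: leq_trans (size_sbst_linear _ _ sYs).
  by apply: size_sbst_linear; rewrite -[gam]opprK polyCN size_XsubC.
have hY' : ydeg_le (mY (Defs.pi r k.+1)) 1 by rewrite eY1; apply: ofP_ydeg.
have eYP : piP k.+1 = Th (piP k) by rewrite /piP eY1 ofPK.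
have me0 := lv_me lv.
have hme' : (0 < me (Defs.pi r k.+1))%N by rewrite eme muln_gt0 me0.
have hrho f : ssub (mc (Defs.pi r k.+1)) (me (Defs.pi r k.+1)) f
    = ssub (z ^+ t) q (ssub (mc pk) (me pk) f).
  by rewrite ssub_ssub // eme emc.
have ePi a : Pi k.+1 a = Th (Pi k a).
  rewrite /Pi eYP /Th /theta sbst_sbst; apply: eq_sbst => f /=; exact: hrho.
have zt0 : z ^+ t != 0 by rewrite expf_neq0.
have mc0' : mc (Defs.pi r k.+1) != 0.
  by rewrite emc mulf_neq0 ?expf_neq0 // (lv_mc0 lv).
have AL0 x c w : AL k x c w 0 -> AL k.+1 (Th x) (c * (z ^+ t) ^+ w) (q * w) 0.
  move=> h m' q' [q'0 [m'0|//]].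
  have := @theta_ld _ (z ^+ t) q m delta _ _ _ _ q0 (h m q al); rewrite muln0 add0n.
  by move=> /(xl_ld0 m'0 q'0); rewrite expr0 coefZ coef1 mulr1.
have AL1 x c w : ld m q x c w 1 ->
    AL k.+1 (Th x) (c * (z ^+ t) ^+ w * z ^+ s) (q * w + m) 0.
  move=> h m' q' [q'0 [m'0|//]].
  have := @theta_ld _ (z ^+ t) q m delta _ _ _ _ q0 h; rewrite muln1 addnC.
  by move=> /(xl_ld0 m'0 q'0); rewrite coefZ shift_exp_coef0 delta0 expr1.
have lphi : ld m q (Pi k (phiQ k)) (Lam k k.+1) (V k k.+1) 1 by apply: hphi.
have [U1 [eF1 hU1 lpsi]] := level_lead kg' lv al hw lphi la0.
have VLk : V k.+1 k.+1 = (q * V k k.+1 + m)%N /\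
    Lam k.+1 k.+1 = Lam k k.+1 * (z ^+ t) ^+ V k k.+1 * z ^+ s.
  apply: (VL_AL hY' hme' kg' (leq0n 1)); last by rewrite ePi; apply: AL1.
  by rewrite !mulf_neq0 ?expf_neq0.
have VLt u : (u < k)%N -> V k.+1 u.+1 = (q * V k u.+1)%N /\
    Lam k.+1 u.+1 = Lam k u.+1 * (z ^+ t) ^+ V k u.+1.
  move=> uk; have [h1 h2 h3] := lv_V lv uk.
  apply: (VL_AL hY' hme' _ (leq0n 1)); last by rewrite ePi; apply: AL0.
    by apply: leq_trans kg'; apply: ltnW.
  by rewrite mulf_neq0 ?expf_neq0.
have [V00 L00] := VL_0 (lv_Y lv) (lv_me lv) (lv_mc0 lv).
have [V01 L01] := VL_0 hY' hme' mc0'.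
have VLp p : (p <= k)%N -> V k.+1 p = (q * V k p)%N /\
    Lam k.+1 p = Lam k p * (z ^+ t) ^+ V k p.
  by case: p => [|p] pk'; [rewrite V01 L01 V00 L00 eme emc mulnC|apply: VLt].
have KLam p : (p <= k.+1)%N -> Kf r k (Lam k p).
  rewrite leq_eqVlt => /orP[/eqP ->|].
    by rewrite -(AL_coef hphi); apply: level_rat.
  case: p => [|p] pk'; first by rewrite L00; apply: (lv_mc lv).
  by have [_ _ h] := lv_V lv pk'; rewrite -(AL_coef h); apply: level_rat.
have lv' : level k.+1.
  apply: Level => //.
  - by move=> c; apply/KK'/(lv_iota lv).
  - by rewrite emc; apply: sfM => //; [apply/KK'/(lv_mc lv)|apply: sfX].
  - rewrite eYP; apply: ratp_theta => // i j; apply: KK'; exact: (lv_Yrat lv).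
  - by rewrite eHP; apply: ofP_monic.
  - have [N' eN'] : exists N', N = N'.+1 by exists N.-1; rewrite prednK.
    have zN : (shiftP gam GP)`_N' = 0.
      apply: tschirnhaus => //; rewrite -?eN' // => j.
      by rewrite /gam /GP coef_poly eN' ltnS leqnSn.
    by move=> j; rewrite eHP /ofP -/N eN' /= zN.
  - move=> _; split; first by rewrite eHP; apply: ofP_monic.
    move=> i iN; rewrite eHP /ofP shift_slice0 // coef_poly ltnS ltnW //.
    exact: hW.2.
  - rewrite eHP' /shiftP; apply: ratp_sbst => //.
      by move=> i j; rewrite /= ssub11; apply: ratG.
    by apply: ratpD => //; [exact: ratpX|exact: ratpC].
  - have [U [u0 [v [eF u00 hU]]]] := lv_F lv.
    exists ((sC ((z ^+ t) ^+ v))%:P * (Th U * shiftP gam UP)),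
      ((z ^+ t) ^+ v * (u0 * (shiftP gam UP)`_0 0%N)), (q * v + aa r k.+1)%N; split.
    + have ThM x y : Th (x * y) = Th x * Th y by rewrite /Th rmorphM.
      rewrite ePi eF !ThM eThH {1}/Th /theta sbstC /= ssub_sX // sXD !polyCM; ring.
    + by rewrite !mulf_neq0 ?expf_neq0.
    move=> m' q' al'; have [q'0 [m'0|//]] := al'.
    have hc : ld m' q' (sC ((z ^+ t) ^+ v))%:P ((z ^+ t) ^+ v) 0 0.
      have -> : (sC ((z ^+ t) ^+ v))%:P = mon ((z ^+ t) ^+ v) 0 0.
        by rewrite /mon sX0 expr0 !mulr1.
      exact: ld_mon.
    apply: (ldM hc (w := 0) (w' := 0) (i := 0) (i' := 0)).
    apply: (@ldM _ m' q' _ _ 0 0 _ _ 0 0).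
      by have := AL0 _ _ _ hU m' q' al'; rewrite expr0 mulr1 muln0.
    have hx : xl (shiftP gam UP) 0 (slice (shiftP gam UP) 0).
      by split=> // i; rewrite sliceE.
    by have := xl_ld0 m'0 q'0 hx; rewrite sliceE.
  - move=> u; rewrite ltnS leq_eqVlt => /orP[/eqP ->|uk].
      have [-> ->] := VLk; rewrite !ePi; split; try by apply: AL1.
      by rewrite !mulf_neq0 ?expf_neq0.
    have [-> ->] := VLt u uk; have [h1 h2 h3] := lv_V lv uk.
    by rewrite !ePi; split; try exact: AL0; rewrite mulf_neq0 ?expf_neq0.
  - apply: (LI_step KF Pm Po Pirr Pz z0 q0 qs (lv_iota lv) _ KLam la0 _ _ _ _ (lv_LI lv)) => //.
    + by move=> p /VLp [].
    + by case: VLk.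
    + by move=> p /VLp [].
    by case: VLk.
  - move=> u; rewrite leq_eqVlt => /orP[/eqP ->|uk]; first exact: psi_monic.
    exact: (lv_psi lv).
  have [I [b [i0 [hs b1 cI]]]] := lv_span lv.
  have [I' [b' [i0' [h1 h2 h3]]]] := spans_step KF KF' Pm Po P1 Pz hKf (Kzn t) zt0 q0
    (fun c => hrho (smapr iota c)) hs b1.
  by exists I', b', i0'; split=> //; rewrite h3 cI dkS mulnC.
split=> //.
have [pm ps p0] := level_phi kg lv'.
have [psm pss] := lv_psi lv (leqnn k).
rewrite ePi in p0; rewrite dkS in ps.
have [c [f [hx f1]]] := phi_lead_step KF Pm Po Pirr Pz z0 qs al qL lL delta0
   (level_rat lv) (level_good lv) psm pss pm ps lpsi la0 p0.
have hAL : AL k.+1 (Pi k.+1 (phiQ k.+1)) f`_1 c 1.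
  by move=> m' q' [q'0 [m'0|//]]; rewrite ePi; apply: xl_ld1.
have [e2 e3] := VL_AL hY' hme' kg (leqnn 1) f1 hAL.
by rewrite /ylead e2 e3.
Qed.
End Levels.

(** * Boundary polynomials *)

Import Order.TTheory Num.Theory.

Lemma big_filter_support (T : eqType) (R : nmodType) (s : seq T) (P : pred T) (G : T -> R) :
  (forall x, x \in s -> ~~ P x -> G x = 0) ->
  \sum_(x <- s) G x = \sum_(x <- [seq x <- s | P x]) G x.
Proof.
elim: s => [|x s IH] h; first by rewrite !big_nil.
rewrite big_cons /= IH => [|y ys]; last by apply: h; rewrite inE ys orbT.
by case: ifP => [_|/negbT nP]; rewrite ?big_cons // h ?add0r // inE eqxx.
Qed.

Ltac case_em h := match goal with |- context [ClassicalEpsilon.excluded_middle_informative ?P] =>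
  destruct (ClassicalEpsilon.excluded_middle_informative P) as [h|h]; simpl end.

Section Final.
Variables (K L : fieldType) (iota : {rmorphism K -> L}) (d : nat) (F : bser K) (r : run L).
Variables (psi phi : nat -> bser K) (phideg : nat -> nat) (fp : nat -> seq nat -> K).
Hypotheses (Hchar : forall p, p \in [pchar K] -> (d < p)%N) (d0 : (0 < d)%N)
  (HF : ymonic F d) (Hrun : is_run iota d F r)
  (Hpsi : forall k, (k <= gg r)%N -> approx_root d F (Nn r k) (psi k))
  (Hphi : forall k, (k <= gg r)%N -> phi_spec iota r phi phideg k)
  (Hexp : forall k, (k <= gg r)%N -> expansion F r psi fp k).

Local Notation V k := (VV iota r phi phideg k).
Local Notation Lam k := (LL iota r phi phideg k).
Local Notation Pk := (Pi iota r).
Local Notation FP := (toP d F).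

Lemma all_levels k : (k <= gg r)%N ->
  level iota d F r psi phi phideg k /\ ylead iota r phi phideg k.
Proof.
elim: k => [|k IH] kg; first exact: level0.
by have [lv yl] := IH (ltnW kg); apply: level_next.
Qed.

Section AtLevel.
Variables (k m q : nat).
Hypotheses (kg : (k <= gg r)%N) (al : allowed k m q)
  (hw : wgt m q (m * Nn r k) (HP r k)).
Let la := Lam k k.+1.
Let Vk := V k k.+1.
Let N := Nn r k.

Let lv : level iota d F r psi phi phideg k. Proof. by case: (all_levels kg). Qed.
Let la0 : la != 0. Proof. by case: (all_levels kg) => _ []. Qed.
Let q0 : (0 < q)%N. Proof. by case: al. Qed.

Lemma final_lead : exists U, [/\ Pk k FP = (sX (N * Vk))%:P * (U * HP r k),
     ld m q U (la ^+ N) 0 0 & ld m q (Pk k (psiP d r psi k)) la Vk 1].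
Proof.
have [_ [_ hphi]] := all_levels kg.
have [U [h1 h2 h3]] := level_lead Hchar d0 HF Hpsi Hphi kg lv al hw (hphi m q al) la0.
by exists U; split=> //; apply: h2.
Qed.

Lemma HPE i j : (HP r k)`_i j = HH r k i j.
Proof. by rewrite -[LHS]/(ofP (HP r k) i j) toPK //; case: (lv_H lv). Qed.

Lemma final_wgt : wgt m q (m * N + q * (N * Vk)) (Pk k FP).
Proof.
have [U [-> hU _]] := final_lead; rewrite addnC; apply: wgtM.
  by apply: wgtC => j; rewrite /sX; case: (j =P _) => [->|]; rewrite ?eqxx.
by rewrite -[(m * N)%N]add0n; apply: wgtM.
Qed.

Lemma final_coef i j : (m * i + q * j = m * N)%N ->
  (Pk k FP)`_i (j + N * Vk)%N = la ^+ N * HH r k i j.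
Proof.
have [U [-> hU _]] := final_lead; move=> e.
by rewrite coefCM sXM leq_addl addnK (UH_coef hw hU e) HPE.
Qed.

Lemma vF_eq : vF iota d F r k = (N * Vk)%N.
Proof.
have [Fm Fs] := FP_monic HF.
have -> : vF iota d F r k = vval (ofP (Pk k FP)).
  rewrite /vF /vk -(@bcomp_Pi _ _ iota r k (lv_Y lv) (lv_me lv) d) ?Fs // toPK //.
  by case: HF.
have [_ [h1 _]] := lv_H lv.
apply: (@vval_eq _ _ _ N).
  rewrite /ofP -[(N * Vk)%N]add0n final_coef; last by rewrite muln0 addn0.
  by rewrite h1 mulr1 expf_neq0.
move=> i j jv; have [U [e _ _]] := final_lead.
by rewrite /ofP e coefCM sXM leqNgt jv.
Qed.

Lemma inB_boxed B : inB r k B <-> exists B1 i, B = rcons B1 i /\ boxed (ql r) k B1.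
Proof.
split.
  case/lastP: B => [|B1 i] [] //; rewrite size_rcons => -[sB] h.
  exists B1, i; split=> //; split=> // j jk; have := h j jk.
  by rewrite nth_rcons sB ltnS; case/andP: jk => _ ->.
move=> [B1 [i [-> [sB h]]]]; split=> [|j jk]; first by rewrite size_rcons sB.
by rewrite nth_rcons sB ltnS; case/andP: (jk) => _ ->; apply: h.
Qed.

Lemma dotBV_rcons B1 i : size B1 = k.+1 ->
  dotBV iota r phi phideg k (rcons B1 i) = (dot (V k) k B1 + i * Vk)%N.
Proof. exact: dot_rcons. Qed.

Lemma LamB_rcons B1 i : size B1 = k.+1 ->
  LamB iota r phi phideg k (rcons B1 i) = lam (Lam k) k B1 * la ^+ i / la ^+ N.
Proof.
move=> sB; rewrite /LamB nth_rcons sB ltnn eqxx expfzDr // exprnN mulrA.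
congr (_ * _ * _); rewrite /lam; apply: eq_bigr => p _.
by rewrite nth_rcons sB ltn_ord.
Qed.

Lemma nth_rcons_last (B1 : seq nat) (i : nat) : size B1 = k.+1 ->
  nth 0%N (rcons B1 i) k.+1 = i.
Proof. by move=> sB; rewrite nth_rcons sB ltnn eqxx. Qed.

Lemma expansion_face :
  (forall B, inB r k B -> fp k B != 0 ->
     (m * N + q * (N * Vk) <= m * nth 0%N B k.+1 + q * dotBV iota r phi phideg k B)%N) /\
  forall i j ss, (m * i + q * j = m * N)%N -> uniq ss ->
    (forall B, B \in ss <-> inB r k B /\ nth 0%N B k.+1 = i /\
        dotBV iota r phi phideg k B = (j + N * Vk)%N) ->
    HH r k i j = \sum_(B <- ss) iota (fp k B) * LamB iota r phi phideg k B.
Proof.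
have [hz [s [us [hs hF]]]] := Hexp kg.
pose c (B' : seq nat) : ser K := fun v => fp k (v :: B').
pose S0 := [seq B' <- s | `[< inB r k (0%N :: B') >]].
have inBv v v' B' : inB r k (v :: B') -> inB r k (v' :: B').
  by move=> [sB h]; split=> // -[|j] // /h.
have c0 B' : ~ inB r k (0%N :: B') -> c B' = 0.
  by move=> no; apply: serP => v; apply: hz => /inBv h; apply/no/h.
have eF : FP = \sum_(B' <- S0) (c B')%:P * \prod_(t < k.+1) psiP d r psi t ^+ nth 0%N B' t.
  apply: ofP_inj; rewrite toPK; last by case: HF.
  apply: bserP => i j; rewrite hF {1}/ofP coef_sum ser_sum big_filter [RHS]big_mkcond.
  apply: eq_bigr => B' _.
  have eP : PsiB psi k B' = ofP (\prod_(t < k.+1) psiP d r psi t ^+ nth 0%N B' t).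
    rewrite /PsiB (big_morph (@ofP K) (@ofPM K) (@ofP1 K)).
    apply: eq_bigr => t _; rewrite ofPX toPK //.
    by have tg : (t <= gg r)%N; [apply: leq_trans kg; rewrite -ltnS|case: (Hpsi tg) => -[]].
  have ec : (fun u v => if u == 0%N then fp k (v :: B') else 0) = ofP (c B')%:P.
    by apply: bserP => u v; rewrite /ofP coefC; case: (u == 0%N).
  rewrite ec eP -ofPM; case: asboolP => // no.
  by rewrite c0 // mul0r ofP0.
have S0P B' : B' \in S0 -> exists B2 i, [/\ B' = rcons B2 i, size B2 = k & boxed (ql r) k (0%N :: B2)].
  rewrite mem_filter => /andP[/asboolP/inB_boxed [B1 [i [e hb]]] _].
  case: B1 e hb => [|v B2] /=; first by move=> _ [].
  move=> [-> ->] hb; exists B2, i; split=> //; by case: hb => -[].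
pose g (B' : seq nat) := nth 0%N B' k.
pose M := (\max_(B' <- S0) g B').+1.
have gM B' : B' \in S0 -> (g B' < M)%N by move=> h; rewrite ltnS; apply: leq_bigmax_seq.
pose S i := [seq take k B' | B' <- S0 & g B' == i].
pose ci i (B2 : seq nat) := c (rcons B2 i).
have tk (B2 : seq nat) i : size B2 = k -> take k (rcons B2 i) = B2.
  by move=> sB; rewrite -sB -cats1 take_size_cat.
have gl (B2 : seq nat) i : size B2 = k -> g (rcons B2 i) = i.
  by move=> sB; rewrite /g nth_rcons sB ltnn eqxx.
have memS i B2 : B2 \in S i -> [/\ boxed (ql r) k (0%N :: B2), size B2 = k & rcons B2 i \in S0].
  case/mapP=> B'; rewrite mem_filter => /andP[/eqP gi h] ->.
  have [B2' [i' [e sB hb]]] := S0P B' h.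
  by move: gi h; rewrite e gl // => <- h; rewrite tk.
have Sint i B2 : size B2 = k -> rcons B2 i \in S0 -> B2 \in S i.
  by move=> sB h; apply/mapP; exists (rcons B2 i); rewrite ?tk // mem_filter gl // eqxx.
have uS i : uniq (S i).
  rewrite map_inj_in_uniq ?filter_uniq // => B1 B2.
  rewrite [B1 \in _]mem_filter [B2 \in _]mem_filter => /andP[/eqP g1 h1] /andP[/eqP g2 h2].
  have [B1' [i1 [e1 s1 _]]] := S0P B1 h1; have [B2' [i2 [e2 s2 _]]] := S0P B2 h2.
  by rewrite e1 e2 !tk // -(gl B1' i1) // -(gl B2' i2) // -e1 -e2 g1 g2 => ->.
pose act i := `[< exists B2, B2 \in S i /\ ci i B2 <> 0 >].
have [e1 e2] := VL_0 iota phi phideg (lv_Y lv) (lv_me lv) (lv_mc0 lv).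
have hlead i : act i -> exists w, let ka := \sum_(B <- sel k (me (Defs.pi r k)) (V k) (S i) w)
     iota (ci i (behead B) (head 0%N B)) * lam (Lam k) k B in
   [/\ ka != 0, exists B v, [/\ B \in S i, ci i B v != 0 & dot (V k) k (v :: B) = w],
     forall B v, B \in S i -> ci i B v != 0 -> (w <= dot (V k) k (v :: B))%N
     & AL k (Pk k (\sum_(B <- S i) (ci i B)%:P * PsiProd k (psiP d r psi) B)) ka w 0].
  move=> /asboolP hact.
  apply: (@lead_sum _ _ iota (ql r) k (Pk k) _ _ (V k) (Lam k) (psiP d r psi) (lv_me lv) e1 e2
     (@PiC _ _ iota r k)) => //.
  - by move=> t tk'; case: (lv_V lv tk').
  - exact: (lv_LI lv).
  - by move=> B2 /memS [].
have /choice [w hwi] : forall i, exists w, act i -> let ka := \sum_(B <- sel k (me (Defs.pi r k)) (V k) (S i) w)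
     iota (ci i (behead B) (head 0%N B)) * lam (Lam k) k B in
   [/\ ka != 0, exists B v, [/\ B \in S i, ci i B v != 0 & dot (V k) k (v :: B) = w],
     forall B v, B \in S i -> ci i B v != 0 -> (w <= dot (V k) k (v :: B))%N
     & AL k (Pk k (\sum_(B <- S i) (ci i B)%:P * PsiProd k (psiP d r psi) B)) ka w 0].
  move=> i; have [a|a] := boolP (act i); last by exists 0%N.
  by have [w h] := hlead i a; exists w.
clear hlead.
pose ka i := \sum_(B <- sel k (me (Defs.pi r k)) (V k) (S i) (w i))
     iota (ci i (behead B) (head 0%N B)) * lam (Lam k) k B.
pose A i := \sum_(B <- S i) (ci i B)%:P * PsiProd k (psiP d r psi) B.
pose T i := Pk k (A i * psiP d r psi k ^+ i).
pose D i := (w i + Vk * i)%N.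
have [U [_ _ lpsi]] := final_lead.
have [||||low coefF] := @compare_leads L m q (m * N + q * (N * Vk)) M (Pk k FP) T act
   (fun i => ka i * la ^+ i) D.
- rewrite eF (@big_fiber _ M _ g) // rmorph_sum; apply: eq_bigr => i _; congr (Pk k _).
  rewrite /A /S big_map big_filter mulr_suml big_seq_cond [RHS]big_seq_cond.
  apply: eq_bigr => B' /andP[h /eqP gi]; have [B2 [i' [e sB _]]] := S0P B' h.
  move: gi; rewrite e gl // => ei; rewrite tk // -ei /ci big_ord_recr /=.
  rewrite nth_rcons sB ltnn eqxx mulrA; congr (_ * _ * _).
  by apply: eq_bigr => t _; rewrite nth_rcons sB ltn_ord.
- exact: final_wgt.
- move=> i _ ai; have [h1 _ _ h2] := hwi i ai; split; first by rewrite mulf_neq0 ?expf_neq0.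
  have h := @ld_exp _ m q _ _ _ _ i lpsi; rewrite mul1n in h.
  by rewrite /T rmorphM rmorphXn; apply: ldM (h2 m q al) h.
- move=> i _ na; rewrite /T /A big_seq big1 ?mul0r ?rmorph0 // => B2 h.
  have -> : ci i B2 = 0; last by rewrite mul0r.
  by apply: contrapT => ne; move/asboolP: na; apply; exists B2.
have nzB B1 i : boxed (ql r) k B1 -> fp k (rcons B1 i) != 0 ->
    [/\ act i, (i < M)%N, (w i <= dot (V k) k B1)%N & exists v B2, B1 = v :: B2 /\ B2 \in S i].
  case: B1 => [|v B2] hb nz; first by case: hb.
  have sB : size B2 = k by case: hb => -[].
  have hS : rcons B2 i \in S0.
    rewrite mem_filter (hs _ nz) andbT; apply/asboolP/inB_boxed.
    by exists (0%N :: B2), i; split=> //; apply: (@boxed_cons _ _ v).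
  have B2S := Sint i B2 sB hS.
  have ai : act i.
    apply/asboolP; exists B2; split=> // e; case/eqP: nz.
    exact: (congr1 (fun f : ser K => f v) e).
  split=> //; first by have := gM _ hS; rewrite gl.
    by have [_ _ h _] := hwi i ai; apply: h.
  by exists v, B2.
split.
  move=> B /inB_boxed [B1 [i [-> hb]]] nz; have sB : size B1 = k.+1 by case: hb.
  have [ai iM le _] := nzB B1 i hb nz.
  rewrite nth_rcons_last // dotBV_rcons //; apply: leq_trans (low i iM ai) _.
  by rewrite leq_add2l leq_mul2l /D (mulnC Vk) leq_add2r le orbT.
move=> i j ss e uss hss.
have ec : (m * i + q * (j + N * Vk) = m * N + q * (N * Vk))%N by rewrite mulnDr addnA e.
apply: (mulfI (expf_neq0 N la0)); rewrite -final_coef // (coefF _ _ ec) mulr_sumr.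
have hin B : B \in ss -> exists B1, [/\ B = rcons B1 i, boxed (ql r) k B1, size B1 = k.+1 &
    (dot (V k) k B1 + i * Vk = j + N * Vk)%N].
  move=> /hss [/inB_boxed [B1 [i' [eB hb]]]]; have sB : size B1 = k.+1 by case: hb.
  by rewrite eB nth_rcons_last // dotBV_rcons // => -[<- hd]; exists B1.
case: ifP => [/and3P[iM ai /eqP Di]|no]; last first.
  rewrite big_seq big1 // => B /hin [B1 [-> hb sB hd]].
  have [->|nz] := eqVneq (fp k (rcons B1 i)) 0; first by rewrite rmorph0 mul0r mulr0.
  have [ai iM le _] := nzB B1 i hb nz; move: no; rewrite ai iM /=.
  have := low i iM ai; rewrite -ec leq_add2l leq_pmul2l // => le2.
  by move/eqP; case; apply/eqP; rewrite eqn_leq le2 andbT -hd /D (mulnC Vk) leq_add2r.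
rewrite /ka mulr_suml.
rewrite [RHS](@big_filter_support _ _ ss (fun B => fp k B != 0)); last first.
  by move=> B _ /negPn/eqP ->; rewrite rmorph0 mul0r mulr0.
rewrite [LHS](@big_filter_support _ _ _ (fun B => fp k (rcons B i) != 0)); last first.
  case=> [|v B2] hB; first by case/mapP: hB.
  by rewrite negbK /= /ci /c => /eqP ->; rewrite rmorph0 !mul0r.
transitivity (\sum_(B <- [seq B <- sel k (me (Defs.pi r k)) (V k) (S i) (w i) | fp k (rcons B i) != 0])
   la ^+ N * (iota (fp k (rcons B i)) * LamB iota r phi phideg k (rcons B i))).
  apply: eq_big_seq => -[|v B2]; rewrite mem_filter => /andP[_ hB]; first by case/mapP: hB.
  have [/memS [hb sB _] _] := proj1 (selP k (lv_me lv) e1 (S i) (w i) v B2) hB.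
  rewrite /ci /c /= -[v :: rcons B2 i]/(rcons (v :: B2) i) LamB_rcons /= ?sB //.
  by field; apply: expf_neq0.
rewrite -(big_map (rcons^~ i) xpredT (fun B => la ^+ N * (iota (fp k B) * LamB iota r phi phideg k B))).
apply: perm_big; apply: uniq_perm.
- rewrite map_inj_uniq; last by move=> B B' /rcons_inj [].
  by apply: filter_uniq; apply: sel_uniq.
- exact: filter_uniq.
move=> B; apply/mapP/idP.
  case=> B1; rewrite [B1 \in _]mem_filter => /andP[nz hB] ->; rewrite mem_filter nz /=.
  case: B1 nz hB => [|v B2] nz hB; first by case/mapP: hB.
  have [/memS [hb sB _] hd] := proj1 (selP k (lv_me lv) e1 (S i) (w i) v B2) hB.
  apply/hss; split; first by apply/inB_boxed; exists (v :: B2), i; split=> //; apply: (@boxed_cons _ _ 0%N).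
  rewrite nth_rcons_last /= ?sB // -/(rcons (v :: B2) i) dotBV_rcons /= ?sB //.
  by split=> //; rewrite hd -Di /D mulnC.
rewrite mem_filter => /andP[nz /hin [B1 [eB hb sB hd]]]; exists B1 => //.
rewrite eB in nz; rewrite mem_filter nz /=.
have [_ _ _ [v [B2 [eB1 B2S]]]] := nzB B1 i hb nz; rewrite eB1.
apply/(selP k (lv_me lv) e1); split=> //; rewrite -eB1.
by move: hd; rewrite -Di /D mulnC => /addIn.
Qed.
End AtLevel.

Lemma face_eq k m q i (j : int) : (k <= gg r)%N -> allowed k m q ->
  wgt m q (m * Nn r k) (HP r k) -> 0 <= j -> m%:Z * i%:Z + q%:Z * j = m%:Z * (Nn r k)%:Z ->
  Hbar r k i j = Hprime iota d F r phi phideg fp k i j.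
Proof.
move=> kg al hw; case: j => [j _ ej|//]; have [lv _] := all_levels kg.
have e : (m * i + q * j = m * Nn r k)%N by move: ej; rewrite -!PoszM -PoszD => -[].
have [hlow hface] := expansion_face kg al hw.
have q0 : (0 < q)%N by case: al.
have ev := vF_eq kg al hw.
set w0 := (j + Nn r k * V k k.+1)%N.
pose ss := [seq B <- [seq rcons (v :: B2) i | B2 <- box (ql r) k, v <- index_iota 0 w0.+1] |
   dotBV iota r phi phideg k B == w0].
have [V0 _] := VL_0 iota phi phideg (lv_Y lv) (lv_me lv) (lv_mc0 lv).
have uss : uniq ss.
  apply: filter_uniq; apply: allpairs_uniq; [exact: box_uniq|exact: iota_uniq|].
  by case=> B v [B' v'] _ _ /= [e1 /rcons_inj[e2]]; rewrite e1 e2.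
have hss B : B \in ss <-> inB r k B /\ nth 0%N B k.+1 = i /\
    dotBV iota r phi phideg k B = w0.
  split.
    rewrite mem_filter => /andP[/eqP hd /allpairsP[[B2 v] /= [/boxP hb _ eB]]].
    split; last split=> //.
      apply/inB_boxed; exists (v :: B2), i; split=> //.
      exact: (@boxed_cons _ _ 0%N).
    by rewrite eB /= nth_rcons; case: hb => -[->] _; rewrite ltnn eqxx.
  move=> [/inB_boxed [B1 [i' [eB hb]]] [hi hd]]; rewrite mem_filter hd eqxx andTb.
  have sB1 : size B1 = k.+1 by case: hb.
  have ei : i' = i by rewrite -hi eB nth_rcons sB1 ltnn eqxx.
  rewrite ei in eB; case: B1 eB hb sB1 => [|v B2] // eB hb [sB].
  apply/allpairsP; exists (B2, v); split=> //.
    by apply/boxP; apply: (@boxed_cons _ _ v).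
  rewrite eB in hd.
  rewrite mem_index_iota /= ltnS -hd -/(rcons (v :: B2) i) dotBV_rcons /= ?sB //.
  rewrite dot_cons V0 -!addnA; apply: leq_trans (leq_addr _ _).
  by rewrite leq_pmulr // (lv_me lv).
have E := hface i j ss e uss hss.
rewrite /Hbar /Hprime.
case_em hon; last by case_em h => //; case: h => w [_ [_ h]]; case: hon.
case: hon => _ hon; case_em no.
  rewrite (@fsum_eq _ _ _ ss) // => B; rewrite hss; split=> -[h1 [h2 h3]]; split=> //; split=> //.
    by rewrite h3 ev PoszD.
  by move: h3; rewrite ev -PoszD => -[].
rewrite /= E big_seq big1 // => B /hss [h1 [h2 h3]].
have [->|nz] := eqVneq (fp k B) 0; first by rewrite rmorph0 mul0r.
case: no; exists w0; split; last by split=> //; rewrite ev /w0 PoszD addrK.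
split; first by exists B.
move=> B' b1 b2 b3; have := hlow B' b1 b3; rewrite b2 -e -addnA leq_add2l -mulnDr.
by rewrite leq_pmul2l.
Qed.

Lemma on_np_line k i (j : int) : (k < gg r)%N -> on_np npT (HH r k) i j ->
  exists m q, [/\ allowed k m q, wgt m q (m * Nn r k) (HP r k), 0 <= j &
    m%:Z * i%:Z + q%:Z * j = m%:Z * (Nn r k)%:Z].
Proof.
move=> kg hon; have [lv _] := all_levels (ltnW kg).
have [_ [_ [_ [_ [hstep _]]]]] := Hrun.
have [_ [hdeg _]] := hstep k kg.
set q := qq r k.+1 in hdeg; set m := mm r k.+1 in hdeg.
have [q0 [_ [[hAm [c0 [hs [_ hline]]]] _]]] := hdeg.
have hA : Apoly k = npT \/ (Apoly k = npP /\ weierstrass (HH r k) (Nn r k)).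
  by case: (k) (lv_HW lv) => [|k'] h; [left|right; split=> //; apply: h].
have [hdegH [hN _]] := lv_H lv.
have ec0 : c0 = m%:Z * (Nn r k)%:Z.
  have := hline (Nn r k) 0%N; rewrite hN oner_neq0 mulr0 addr0 => <- //.
  exact: (np_top (lv_H lv) (lv_N lv) hA hdeg).
exists m, q.
have [a [b [c [i1 [j1 [i2 [j2 [_ [[b0 hab] [n1 [n2 [e1 [e2 [i12 e]]]]]]]]]]]]]] := hon.
have i2N : (i2 <= Nn r k)%N.
  by rewrite leqNgt; apply/negP => lt; move: n2; rewrite hdegH ?eqxx.
have on_line i' j' : HH r k i' j' != 0 -> a * i'%:Z + b * j'%:Z = c ->
    m%:Z * i'%:Z + q%:Z * j'%:Z = m%:Z * (Nn r k)%:Z.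
  move=> nz el; have i'N : (i' <= Nn r k)%N.
    by rewrite leqNgt; apply/negP => lt; move: nz; rewrite hdegH ?eqxx.
  case: hA => [eA|[eA [_ hW]]].
    rewrite -ec0; apply: hline => //; rewrite eA.
    by exists a, b, c, i', j', i', j'; rewrite leqnn.
  case: (ltrP 0 a) => a0.
    rewrite -ec0; apply: hline => //; rewrite eA.
    by exists a, b, c, i', j', i', j'; rewrite leqnn.
  have : c <= a * (Nn r k)%:Z + b * 0%:Z by apply: hab; rewrite hN oner_neq0.
  have j0 : j' = 0%N.
    move: (hab (Nn r k) 0%N); rewrite hN oner_neq0 => /(_ isT) le.
    have : a * (Nn r k)%:Z <= a * i'%:Z by rewrite ler_wnM2l // lez_nat.
    case: j' el {nz} => // j' el h.
    have : 0 < b * j'.+1%:Z by rewrite pmulr_rgt0.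
    lia.
  case: (ltngtP i' (Nn r k)) => [lt|lt|->] _; last by rewrite j0 mulr0 addr0.
    by move: nz; rewrite j0 hW ?eqxx.
  by move: i'N; rewrite leqNgt lt.
have l1 := on_line _ _ n1 e1; have l2 := on_line _ _ n2 e2.
have el : m%:Z * i%:Z + q%:Z * j = m%:Z * (Nn r k)%:Z.
  have bq : b * (m%:Z * i%:Z + q%:Z * j - m%:Z * (Nn r k)%:Z) = 0.
    case: (eqVneq i1 i2) => [ei|ne].
      have ii : i = i1 by lia.
      have -> : b * (m%:Z * i%:Z + q%:Z * j - m%:Z * (Nn r k)%:Z)
         = b * (m%:Z * i%:Z - m%:Z * (Nn r k)%:Z) + q%:Z * (a * i%:Z + b * j) - q%:Z * a * i%:Z by ring.
      by rewrite e -e1 -l1 ii; ring.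
    have s : q%:Z * a = m%:Z * b.
      have : (i2%:Z - i1%:Z) * (q%:Z * a - m%:Z * b) = 0.
        have -> : (i2%:Z - i1%:Z) * (q%:Z * a - m%:Z * b)
          = q%:Z * (a * i2%:Z + b * j2%:Z) - q%:Z * (a * i1%:Z + b * j1%:Z)
            - b * (m%:Z * i2%:Z + q%:Z * j2%:Z) + b * (m%:Z * i1%:Z + q%:Z * j1%:Z) by ring.
        by rewrite e1 e2 l1 l2; ring.
      move/eqP; rewrite mulf_eq0 !subr_eq0 => /orP[/eqP[] e3|/eqP //].
      by move: ne; rewrite e3 eqxx.
    have -> : b * (m%:Z * i%:Z + q%:Z * j - m%:Z * (Nn r k)%:Z)
         = (m%:Z * b - q%:Z * a) * i%:Z + q%:Z * (a * i%:Z + b * j) - b * (m%:Z * (Nn r k)%:Z) by ring.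
    rewrite e -e1 -l1.
    transitivity ((m%:Z * b - q%:Z * a) * (i%:Z - i1%:Z)); first by ring.
    by rewrite s subrr mul0r.
  by move/eqP: bq; rewrite mulf_eq0 (gt_eqF b0) /= subr_eq0 => /eqP.
split=> //.
- by split=> //; move: hAm; rewrite /Apoly; case: (k) => [|k'] h; [right|left].
- by move=> i' j'; rewrite HPE //; [apply: (degen_wgt (lv_H lv) (lv_N lv) hA hdeg)|exact: ltnW].
have : 0 <= q%:Z * j.
  have : m%:Z * i%:Z <= m%:Z * (Nn r k)%:Z.
    by rewrite ler_wpM2l // lez_nat; case/andP: i12 => _ h; apply: leq_trans i2N.
  by move: el; lia.
by rewrite pmulr_rge0.
Qed.

Lemma on_lower_line k i (j : int) : (k <= gg r)%N -> on_lower (HH r k) (Nn r k) i j ->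
  exists m q, [/\ allowed k m q, wgt m q (m * Nn r k) (HP r k), 0 <= j &
    m%:Z * i%:Z + q%:Z * j = m%:Z * (Nn r k)%:Z].
Proof.
move=> kg [a [b [c [i1 [j1 [[b0 hab] [n1 [_ [e1 [ec [i1N [/andP[_ iN] e]]]]]]]]]]]].
have [lv _] := all_levels kg.
have ae : a * ((Nn r k)%:Z - i1%:Z) = b * j1%:Z by rewrite mulrBr ec -e1; ring.
have Ni : 0 < (Nn r k)%:Z - i1%:Z by rewrite subr_gt0 ltz_nat.
have a0 : 0 <= a.
  by rewrite -(pmulr_lge0 a Ni) ae mulr_ge0 // ltW.
have apos : (0 < k)%N -> 0 < a.
  move=> k0; rewrite -(pmulr_lgt0 a Ni) ae pmulr_rgt0 // ltz_nat lt0n.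
  apply: contraNneq n1 => z; rewrite z; have [_ hW] := lv_HW lv k0.
  by rewrite hW.
case: a ae ec e e1 a0 apos hab => [m|//] ae ec e e1 a0 apos hab.
case: b b0 ae e e1 hab => [q|//] b0 ae e e1 hab.
have j0 : 0 <= j.
  rewrite -(pmulr_rge0 j b0); have -> : q%:Z * j = m%:Z * ((Nn r k)%:Z - i%:Z).
    by rewrite mulrBr ec -e; ring.
  by rewrite mulr_ge0 // subr_ge0 lez_nat.
exists m, q; split=> //; last by rewrite ec.
  by split=> //; case: (k) apos => [|k'] h; [right|left; apply: h].
by move=> i' j'; rewrite HPE // => /hab; rewrite -ec; lia.
Qed.
End Final.

Unset Implicit Arguments.

Theorem theorem7 (K L : fieldType) (iota : {rmorphism K -> L}) (d : nat) (F : bser K)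
  (r : run L) (psi phi : nat -> bser K) (phideg : nat -> nat)
  (fp : nat -> seq nat -> K) :
  perfect_field K ->
  (forall p, p \in [pchar K] -> (d < p)%N) ->
  (0 < d)%N ->
  ymonic F d ->
  is_run iota d F r ->
  (forall k, (k <= gg r)%N -> approx_root d F (Nn r k) (psi k)) ->
  (forall k, (k <= gg r)%N -> phi_spec iota r phi phideg k) ->
  (forall k, (k <= gg r)%N -> expansion F r psi fp k) ->
  (forall k, (k < gg r)%N -> forall (i : nat) (j : int),
      Hbar r k i j = Hprime iota d F r phi phideg fp k i j) /\
  (forall (i : nat) (j : int), on_lower (HH r (gg r)) (Nn r (gg r)) i j ->
      Hbar r (gg r) i j = Hprime iota d F r phi phideg fp (gg r) i j).
Proof.
move=> _ Hchar d0 HF Hrun Hpsi Hphi Hexp; split=> [k kg i j|i j hl].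
  have [hon|hoff] := pselect (on_np npT (HH r k) i j); last first.
    rewrite /Hbar /Hprime; case_em h1; first by case: h1.
    by case_em h2 => //; case: h2 => w [_ [_ h]].
  have [m [q [al hw j0 e]]] := on_np_line Hchar d0 HF Hrun Hpsi Hphi kg hon.
  exact: (face_eq Hchar d0 HF Hrun Hpsi Hphi Hexp (ltnW kg) al hw j0 e).
have [m [q [al hw j0 e]]] := on_lower_line Hchar d0 HF Hrun Hpsi Hphi (leqnn _) hl.
exact: (face_eq Hchar d0 HF Hrun Hpsi Hphi Hexp (leqnn _) al hw j0 e).
Qed.
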